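(* Let $\alpha\ge 0$ with $\alpha\notin\pi\mathbb Q$. Fix $x\in(0,\pi)$ and let $(\varphi(n))_{n\ge1}$ be an increasing sequence of positive integers such that $\varphi(n)\alpha\ \mathrm{mod}\ \pi$ converges to $x$ as $n$ goes to infinity. Then $$\lim_{n\to+\infty}\left|\frac{\mathbb E\left[\mathcal N(f_{\varphi(n)},[0,2\pi])\right]}{\varphi(n)}-\ell^\alpha(x)\right|=0.$$
   Context: Let $(a_k)_{k\ge1}$ and $(b_k)_{k\ge1}$ be two independent (centered) stationary Gaussian processes with $\mathbb E[a_ka_l]=\mathbb E[b_kb_l]=\cos((k-l)\alpha)$ and $\mathbb E[a_kb_l]=0$ for all $k,l\ge1$. For $n\ge 1$ and $t\in\mathbb R$ set $f_n(t)=\frac{1}{\sqrt n}\sum_{k=1}^n\big(a_k\cos(kt)+b_k\sin(kt)\big)$. $\mathcal N(f_n,[0,2\pi])$ denotes the number of real zeros of $f_n$ in $[0,2\pi]$. For $x\in(0,\pi)$ define $$g_x^\alpha(s,u)=\frac{\sin(x)\sin\left(\frac{s-\alpha}{2}\right)\sin\left(\frac{s+\alpha}{2}\right)}{\sin^2\left(\frac{u-x}{2}\right)\sin^2\left(\frac{s+\alpha}{2}\right)+\sin^2\left(\frac{u+x}{2}\right)\sin^2\left(\frac{s-\alpha}{2}\right)},$$ $$\ell^\alpha(x)=\frac{1}{4\pi^2}\int_{[0,2\pi]^2}\sqrt{1+|g_x^\alpha(s,u)|^2}\,ds\,du$$ (the integrand is defined almost everywhere). For real $y$, $y\ \mathrm{mod}\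 \pi$ denotes the representative of $y$ modulo $\pi$ in $[0,\pi)$. *)

(* Defs.v *)
From HB Require Import structures.
From mathcomp Require Import all_boot all_order all_algebra.
From mathcomp Require Import all_classical all_reals all_analysis.

Set Implicit Arguments.
Unset Strict Implicit.
Unset Printing Implicit Defensive.

Import Order.TTheory GRing.Theory Num.Theory.
Import numFieldNormedType.Exports.

Local Open Scope classical_set_scope.
Local Open Scope ring_scope.

Section processes.
Context d (T : measurableType d) (R : realType) (P : probability T R).

(* The laws N(m, s^2), with s = 0 meaning the Dirac mass at m. The case s = 0 is
   separate because [normal_prob m 0] is a uniform law. Degenerate laws do occur:
   the covariance cos((k - l) alpha) has rank 2. *)
Definition gaussian_rv (X : T -> R) :=
  exists m s : R, 0 <= s /\
    forall A : set R, measurable A ->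
      P (X @^-1` A) = if s == 0 then \d_m A else normal_prob m s A.

(* Processes are indexed by k >= 1; the value at k = 0 is never used. *)
Definition gaussian_process (X : nat -> {RV P >-> R}) :=
  forall (n : nat) (c : nat -> R),
    gaussian_rv (fun w => \sum_(1 <= k < n.+1) c k * X k w).

(* The sigma-algebra generated by the family (X k), k >= 1. *)
Definition sigma_process (X : nat -> {RV P >-> R}) : set (set T) :=
  <<s \bigcup_(k in [set k | (0 < k)%N])
        preimage_set_system setT (X k) measurable >>.

Definition independent_processes (X Y : nat -> {RV P >-> R}) :=
  forall A B : set T, sigma_process X A -> sigma_process Y B ->
    P (A `&` B) = (P A * P B)%E.

(* For a Gaussian process, being centered with covariance depending only on
   k - l is what being (centered and) stationary means. *)
Definition centered_gaussian_process_cov (rho : int -> R)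
    (X : nat -> {RV P >-> R}) :=
  [/\ gaussian_process X,
      forall k, (0 < k)%N -> ('E_P[X k] = 0)%E &
      forall k l, (0 < k)%N -> (0 < l)%N ->
        ('E_P[(X k \* X l)%R])%E = (rho (k%:Z - l%:Z))%:E].

Definition trig_poly (a b : nat -> {RV P >-> R}) (n : nat) (w : T) (t : R) : R :=
  (Num.sqrt n%:R)^-1 *
  \sum_(1 <= k < n.+1) (a k w * cos (k%:R * t) + b k w * sin (k%:R * t)).

End processes.

Section deterministic.
Context (R : realType).

(* +oo if there are infinitely many zeros. *)
Definition nb_zeros (f : R -> R) (I : set R) : \bar R :=
  counting [set t | I t /\ f t = 0].

Definition modpi (y : R) : R := y - (Num.floor (y / pi))%:~R * pi.

Definition g_fun (alpha x s u : R) : R :=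
  (sin x * sin ((s - alpha) / 2) * sin ((s + alpha) / 2)) /
  (sin ((u - x) / 2) ^+ 2 * sin ((s + alpha) / 2) ^+ 2 +
   sin ((u + x) / 2) ^+ 2 * sin ((s - alpha) / 2) ^+ 2).

Definition ell (alpha x : R) : \bar R :=
  (((4 * pi ^+ 2)^-1)%:E *
   \int[lebesgue_measure \x lebesgue_measure]_(p in
          `[0%R, (2 * pi)%R] `*` `[0%R, (2 * pi)%R])
     (Num.sqrt (1 + `|g_fun alpha x p.1 p.2| ^+ 2))%:E)%E.

End deterministic.

(* Main.v *)
(* The covariance of f_n is explicit: with D(t) = sin(n t / 2) / sin(t / 2),
   Cov(f_n(s), f_n(t)) = cos((n + 1)(t - s) / 2) (D(s - alpha) D(t - alpha) + D(s + alpha) D(t + alpha)) / (2 n).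
   So the Kac formula expresses the expected number of zeros as
   (1 / pi) int_0^(2 pi) sqrt(((n + 1) / 2)^2 + w(t)^2) dt, where w is the angular speed of
   the plane curve (D(t - alpha), D(t + alpha)). The Kac formula comes from counting sign changes of
   f_n at distance h: P(f_n(t) f_n(t + h) < 0) = acos(correlation) / pi, and the zeros are almost
   surely simple (Bulinskaya), since P(|f_n(t)| <= e) = O(e) uniformly in t.

   The function w depends on t both slowly and fast, through n t. Averaging over
   t = s + O(1 / n) with n t = u + n alpha - x_n modulo 2 pi, where x_n = n alpha mod pi, turns
   int G(t) dt into (1 / 2 pi) intint G(t_n(s, u)) ds du, and 2 |w| / n converges pointwise to
   |g_x(s, u)| along the subsequence. Convergence of the integrals of sqrt(1 + .^2) then follows
   as in Scheffe's lemma, because there is no loss of mass: the process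
   a_1 D(t - alpha) + b_1 D(t + alpha) changes sign at most n + 2 times, so its own Kac formula gives
   int |w| <= pi (n + 2), while |g_x(s, .)| is a Poisson kernel of integral 2 pi. *)

Require Import Defs.
From HB Require Import structures.
From mathcomp Require Import all_boot all_order all_algebra.
From mathcomp Require Import all_classical all_reals all_analysis.
From mathcomp Require Import measurable_realfun finmap ring lra.
Set Implicit Arguments.
Unset Strict Implicit.
Unset Printing Implicit Defensive.
Import Order.TTheory GRing.Theory Num.Theory.
Import numFieldNormedType.Exports.
Local Open Scope classical_set_scope.
Local Open Scope ring_scope.

(** * Integration against Gaussian laws *)

(** Joint Gaussianity is given through the one-dimensional laws of linear combinations. A pair of
    values of the process is therefore known through the expectations of cosines and sines of its
    combinations, which depend on the variance alone. Each pair is compared with two rotated copies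
    of the orthonormal pair (a_1, b_1), and the sign probability comes from this comparison, with no
    bivariate density; that density would degenerate at correlation 1, which is where h tends to 0.
    The irrationality of alpha / pi acts at finite n: sin(n alpha) differs from 0, so the two
    kernels have no common zero and the variance is positive at every t. The condition 0 < x < pi
    does the same for the limit kernel. The Scheffe step is tight because the two bounds meet: 2 pi
    (2 / n) pi (n + 2) tends to 4 pi^2, which is also the integral over s of the Poisson mass 2 pi.
    Fatou's lemma and this bound leave no room for escaping mass. *)

Section density.
Context d (T : measurableType d) (R : realType).
Variables (mu nu : {measure set T -> \bar R}) (f : T -> R).
Hypotheses (mf : measurable_fun setT f) (f0 : forall x, 0 <= f x).
Hypothesis nuE : forall A, measurable A -> nu A = (\int[mu]_(x in A) (f x)%:E)%E.

Import HBNNSimple.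

Let ge0_integral_density_nnsfun (h : {nnsfun T >-> R}) :
  (\int[nu]_x (h x)%:E = \int[mu]_x ((h x)%:E * (f x)%:E))%E.
Proof.
under [LHS]eq_integral do rewrite fimfunE -fsumEFin//.
rewrite [LHS]ge0_integral_fsum//; last 2 first.
  - by move=> r; exact/measurable_EFinP/measurableT_comp.
  - by move=> n x _; rewrite EFinM nnfun_muleindic_ge0.
under [RHS]eq_integral.
  move=> x xD; rewrite fimfunE -fsumEFin// muleC ge0_mule_fsumr; last first.
    by move=> r; rewrite EFinM nnfun_muleindic_ge0.
  over.
rewrite [RHS]ge0_integral_fsum//; last 2 first.
  - move=> r; apply/measurable_EFinP; apply: measurable_funM => //.
    exact: measurableT_comp.
  - by move=> n x _; rewrite mule_ge0 ?lee_fin//; exact: nnfun_muleindic_ge0.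
apply: eq_fsbigr => r _.
have mh : measurable (h @^-1` [set r]) by [].
(* A negative value [r] is never attained by [h], so both sides vanish; for [r >= 0] the factor can
   leave the integral. *)
have [r0|r0] := leP 0 r; last first.
  rewrite !integral0_eq// => x _; rewrite indicE.
    case: (boolP (x \in _)) => [|_]; last by rewrite mulr0 mule0.
    by move=> /set_mem/= hr; move: r0; rewrite -hr ltNge fun_ge0.
  case: (boolP (x \in _)) => [|_]; last by rewrite mulr0.
  by move=> /set_mem/= hr; move: r0; rewrite -hr ltNge fun_ge0.
under eq_integral do rewrite EFinM.
have m1 : measurable_fun setT (fun x => (\1_(h @^-1` [set r]) x)%:E : \bar R).
  exact/measurable_EFinP.
rewrite ge0_integralZl//.
rewrite integral_indic// setIT nuE//.
under [RHS]eq_integral do rewrite EFinM muleCA.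
rewrite ge0_integralZl//; last 2 first.
  - by apply: emeasurable_funM => //; exact/measurable_EFinP.
  - by move=> x _; rewrite mule_ge0// lee_fin.
congr (_ * _)%E; rewrite integral_mkcond; apply: eq_integral => x _.
by rewrite patchE indicE; case: ifP => _; rewrite ?mule1 ?mule0.
Qed.

Lemma ge0_integral_density (g : T -> \bar R) :
  measurable_fun setT g -> (forall x, 0 <= g x)%E ->
  (\int[nu]_x g x = \int[mu]_x (g x * (f x)%:E))%E.
Proof.
move=> mg g0; pose g_ := nnsfun_approx measurableT mg.
transitivity (limn (fun n => \int[nu]_x (g_ n x)%:E)%E).
  rewrite -monotone_convergence//=.
  - apply: eq_integral => x _; apply/esym/cvg_lim => //=.
    exact: cvg_nnsfun_approx.
  - by move=> n; exact/measurable_EFinP/measurable_funTS.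
  - by move=> n x _; rewrite lee_fin.
  - by move=> x _ m n mn; rewrite lee_fin; exact/lefP/nd_nnsfun_approx.
under eq_fun do rewrite ge0_integral_density_nnsfun.
rewrite -monotone_convergence//=.
- apply: eq_integral => x _; apply/cvg_lim => //=.
  apply: cvgeZr; first by [].
  exact: cvg_nnsfun_approx.
- move=> n; apply: emeasurable_funM; first exact/measurable_EFinP/measurable_funTS.
  exact/measurable_EFinP.
- by move=> n x _; rewrite mule_ge0// lee_fin.
- move=> x _ m n mn; rewrite lee_wpmul2r ?lee_fin//.
  exact/lefP/nd_nnsfun_approx.
Qed.
End density.

(** * Affine changes of variable and symmetry for normal laws *)

Section standard_normal.
Context {R : realType}.
Notation mu := (@lebesgue_measure R).
Notation nu := (@normal_prob R 0 1).

Lemma ge0_integral_normal_prob (m s : R) (g : R -> \bar R) : 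
  measurable_fun setT g -> (forall x, 0 <= g x)%E ->
  (\int[normal_prob m s]_x g x = \int[mu]_x (g x * (normal_pdf m s x)%:E))%E.
Proof.
move=> mg g0; apply: ge0_integral_density => //.
- exact: measurable_normal_pdf.
- exact: normal_pdf_ge0.
Qed.

Lemma normal_pdf_affine (m s x : R) : 0 < s ->
  normal_pdf m s (m + s * x) * s = normal_pdf 0 1 x.
Proof.
move=> s0; have s1 : s != 0 by rewrite gt_eqF.
rewrite !normal_pdfE ?oner_neq0// /normal_peak /normal_fun.
rewrite mulrAC; congr (_ * _).
  rewrite -mulrnAr expr1n mul1r.
  have -> : Num.ExtraDef.sqrtr (s ^+ 2 * (pi *+ 2)) = s * Num.ExtraDef.sqrtr (pi *+ 2).
    by rewrite sqrtrM ?sqr_ge0// sqrtr_sqr gtr0_norm.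
  by rewrite invfM mulrAC mulVf ?mul1r.
by congr expR; field.
Qed.

Lemma ge0_integral_affine (m s : R) (G : R -> R) : 0 < s ->
  continuous G -> (forall x, 0 <= G x) ->
  (\int[mu]_x (G x)%:E = \int[mu]_x (G (m + s * x) * s)%:E)%E.
Proof.
move=> s0 cG G0.
have Fd (x : R) : is_derive x 1 (fun x => m + s * x : R) s.
  by apply: is_derive_eq; rewrite add0r mul1r /GRing.scale/= mulr1.
have F'E : (fun x : R => m + s * x : R)^`()%classic = cst s.
  by apply/funext => x; rewrite derive1E derive_val.
rewrite (@increasing_ge0_integration_by_substitutionT _ (fun x => m + s * x))//.
- by apply: eq_integral => x _; rewrite F'E.
- by move=> x y xy; rewrite ltrD2l ltr_pM2l.
- by rewrite F'E => x; exact: cvg_cst.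
- by rewrite F'E; exact: is_cvg_cst.
- by rewrite F'E; exact: is_cvg_cst.
- apply/cvgrNyPle => A; near=> x.
  rewrite -lerBrDl -ler_pdivlMl//; near: x.
- apply/cvgryPge => A; near=> x.
  rewrite -lerBlDl -ler_pdivrMl//; near: x.
Unshelve. all: by end_near.
Qed.

Lemma integral_normal_prob_std (m s : R) (G : R -> R) : 0 < s ->
  continuous G -> (forall x, 0 <= G x) ->
  (\int[normal_prob m s]_x (G x)%:E = \int[nu]_x (G (m + s * x))%:E)%E.
Proof.
move=> s0 cG G0.
have mG : measurable_fun setT G by exact: continuous_measurable_fun.
have cF : continuous (fun x => m + s * x : R).
  by move=> x; apply: cvgD; [exact: cvg_cst|apply: cvgM; [exact: cvg_cst|exact: cvg_id]].
rewrite [LHS]ge0_integral_normal_prob//; last exact/measurable_EFinP.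
have mGF : measurable_fun setT (fun x => (G (m + s * x))%:E).
  apply/measurable_EFinP; apply: (measurableT_comp mG).
  exact: continuous_measurable_fun.
have -> := @ge0_integral_normal_prob 0 1 _ mGF (fun x => ltac:(by rewrite lee_fin)).
under eq_integral do rewrite -EFinM.
rewrite (@ge0_integral_affine m s)//; last 2 first.
- move=> x; apply: cvgM; first exact: cG.
  by apply: continuous_normal_pdf; rewrite gt_eqF.
- by move=> x; rewrite mulr_ge0// normal_pdf_ge0.
apply: eq_integral => x _; rewrite -EFinM; congr EFin; rewrite -mulrA; congr (_ * _).
exact: normal_pdf_affine.
Qed.

Lemma integral_normal_prob_sym (G : R -> R) :
  continuous G -> (forall x, 0 <= G x) ->
  (\int[nu]_x (G (- x))%:E = \int[nu]_x (G x)%:E)%E.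
Proof.
move=> cG G0.
have mG : measurable_fun setT G by exact: continuous_measurable_fun.
rewrite [LHS]ge0_integral_normal_prob//; last 2 first.
- by apply/measurable_EFinP; exact: measurableT_comp.
- by move=> x; rewrite lee_fin.
rewrite [RHS]ge0_integral_normal_prob//; last exact/measurable_EFinP.
pose f (x : R) := ((G x)%:E * (normal_pdf 0 1 x)%:E)%E.
have mf : measurable_fun setT f.
  apply: emeasurable_funM; apply/measurable_EFinP => //.
  exact: measurable_normal_pdf.
have f0 x : (0 <= f x)%E by rewrite mule_ge0 ?lee_fin ?normal_pdf_ge0.
transitivity (\int[mu]_x f (- x)%R)%E.
  apply: eq_integral => x _; rewrite /f; congr (_ * _%:E)%E.
  by rewrite !normal_pdfE ?oner_neq0// /normal_fun !subr0 sqrrN.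
transitivity (\int[pushforward mu (-%R : measurableTypeR R -> measurableTypeR R)]_x f x)%E.
  rewrite ge0_integral_pushforward//= ?preimage_setT//.
apply: eq_measure_integral => //= A mA AS; exact: lebesgue_measureN.
Qed.
End standard_normal.

Lemma integral_cst_probability d (T : measurableType d) (R : realType)
  (P : probability T R) (r : R) : (\int[P]_x r%:E = r%:E)%E.
Proof.
have /= -> := @integral_cst _ _ _ P _ measurableT r%:E.
by rewrite probability_setT mule1.
Qed.

(** * Gaussian variables seen through nonnegative test functions *)

Section gaussian_laws.
Context d (T : measurableType d) (R : realType) (P : probability T R).
Notation mu := (@lebesgue_measure R).
Notation nu := (@normal_prob R 0 1).

Lemma integral_of_normal_law (X : {RV P >-> R}) (m s : R) (G : R -> \bar R) :
  (forall A : set R, measurable A -> P (X @^-1` A) = normal_prob m s A) ->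
  measurable_fun setT G -> (forall x, (0 <= G x)%E) ->
  (\int[P]_w G (X w) = \int[normal_prob m s]_x G x)%E.
Proof.
move=> XE mG G0.
have mX : measurable_fun setT (X : T -> measurableTypeR R).
  by move=> mT A mA; have := @measurable_funP _ _ _ _ setT X mT A mA.
pose X' : {mfun T >-> measurableTypeR R} :=
  HB.pack (X : T -> measurableTypeR R) (isMeasurableFun.Build _ _ _ _ _ mX).
rewrite -[LHS](@ge0_integral_pushforward _ _ _ (measurableTypeR R) _ X' _ P setT G)//.
apply: (@eq_measure_integral _ (measurableTypeR R) R setT (normal_prob m s) (pushforward P X') G).
by move=> A mA _; exact: XE.
Qed.
(** Testing against continuous [G] brings the two cases of [gaussian_rv] under one formula: for
    [s = 0] the right-hand integrand is the constant [G m]. *)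
Lemma gaussian_rv_integral (X : {RV P >-> R}) :
  gaussian_rv P X -> exists m s : R, 0 <= s /\
  forall G : R -> R, continuous G -> (forall x, 0 <= G x) ->
    (\int[P]_w (G (X w))%:E = \int[nu]_x (G (m + s * x))%:E)%E.
Proof.
move=> [m [s [s0 XE]]]; exists m, s; split => // G cG G0.
have mG : measurable_fun setT G by exact: continuous_measurable_fun.
have mG' : measurable_fun setT (EFin \o G) by exact/measurable_EFinP.
rewrite -(@ge0_integral_distribution _ _ _ _ _ P X (EFin \o G))//.
have [s00|s00] := eqVneq s 0.
  transitivity (\int[\d_m]_x (G x)%:E)%E.
    apply: eq_measure_integral => A mA _.
    by have := XE A mA; rewrite s00 eqxx.
  rewrite integral_dirac// diracT mul1e s00.
  under eq_integral do rewrite mul0r addr0.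
  by rewrite (integral_cst_probability nu).
rewrite -integral_normal_prob_std//; last by rewrite lt_neqAle eq_sym s00.
rewrite ge0_integral_distribution//.
apply: integral_of_normal_law => // A mA.
by have := XE A mA; rewrite (negbTE s00).
Qed.

Lemma integrable_of_sqr (X : {RV P >-> R}) :
  P.-integrable setT (fun w => (X w ^+ 2)%:E) -> P.-integrable setT (EFin \o X).
Proof.
move=> iX2.
have i1 := @finite_measure_integrable_cst _ _ _ P setT 1 measurableT.
have := integrableD measurableT i1 iX2.
apply: le_integrable => //; first exact/measurable_EFinP.
move=> w _ /=; rewrite lee_fin.
rewrite [leRHS]ger0_norm ?addr_ge0 ?sqr_ge0// -(real_normK (num_real (X w))).
by have := normr_ge0 (X w); nra.
Qed.

Lemma integrable_sqr (X : {RV P >-> R}) (v : R) :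
  (\int[P]_w (X w ^+ 2)%:E = v%:E)%E -> P.-integrable setT (fun w => (X w ^+ 2)%:E).
Proof.
move=> Xv; apply/integrableP; split.
  by apply/measurable_EFinP; exact: measurable_funX.
under eq_integral do rewrite gee0_abs ?lee_fin ?sqr_ge0//.
by rewrite Xv ltry.
Qed.

Definition normal_moment2 : \bar R := (\int[nu]_x (x ^+ 2)%:E)%E.

Lemma continuous_affine (a b : R) : continuous (fun x => a + b * x).
Proof.
move=> x; apply: cvgD; first exact: cvg_cst.
by apply: cvgM; [exact: cvg_cst|exact: cvg_id].
Qed.

Lemma continuous_affine_sqr (a b : R) : continuous (fun x => (a + b * x) ^+ 2).
Proof.
move=> x; apply: (@continuous_comp _ _ _ (fun x => a + b * x) (fun x => x ^+ 2)).
  exact: continuous_affine.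
exact: exprn_continuous.
Qed.

(** The mean [m] is shown to vanish with nonnegative integrands only. By symmetry of N(0, 1), m + s
    x and - m + s x have the same second moment v. But - m + s x has the law of X - 2 m, whose
    second moment is v + 4 m^2 because X is centered. *)
Lemma gaussian_rv_centered (X : {RV P >-> R}) (v : R) :
  gaussian_rv P X -> (\int[P]_w (X w)%:E = 0)%E ->
  (\int[P]_w (X w ^+ 2)%:E = v%:E)%E ->
  exists s : R, [/\ 0 <= s, ((s ^+ 2)%:E * normal_moment2 = v%:E)%E &
  forall G : R -> R, continuous G -> (forall x, 0 <= G x) ->
    (\int[P]_w (G (X w))%:E = \int[nu]_x (G (s * x))%:E)%E].
Proof.
move=> /gaussian_rv_integral[m [s [s0 XE]]] X1 X2.
have iX2 := integrable_sqr X2; have iX := integrable_of_sqr iX2.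
have E0 : (\int[nu]_x ((m + s * x) ^+ 2)%:E = v%:E)%E.
  rewrite -X2 (XE (fun x => x ^+ 2))//.
  - exact: exprn_continuous.
  - by move=> x; exact: sqr_ge0.
have E1 : (\int[nu]_x ((- m + s * x) ^+ 2)%:E = (v + 4 * m ^+ 2)%:E)%E.
  transitivity (\int[P]_w ((- 2 * m + 1 * X w) ^+ 2)%:E)%E.
    rewrite (XE (fun x => (-2 * m + 1 * x) ^+ 2)).
    - by apply: eq_integral => x _; congr (_ ^+ 2)%:E; ring.
    - exact: continuous_affine_sqr.
    - by move=> x; exact: sqr_ge0.
  under eq_integral => w _.
    have -> : (-2 * m + 1 * X w) ^+ 2 = X w ^+ 2 + (4 * m ^+ 2 + (- 4 * m) * X w).
      by ring.
    rewrite [(X w ^+ 2 + _)%:E]EFinD [(4 * m ^+ 2 + _)%:E]EFinD [(- 4 * m * X w)%:E]EFinM.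
  over.
  have i1 := @finite_measure_integrable_cst _ _ _ P setT (4 * m ^+ 2) measurableT.
  have i2 := integrableZl measurableT (- 4 * m) iX.
  rewrite integralD//; last exact: (integrableD measurableT i1 i2).
  rewrite integralD// integralZl//.
  by rewrite X1 X2 mule0 adde0 integral_cst_probability.
have m0 : m = 0.
  have : (\int[nu]_x ((- m + s * x) ^+ 2)%:E = v%:E)%E.
    rewrite -E0 -(@integral_normal_prob_sym _ (fun x => (m + s * x) ^+ 2)).
    - by apply: eq_integral => x _; congr EFin; ring.
    - exact: continuous_affine_sqr.
    - by move=> x; exact: sqr_ge0.
  rewrite E1 => -[] /eqP; rewrite -subr_eq0 [X in X == 0](_ : _ = 4 * m ^+ 2); last by ring.
  by rewrite mulf_eq0 sqrf_eq0 pnatr_eq0/= => /eqP.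
exists s; split => //.
- rewrite -E0 m0 /normal_moment2 -ge0_integralZl//.
  + by apply: eq_integral => x _; rewrite -EFinM add0r exprMn.
  + apply/measurable_EFinP; apply: continuous_measurable_fun; exact: exprn_continuous.
  + by move=> x _; rewrite lee_fin sqr_ge0.
  + by rewrite lee_fin sqr_ge0.
- move=> G cG G0; rewrite XE//.
  by apply: eq_integral => x _; rewrite m0 add0r.
Qed.

End gaussian_laws.

(** * Sums of independent Gaussian variables *)

Section pair_sum.
Context (R : realType).
Notation mu := (@lebesgue_measure R).
Notation nu := (@normal_prob R 0 1).

(** Completing the square: the joint density of x and z = s x + t y is the density of z times the
    conditional density of x given z. After Tonelli the conditional density integrates to 1. *)
Lemma normal_pdf_convolution (s t z x : R) : 0 <= s -> 0 < t ->
  normal_pdf 0 1 x * normal_pdf (s * x) t z =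
  normal_pdf 0 (Num.sqrt (s ^+ 2 + t ^+ 2)) z *
  normal_pdf (s * z / (s ^+ 2 + t ^+ 2)) (t / Num.sqrt (s ^+ 2 + t ^+ 2)) x.
Proof.
move=> s0 t0; set q := s ^+ 2 + t ^+ 2.
have q0 : 0 < q by rewrite ltr_wpDl ?sqr_ge0 ?exprn_gt0.
have t1 : t != 0 by rewrite gt_eqF.
have q1 : q != 0 by rewrite gt_eqF.
have sq0 : 0 < Num.sqrt q by rewrite sqrtr_gt0.
have sq1 : Num.sqrt q != 0 by rewrite gt_eqF.
have r1 : t / Num.sqrt q != 0 by rewrite mulf_neq0// invr_neq0.
have sqq : Num.sqrt q ^+ 2 = q by rewrite sqr_sqrtr// ltW.
rewrite !normal_pdfE ?oner_neq0// /normal_peak /normal_fun.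
rewrite mulrACA [in RHS]mulrACA -!expRD; congr (_ * expR _).
  rewrite -!invfM -!sqrtrM ?mulrn_wge0// ?mulr_ge0 ?pi_ge0 ?sqr_ge0//.
  by congr (_ _)^-1; rewrite exprMn exprVn sqq; field.
rewrite exprMn exprVn sqq /q; field.
by rewrite -/q t1 q1.
Qed.

Lemma normal_prob_convolution (s t : R) (h : R -> R) : 0 <= s -> 0 <= t ->
  continuous h -> (forall x, 0 <= h x) ->
  (\int[nu]_x \int[nu]_y (h (s * x + t * y))%:E =
   \int[nu]_z (h (Num.sqrt (s ^+ 2 + t ^+ 2) * z))%:E)%E.
Proof.
move=> s0 t0 ch h0.
have mh : measurable_fun setT h by exact: continuous_measurable_fun.
have [t00|t00] := eqVneq t 0.
  rewrite t00 expr0n/= addr0 sqrtr_sqr ger0_norm//; apply: eq_integral => x _.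
  under eq_integral do rewrite mul0r addr0.
  exact: (integral_cst_probability nu).
have {t00}t0 : 0 < t by rewrite lt_neqAle eq_sym t00.
set q := Num.sqrt _.
have q0 : 0 < q by rewrite sqrtr_gt0 ltr_wpDl ?sqr_ge0 ?exprn_gt0.
pose f x z := ((h z)%:E * (normal_pdf 0 1 x * normal_pdf (s * x) t z)%:E)%E.
have m1 : measurable_fun [set: R * R] (fun p => (h (s * p.1 + t * p.2))%:E).
  apply/measurable_EFinP; apply: measurableT_comp => //.
  by apply: measurable_funD; apply: measurable_funM.
have mf : measurable_fun [set: R * R] (fun p => f p.1 p.2).
  apply: emeasurable_funM; apply/measurable_EFinP.
    exact: measurableT_comp.
  apply: measurable_funM.
    by apply: measurableT_comp => //; exact: measurable_normal_pdf.
  under eq_fun do rewrite normal_pdfE ?gt_eqF//.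
  apply: measurable_funM => //; apply: measurableT_comp => //.
  apply: measurable_funM => //; apply: measurableT_comp => //.
  apply: measurable_funX; apply: measurable_funB => //.
  exact: measurable_funM.
have f0 p : (0 <= f p.1 p.2)%E.
  by rewrite mule_ge0// lee_fin ?mulr_ge0// normal_pdf_ge0.
have E x : (\int[nu]_y (h (s * x + t * y))%:E =
            \int[normal_prob (s * x)%R t]_z (h z)%:E)%E.
  by rewrite (integral_normal_prob_std _ t0 ch h0).
have E2 x : (\int[normal_prob (s * x)%R t]_z (h z)%:E =
             \int[mu]_z ((h z)%:E * (normal_pdf (s * x) t z)%:E))%E.
  apply: ge0_integral_normal_prob; first exact/measurable_EFinP.
  by move=> z; rewrite lee_fin.
transitivity (\int[mu]_x \int[mu]_z f x z)%E.
  rewrite [LHS]ge0_integral_normal_prob; last 2 first.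
  - apply: (@measurable_fun_fubini_tonelli_F _ _ _ _ _ nu _ m1) => p.
    by rewrite lee_fin.
  - by move=> x; apply: integral_ge0 => y _; rewrite lee_fin.
  apply: eq_integral => x _; rewrite E E2.
  rewrite -ge0_integralZr//; last 3 first.
  - apply: emeasurable_funM; apply/measurable_EFinP => //.
    exact: measurable_normal_pdf.
  - by move=> z _; rewrite -EFinM lee_fin mulr_ge0// normal_pdf_ge0.
  - by rewrite lee_fin normal_pdf_ge0.
  by apply: eq_integral => z _; rewrite /f -!EFinM; congr EFin; ring.
transitivity (\int[mu]_z \int[mu]_x f x z)%E.
  exact: (@fubini_tonelli _ _ _ _ _ mu mu (fun p => f p.1 p.2)).
transitivity (\int[normal_prob 0 q]_z (h z)%:E)%E; last first.
  by rewrite integral_normal_prob_std//; apply: eq_integral => x _; rewrite add0r.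
rewrite [RHS]ge0_integral_normal_prob//; last exact/measurable_EFinP.
apply: eq_integral => z _.
under eq_integral do rewrite /f normal_pdf_convolution// EFinM muleA.
rewrite ge0_integralZl//.
- by rewrite integral_normal_pdf mule1.
- by apply/measurable_EFinP; exact: measurable_normal_pdf.
- by move=> x _; rewrite lee_fin normal_pdf_ge0.
- by rewrite mule_ge0 ?lee_fin// normal_pdf_ge0.
Qed.

End pair_sum.

Lemma ge0_integral_distribution_EFin d (T : measurableType d) (R : realType)
  (P : probability T R) (X : {RV P >-> R}) (G : R -> R) :
  measurable_fun setT G -> (forall x, 0 <= G x) ->
  (\int[distribution P X]_x (G x)%:E = \int[P]_w (G (X w))%:E)%E.
Proof.
move=> mG G0; rewrite ge0_integral_distribution//; first exact/measurable_EFinP.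
Qed.

Section independent_sum.
Context d (T : measurableType d) (R : realType) (P : probability T R).
Notation nu := (@normal_prob R 0 1).

Lemma independent_integral2 (X Y : {RV P >-> R}) (f : R * R -> \bar R) :
  (forall A B, measurable A -> measurable B ->
     P (X @^-1` A `&` Y @^-1` B) = (P (X @^-1` A) * P (Y @^-1` B))%E) ->
  measurable_fun setT f -> (forall p, 0 <= f p)%E ->
  (\int[P]_w f (X w, Y w) =
   \int[distribution P X]_x \int[distribution P Y]_y f (x, y))%E.
Proof.
move=> XY mf f0.
have mXY : measurable_fun setT (fun w => (X w, Y w)) by exact: measurable_fun_pair.
rewrite -(@fubini_tonelli1 _ _ _ _ _ (distribution P X) (distribution P Y) f)//.
pose Z : {mfun T >-> (R * R)%type} :=
  HB.pack (fun w => (X w, Y w)) (isMeasurableFun.Build _ _ _ _ _ mXY).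
rewrite -[LHS](@ge0_integral_pushforward _ _ _ _ _ Z _ P setT f)//.
apply: eq_measure_integral => A mA _.
apply/esym; apply: product_measure_unique => // B C mB mC.
Qed.

Lemma independent_gaussian_sum (X Y : {RV P >-> R}) (s t : R) (h : R -> R) :
  0 <= s -> 0 <= t ->
  (forall A B, measurable A -> measurable B ->
     P (X @^-1` A `&` Y @^-1` B) = (P (X @^-1` A) * P (Y @^-1` B))%E) ->
  (forall G : R -> R, continuous G -> (forall x, 0 <= G x) ->
    (\int[P]_w (G (X w))%:E = \int[nu]_x (G (s * x))%:E)%E) ->
  (forall G : R -> R, continuous G -> (forall x, 0 <= G x) ->
    (\int[P]_w (G (Y w))%:E = \int[nu]_x (G (t * x))%:E)%E) ->
  continuous h -> (forall x, 0 <= h x) ->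
  (\int[P]_w (h (X w + Y w))%:E =
   \int[nu]_z (h (Num.sqrt (s ^+ 2 + t ^+ 2) * z))%:E)%E.
Proof.
move=> s0 t0 XY XE YE ch h0.
have mh : measurable_fun setT h by exact: continuous_measurable_fun.
have chD x : continuous (fun y => h (x + y)).
  move=> y; apply: (@continuous_comp _ _ _ (fun y => x + y) h); last exact: ch.
  by apply: cvgD; [exact: cvg_cst|exact: cvg_id].
have chD' y : continuous (fun x => h (x + y)).
  by under eq_fun do rewrite addrC; exact: chD.
have mD : measurable_fun [set: R * R] (fun p => (h (p.1 + p.2))%:E).
  apply/measurable_EFinP; apply: measurableT_comp => //.
  exact: measurable_funD.
have mtD : measurable_fun [set: R * R] (fun p => (h (p.1 + t * p.2))%:E).
  apply/measurable_EFinP; apply: measurableT_comp => //.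
  by apply: measurable_funD => //; exact: measurable_funM.
rewrite (@independent_integral2 X Y (fun p => (h (p.1 + p.2))%:E))//; last first.
  by move=> p; rewrite lee_fin.
transitivity (\int[distribution P X]_x \int[nu]_y (h (x + t * y))%:E)%E.
  apply: eq_integral => x _.
  rewrite (ge0_integral_distribution_EFin _ (continuous_measurable_fun (chD x)))//.
  by rewrite (YE (fun y => h (x + y)))//; exact: chD.
rewrite (@fubini_tonelli _ _ _ _ _ (distribution P X) nu (fun p => (h (p.1 + t * p.2))%:E))//; last first.
  by move=> p; rewrite lee_fin.
rewrite addrC -normal_prob_convolution//.
apply: eq_integral => y _ /=.
rewrite (ge0_integral_distribution_EFin _ (continuous_measurable_fun (chD' (t * y))))//.
rewrite (XE _ (chD' (t * y)) (fun=> h0 _)).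
by apply: eq_integral => x _; rewrite addrC.
Qed.
End independent_sum.

(** * Linear combinations of the two processes *)

Section process_combination.
Context d (T : measurableType d) (R : realType) (P : probability T R).
Implicit Types (a b : nat -> {RV P >-> R}) (c : nat -> R).

Lemma measurable_combination a c n :
  measurable_fun setT (fun w => \sum_(1 <= k < n.+1) c k * a k w).
Proof. by apply: measurable_sum => k; exact: measurable_funM. Qed.

Definition combination a c n : {RV P >-> R} :=
  HB.pack (fun w => \sum_(1 <= k < n.+1) c k * a k w)
    (isMeasurableFun.Build _ _ _ _ _ (measurable_combination a c n)).

(** Independence is stated for the generated sigma-algebras; this makes it apply to combinations of
    finitely many terms. *)
Lemma sigma_process_combination a c n (A : set R) : measurable A ->
  sigma_process a (combination a c n @^-1` A).
Proof.
move=> mA.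
set G0 := \bigcup_(k in [set k | (0 < k)%N])
        preimage_set_system setT (a k) measurable.
have mc : measurable_fun [set: g_sigma_algebraType G0] (combination a c n).
  rewrite /=; elim: n => [|n IHn].
    rewrite [X in measurable_fun _ X](_ : _ = cst 0); first exact: measurable_cst.
    by apply/funext => w; rewrite big_geq.
  under eq_fun do rewrite big_nat_recr//=.
  apply: measurable_funD => //; apply: measurable_funM => //.
  move=> _ B mB; rewrite setTI; apply: sub_sigma_algebra.
  by exists n.+1 => //; exists B => //; rewrite setTI.
by have := mc measurableT A mA; rewrite setTI.
Qed.

Definition combination_var (rho : int -> R) c n : R :=
  \sum_(1 <= k < n.+1) \sum_(1 <= l < n.+1) c k * c l * rho (k%:Z - l%:Z).

Lemma combination_moments a (rho : int -> R) c n :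
  centered_gaussian_process_cov rho a ->
  (\int[P]_w (combination a c n w)%:E = 0)%E /\
  (\int[P]_w (combination a c n w ^+ 2)%:E = (combination_var rho c n)%:E)%E.
Proof.
move=> [_ a1 a2].
have i2 k : (0 < k)%N -> P.-integrable setT (fun w => (a k w ^+ 2)%:E).
  move=> k0; apply: (@integrable_sqr _ _ _ _ (a k) (rho 0)).
  by have := a2 k k k0 k0; rewrite unlock subrr.
have i1 k : (0 < k)%N -> P.-integrable setT (EFin \o a k).
  by move=> k0; exact: integrable_of_sqr (i2 _ k0).
have i11 k l : (0 < k)%N -> (0 < l)%N -> P.-integrable setT (fun w => (a k w * a l w)%:E).
  move=> k0 l0; have := integrableD measurableT (i2 _ k0) (i2 _ l0).
  apply: le_integrable => //.
    by apply/measurable_EFinP; exact: measurable_funM.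
  move=> w _; rewrite /= lee_fin [leRHS]ger0_norm ?addr_ge0 ?sqr_ge0//.
  by rewrite ler_norml; apply/andP; split; nra.
split.
- under eq_integral do rewrite /= big_add1 -sumEFin.
  rewrite integral_sum//=; last first.
    by move=> k; exact: (integrableZl measurableT (c k.+1) (i1 k.+1 _)).
  rewrite big1// => k _.
  under eq_integral do rewrite EFinM.
  rewrite integralZl//; last exact: i1.
  by have := a1 k.+1 isT; rewrite unlock => ->; rewrite mule0.
- transitivity (\int[P]_w \sum_(0 <= k < n) \sum_(0 <= l < n)
    ((c k.+1 * c l.+1)%:E * (a k.+1 w * a l.+1 w)%:E))%E.
    apply: eq_integral => w _; rewrite /= big_add1 expr2 big_distrlr/= -sumEFin.
    apply: eq_bigr => k _; rewrite -sumEFin; apply: eq_bigr => l _.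
    by rewrite -EFinM; congr EFin; ring.
  have iZ k l := integrableZl measurableT (c k.+1 * c l.+1) (i11 k.+1 l.+1 isT isT).
  rewrite integral_sum//; last by move=> k; exact: integrable_sum.
  rewrite /combination_var big_add1 -sumEFin; apply: eq_bigr => k _.
  rewrite integral_sum//.
  rewrite big_add1 -sumEFin; apply: eq_bigr => l _.
  rewrite integralZl//; last exact: i11.
  by have := a2 k.+1 l.+1 isT isT; rewrite unlock => ->.
Qed.

Lemma combination_gaussian a (rho : int -> R) c n :
  centered_gaussian_process_cov rho a ->
  exists s : R, [/\ 0 <= s,
    ((s ^+ 2)%:E * normal_moment2 R = (combination_var rho c n)%:E)%E &
  forall G : R -> R, continuous G -> (forall x, 0 <= G x) ->
    (\int[P]_w (G (combination a c n w))%:E =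
     \int[@normal_prob R 0 1]_x (G (s * x))%:E)%E].
Proof.
move=> acov; have [m1 m2] := combination_moments c n acov.
by apply: gaussian_rv_centered => //; have [+ _ _] := acov; exact.
Qed.

(* The value of the second moment of N(0,1) is immaterial; that it is finite and
   nonzero comes from the process itself. *)
Lemma normal_moment2_fin a (rho : int -> R) : rho 0 = 1 ->
  centered_gaussian_process_cov rho a ->
  exists2 kappa : R, 0 < kappa & normal_moment2 R = kappa%:E.
Proof.
move=> rho0 acov.
have [s [s0 + _]] := combination_gaussian (fun=> 1) 1 acov.
rewrite /combination_var !big_nat1 subrr rho0 !mulr1.
have k0 : (0 <= normal_moment2 R)%E.
  by apply: integral_ge0 => x _; rewrite lee_fin sqr_ge0.
case: (normal_moment2 R) k0 => [k k0|_|//].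
- rewrite -EFinM => -[sk]; exists k => //.
  rewrite lee_fin in k0; by rewrite lt_neqAle k0 andbT; apply/eqP => k00; move/eqP: sk; rewrite -k00 mulr0 eq_sym oner_eq0.
- have [->|sN0] := eqVneq s 0; first by rewrite expr0n/= mul0e => -[/eqP]; rewrite eq_sym oner_eq0.
  by rewrite gt0_muley// lte_fin exprn_gt0// lt_neqAle eq_sym sN0.
Qed.

(** [Phi] is the cosine transform as a function of the variance, its formula left abstract; dividing
    by the second moment [kappa] of N(0, 1) turns a variance into a squared scale. The added 1 keeps
    the integrands nonnegative, and symmetry removes the sine. *)
Lemma gaussian_transform a b (rho : int -> R) : rho 0 = 1 ->
  centered_gaussian_process_cov rho a ->
  centered_gaussian_process_cov rho b -> independent_processes a b ->
  exists Phi : R -> R, forall n (c e : nat -> R),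
    let U w := combination a c n w + combination b e n w in
    (\int[P]_w (1 + cos (U w))%:E =
     (Phi (combination_var rho c n + combination_var rho e n))%:E)%E /\
    (\int[P]_w (1 + sin (U w))%:E = 1)%E.
Proof.
move=> rho0 acov bcov ab.
have [kappa k0 kE] := normal_moment2_fin rho0 acov.
pose nu := @normal_prob R 0 1.
exists (fun v => fine (\int[nu]_x (1 + cos (Num.sqrt (v / kappa) * x))%:E)%E).
move=> n c e U.
have [s [s0 sv sE]] := combination_gaussian c n acov.
have [t [t0 tv tE]] := combination_gaussian e n bcov.
have XY A B : measurable A -> measurable B ->
    P (combination a c n @^-1` A `&` combination b e n @^-1` B) =
    (P (combination a c n @^-1` A) * P (combination b e n @^-1` B))%E.
  by move=> mA mB; apply: ab; exact: sigma_process_combination.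
have sum_gauss := independent_gaussian_sum s0 t0 XY sE tE.
have cos0 (x : R) : 0 <= 1 + cos x by rewrite -lerBlDl sub0r cos_geN1.
have sin0 (x : R) : 0 <= 1 + sin x by rewrite -lerBlDl sub0r sin_geN1.
have ccos : continuous (fun x : R => 1 + cos x).
  by move=> x; apply: cvgD; [exact: cvg_cst|exact: continuous_cos].
have csin : continuous (fun x : R => 1 + sin x).
  by move=> x; apply: cvgD; [exact: cvg_cst|exact: continuous_sin].
have mZ q : measurable_fun setT (fun x : R => q * x) by exact: measurable_funM.
split.
- rewrite (sum_gauss (fun x => 1 + cos x))//.
  have -> : (combination_var rho c n + combination_var rho e n) / kappa = s ^+ 2 + t ^+ 2.
    move: sv tv; rewrite kE -!EFinM => -[<-] [<-].
    by rewrite -mulrDl mulfK// gt_eqF.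
  rewrite fineK// ge0_fin_numE; last by apply: integral_ge0 => x _; rewrite lee_fin.
  apply: (@le_lt_trans _ _ (\int[nu]_x 2%:E)%E).
    apply: ge0_le_integral => //.
    + apply/measurable_EFinP; apply: measurable_funD => //.
      apply: measurableT_comp => //; apply: continuous_measurable_fun; exact: continuous_cos.
    + by move=> x _; rewrite lee_fin -[2]/(1 + 1) lerD2l cos_le1.
  by rewrite (integral_cst_probability nu) ltry.
- rewrite (sum_gauss (fun x => 1 + sin x))//; set q := Num.sqrt _.
  set I := LHS.
  have mS r : measurable_fun setT (fun z : R => (1 + sin (r * z))%:E).
    apply/measurable_EFinP; apply: measurable_funD => //.
    apply: measurableT_comp => //; apply: continuous_measurable_fun; exact: continuous_sin.
  (* Reflecting one of the two copies makes the sines cancel pointwise. *)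
  have : (I + I = 2%:E)%E.
    rewrite {1}/I.
    rewrite -(@integral_normal_prob_sym _ (fun z => 1 + sin (q * z)))//; last first.
      move=> x; apply: (@continuous_comp _ _ _ (fun x => q * x) (fun x => 1 + sin x)); last exact: csin.
      by apply: cvgM; [exact: cvg_cst|exact: cvg_id].
    have mSq := mS q; have mSq' : measurable_fun setT (fun z : R => (1 + sin (q * - z))%:E).
      by rewrite [X in measurable_fun _ X](_ : _ = (fun z => (1 + sin (- q * z))%:E))//;
        apply/funext => z; rewrite mulrN mulNr.
    rewrite -ge0_integralD//.
    under eq_integral do rewrite -EFinD mulrN sinN addrACA addNr addr0.
    exact: (integral_cst_probability nu).
  by case: I => [r| |]//; rewrite -EFinD => -[rr]; congr EFin; lra.
Qed.
End process_combination.

(** * Sign probabilities of Gaussian pairs *)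

Section sign_iteration.
Context {R : realType}.
Implicit Types y : R.

(* Newton's iteration for 1/sqrt: its iterates are odd polynomials in the
   starting point, bounded by 1 on [-1, 1], and they converge to the sign. *)
Fixpoint sign_poly (j : nat) : {poly R} :=
  if j is i.+1 then 2^-1 *: (sign_poly i * (3%:P - sign_poly i ^+ 2)) else 'X.

Lemma sign_polyS j y : (sign_poly j.+1).[y] =
  2^-1 * ((sign_poly j).[y] * (3 - (sign_poly j).[y] ^+ 2)).
Proof. by rewrite /= !hornerE. Qed.

Lemma sign_polyN j y : (sign_poly j).[- y] = - (sign_poly j).[y].
Proof.
elim: j => [|j IHj]; first by rewrite !hornerX.
by rewrite !sign_polyS IHj; ring.
Qed.

(** For p(z) = z (3 - z^2) / 2 one has 1 - p(z) = (1 - z)^2 (2 + z) / 2, and (1 - z)(2 + z) / 2 <= 1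
    - y / 2 when y <= z <= 1. The iterates stay above y, so each step contracts the distance to 1 by
    the factor 1 - y / 2. *)
Lemma sign_poly_ge j y : 0 <= y <= 1 ->
  y <= (sign_poly j).[y] <= 1 /\ 1 - (sign_poly j).[y] <= (1 - y / 2) ^+ j.
Proof.
move=> /andP[y0 y1]; elim: j => [|j [/andP[IH1 IH2] IH3]].
  by rewrite hornerX lexx y1 expr0; split=> //; lra.
rewrite sign_polyS; set z := (sign_poly j).[y] in IH1 IH2 IH3 *.
have h : 0 <= 1 - z by lra.
have z0 : 0 <= z by lra.
have h1 : 0 <= z * (1 - z) * (1 + z) by rewrite !mulr_ge0//; lra.
have h2 : 0 <= (1 - z) ^+ 2 * (2 + z) by rewrite mulr_ge0 ?sqr_ge0//; lra.
split; first by apply/andP; split; lra.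
rewrite [leRHS]exprS.
have -> : 1 - 2^-1 * (z * (3 - z ^+ 2)) = (1 - z) * ((1 - z) * (2 + z) / 2) by field.
have h3 : 0 <= z * (1 + z - y) + (z - y) by rewrite addr_ge0 ?mulr_ge0//; lra.
rewrite [leLHS]mulrC; apply: ler_pM => //; first by rewrite divr_ge0 ?mulr_ge0//; lra.
by have := mulr_ge0 z0 y0; nra.
Qed.

Lemma sign_poly_norm j y : `|y| <= 1 -> `|(sign_poly j).[y]| <= 1.
Proof.
have [y0|y0] := leP 0 y => y1.
  have yp : 0 <= y <= 1 by rewrite y0; rewrite ger0_norm in y1.
  have [/andP[h1 h2] _] := sign_poly_ge j yp.
  by rewrite ger0_norm// (le_trans y0).
have yN : 0 <= - y <= 1 by rewrite ltr0_norm// in y1; apply/andP; split; lra.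
have [/andP[h1 h2] _] := sign_poly_ge j yN.
rewrite -[y]opprK sign_polyN normrN ger0_norm//; lra.
Qed.

Lemma cvg_sign_poly y : `|y| <= 1 -> (sign_poly j).[y] @[j --> \oo] --> Num.sg y.
Proof.
have pos z : 0 < z <= 1 -> (sign_poly j).[z] @[j --> \oo] --> (1 : R).
  move=> /andP[z0 z1].
  have zz : 0 <= z <= 1 by rewrite ltW.
  have c0 : (1 - z / 2) ^+ j @[j --> \oo] --> (0 : R).
    by apply: cvg_expr; rewrite ger0_norm; lra.
  apply: (@squeeze_cvgr _ _ _ _ (fun j => 1 - (1 - z / 2) ^+ j) (cst 1)).
  - by near=> j; have [/andP[h1 h2] h3] := sign_poly_ge j zz; apply/andP; split=> //=; lra.
  - by rewrite -[X in _ --> X]subr0; apply: cvgB => //; exact: cvg_cst.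
  - exact: cvg_cst.
move=> y1; have [y0|y0|->] := ltgtP y 0.
- rewrite ltr0_sg// -(opprK y).
  under eq_fun do rewrite sign_polyN.
  apply: cvgN; apply: pos; rewrite oppr_gt0 y0/=.
  by rewrite ltr0_norm in y1.
- rewrite gtr0_sg//; apply: pos; rewrite y0/=; by rewrite gtr0_norm in y1.
- rewrite sgr0; under eq_fun => j.
    have -> : (sign_poly j).[0] = 0.
      by have := sign_polyN j 0; rewrite oppr0 => h; lra.
  over.
  exact: cvg_cst.
Unshelve. all: by end_near.
Qed.
End sign_iteration.

(** * Pairs of variables with the same trigonometric moments *)

Section twin_pairs.
Context d (T : measurableType d) (R : realType) (P : probability T R).
Implicit Types (U V : {RV P >-> R}) (F G : R * R -> R).

Lemma bounded_integrable (f : T -> R) (M : R) : measurable_fun setT f ->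
  (forall w, `|f w| <= M) -> P.-integrable setT (EFin \o f).
Proof.
move=> mf fM; apply: measurable_bounded_integrable => //.
  by have /= -> := @probability_setT _ _ _ P; rewrite ltry.
exists M; split; first exact: num_real.
by move=> x Mx w _ /=; rewrite (le_trans (fM w))// ltW.
Qed.

(** The free phase [th] makes a single family of integrals carry both the cosine and the sine
    moments. *)
Definition same_transform U V U' V' := forall p q th : R,
  \int[P]_w cos (p * U w + q * V w + th) = \int[P]_w cos (p * U' w + q * V' w + th).

Variables (U V U' V' : {RV P >-> R}).
Hypothesis UV : same_transform U V U' V'.

(* The law of (U, V) is only known through its trigonometric moments. The twin functions have
   the same expectation under both pairs; the class is closed under products with cosines and bounded
   limits, and the polynomials [sign_poly] bring in signs. *)
Definition twin F := [/\ measurable_fun setT F, exists M, forall z, `|F z| <= M &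
  forall p q th : R,
  \int[P]_w (F (U w, V w) * cos (p * U w + q * V w + th)) =
  \int[P]_w (F (U' w, V' w) * cos (p * U' w + q * V' w + th))].

Definition phase (p q th : R) (z : R * R) := p * z.1 + q * z.2 + th.

Lemma measurable_phase p q th : measurable_fun setT (phase p q th).
Proof.
apply: measurable_funD => //; apply: measurable_funD; exact: measurable_funM.
Qed.

Lemma measurable_cos_phase p q th : measurable_fun setT (fun z => cos (phase p q th z)).
Proof.
apply: measurableT_comp; last exact: measurable_phase.
by apply: continuous_measurable_fun; exact: continuous_cos.
Qed.

Let cosM1 (x : R) : `|cos x| <= 1.
Proof. by rewrite ler_norml cos_geN1 cos_le1. Qed.

Let twin_integrable F (X Y : {RV P >-> R}) p q th : measurable_fun setT F ->
  (exists M, forall z, `|F z| <= M) ->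
  P.-integrable setT (fun w => (F (X w, Y w) * cos (p * X w + q * Y w + th))%:E).
Proof.
move=> mF [M FM].
have mXY : measurable_fun setT (fun w => (X w, Y w)) by exact: measurable_fun_pair.
apply: (@bounded_integrable (fun w => F (X w, Y w) * cos (p * X w + q * Y w + th)) M).
  apply: measurable_funM; first exact: measurableT_comp mXY.
  exact: (measurableT_comp (measurable_cos_phase p q th) mXY).
move=> w; rewrite normrM -[M]mulr1 ler_pM//.
Qed.

Lemma twin1 : twin (cst 1).
Proof.
split; first exact: measurable_cst.
  by exists 1 => z; rewrite normr1.
by move=> p q th; under eq_Rintegral do rewrite mul1r; rewrite UV;
  under [RHS]eq_Rintegral do rewrite mul1r.
Qed.

Lemma twinD (c : R) F G : twin F -> twin G -> twin (fun z => c * F z + G z).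
Proof.
move=> [mF bF FE] [mG bG GE].
split.
- by apply: measurable_funD => //; exact: measurable_funM.
- move: bF bG => [M FM] [N GN]; exists (`|c| * M + N) => z.
  by rewrite (le_trans (ler_normD _ _))// lerD// normrM ler_wpM2l.
- move=> p q th.
  have E (X Y : {RV P >-> R}) : \int[P]_w ((c * F (X w, Y w) + G (X w, Y w)) * cos (p * X w + q * Y w + th)) =
     c * \int[P]_w (F (X w, Y w) * cos (p * X w + q * Y w + th)) +
     \int[P]_w (G (X w, Y w) * cos (p * X w + q * Y w + th)).
    rewrite -RintegralZl//; last exact: twin_integrable.
    rewrite -RintegralD//; last 2 first.
    + exact: (integrableZl measurableT c (twin_integrable X Y p q th mF bF)).
    + exact: twin_integrable.
    by apply: eq_Rintegral => w _; ring.
  by rewrite !E FE GE.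
Qed.

(** By the product-to-sum formula the extra factor only changes the parameters of the test
    cosine. *)
Lemma twinM F p q th : twin F -> twin (fun z => F z * cos (phase p q th z)).
Proof.
move=> [mF bF FE]; split.
- by apply: measurable_funM => //; exact: measurable_cos_phase.
- move: bF => [M FM]; exists M => z.
  by rewrite normrM -[M]mulr1 ler_pM.
- move=> p' q' th'.
  have E (X Y : {RV P >-> R}) :
     \int[P]_w (F (X w, Y w) * cos (phase p q th (X w, Y w)) * cos (p' * X w + q' * Y w + th')) =
     2^-1 * (\int[P]_w (F (X w, Y w) * cos ((p + p') * X w + (q + q') * Y w + (th + th'))) +
     \int[P]_w (F (X w, Y w) * cos ((p - p') * X w + (q - q') * Y w + (th - th')))).
    rewrite -RintegralD//; [|exact: twin_integrable|exact: twin_integrable].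
    rewrite -RintegralZl//; last first.
      exact: (integrableD measurableT (twin_integrable X Y _ _ _ mF bF) (twin_integrable X Y _ _ _ mF bF)).
    apply: eq_Rintegral => w _; rewrite /phase/=.
    set A := p * X w + q * Y w + th; set B := p' * X w + q' * Y w + th'.
    have -> : (p + p') * X w + (q + q') * Y w + (th + th') = A + B by rewrite /A /B; ring.
    have -> : (p - p') * X w + (q - q') * Y w + (th - th') = A - B by rewrite /A /B; ring.
    by rewrite [cos (A + B)]cosD [cos (A - B)]cosB; field.
  by rewrite !E !FE.
Qed.

Lemma twin_poly F p q th (Q : {poly R}) : twin F ->
  twin (fun z => F z * Q.[cos (phase p q th z)]).
Proof.
move=> tF; elim/poly_ind: Q => [|Q c IH].
  have := @twinD (-1) _ _ tF tF; congr twin; apply/funext => z; rewrite horner0; ring.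
have := @twinD c _ _ tF (@twinM _ p q th IH); congr twin; apply/funext => z.
by rewrite !hornerE; ring.
Qed.

Lemma twin_lim (Fn : nat -> R * R -> R) F (M : R) : (forall n, twin (Fn n)) ->
  (forall n z, `|Fn n z| <= M) -> (forall z, Fn n z @[n --> \oo] --> F z) -> twin F.
Proof.
move=> tF FM cF.
have mFn n : measurable_fun setT (Fn n) by have [] := tF n.
have mF : measurable_fun setT F.
  by apply: (measurable_fun_cvg mFn) => z _; exact: cF.
have bF z : `|F z| <= M.
  have cn : `|Fn n z| @[n --> \oo] --> `|F z| by apply: cvg_norm; exact: cF.
  rewrite -(cvg_lim _ cn)//; apply: limr_le; first by apply/cvg_ex; exists `|F z|.
  by near=> n; exact: FM.
split => //; first by exists M.
move=> p q th.
have E (X Y : {RV P >-> R}) :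
    \int[P]_w (Fn n (X w, Y w) * cos (p * X w + q * Y w + th)) @[n --> \oo] -->
    \int[P]_w (F (X w, Y w) * cos (p * X w + q * Y w + th)).
  have i1 (G : R * R -> R) : measurable_fun setT G -> (forall z, `|G z| <= M) ->
     P.-integrable setT (fun w => (G (X w, Y w) * cos (p * X w + q * Y w + th))%:E).
    by move=> mG GM; apply: twin_integrable => //; exists M.
  rewrite /Rintegral; apply: fine_cvg; rewrite fineK; last exact: (integrable_fin_num measurableT (i1 _ mF bF)).
  have [//| | | | |] := @dominated_convergence _ _ _ P setT measurableT
    (fun n w => (Fn n (X w, Y w) * cos (p * X w + q * Y w + th))%:E)
    (fun w => (F (X w, Y w) * cos (p * X w + q * Y w + th))%:E) (cst M%:E).
  - by move=> n; have /measurable_int := i1 _ (mFn n) (FM n).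
  - by have /measurable_int := i1 _ mF bF.
  - by apply: aeW => w _; apply: cvg_EFin; [near=> n|apply: cvgMl; exact: cF].
  - exact: finite_measure_integrable_cst.
  - apply: aeW => w n _; rewrite lee_fin normrM -[M]mulr1 ler_pM//.
  - by [].
apply: cvg_unique (E U V) _; first exact: Rhausdorff.
suff -> : (fun n => \int[P]_w (Fn n (U w, V w) * cos (p * U w + q * V w + th))) =
  (fun n => \int[P]_w (Fn n (U' w, V' w) * cos (p * U' w + q * V' w + th))) by exact: E.
by apply/funext => n; have [_ _] := tF n; exact.
Unshelve. all: by end_near.
Qed.

Lemma twin_sgn_cos F p q th : twin F -> 
  twin (fun z => F z * Num.sg (cos (phase p q th z))).
Proof.
move=> tF; have [_ [M FM] _] := tF.
apply: (@twin_lim (fun n z => F z * (sign_poly n).[cos (phase p q th z)]) _ M).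
- by move=> n; exact: twin_poly.
- by move=> n z; rewrite normrM -[M]mulr1 ler_pM// sign_poly_norm.
- by move=> z; apply: cvgMr; exact: cvg_sign_poly.
Qed.

(** Dividing the linear form by n + 1 and shifting the phase by pi / 2 turns the cosine into a sine
    of an argument that eventually lies in ]-pi, pi[, where the sine has the sign of its argument.
    The approximating sequence is thus eventually constant at each point. *)
Lemma twin_sgn F p q c : twin F ->
  twin (fun z => F z * Num.sg (phase p q c z)).
Proof.
move=> tF; have [_ [M FM] _] := tF.
have sgM (x y : R) : `|x * Num.sg y| <= `|x|.
  by rewrite normrM normr_sg; case: (y != 0); rewrite ?mulr1 ?mulr0.
pose Fn n z := F z *
  Num.sg (cos (phase (p / n.+1%:R) (q / n.+1%:R) (c / n.+1%:R - pi / 2) z)).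
apply: (@twin_lim Fn _ M).
- by move=> n; exact: twin_sgn_cos.
- by move=> n z; rewrite (le_trans (sgM _ _)).
- move=> z; apply: cvgMr.
  set x := phase p q c z.
  have E n : cos (phase (p / n.+1%:R) (q / n.+1%:R) (c / n.+1%:R - pi / 2) z) = sin (x / n.+1%:R).
    by rewrite -cosBpihalf; congr cos; rewrite /x /phase; ring.
  under eq_fun do rewrite E.
  apply: cvg_near_cst; exists (Num.truncn `|x|) => // n /= Hn.
  have n0 : 0 < n.+1%:R :> R by rewrite ltr0n.
  have xn : `|x / n.+1%:R| < pi.
    apply: (@lt_le_trans _ _ 1); last by rewrite (le_trans _ (pi_ge2 _))// ler1n.
    rewrite normrM normfV (ger0_norm (ltW n0)) ltr_pdivrMr// mul1r.
    by rewrite (lt_le_trans (truncnS_gt _))// ler_nat.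
  have [x0|x0|->] := ltgtP x 0; last by rewrite mul0r sin0 sgr0.
  - have y0 : x / n.+1%:R < 0 by rewrite pmulr_llt0// invr_gt0.
    rewrite !ltr0_sg// -oppr_gt0 -sinN; apply: sin_gt0_pi.
    by rewrite oppr_gt0 y0 -(ltr0_norm y0).
  - have y0 : 0 < x / n.+1%:R by rewrite divr_gt0.
    rewrite !gtr0_sg//; apply: sin_gt0_pi.
    by rewrite y0 -(gtr0_norm y0).
Qed.

Lemma twin_probability (A : set (R * R)) : measurable A -> twin (\1_A) ->
  P [set w | A (U w, V w)] = P [set w | A (U' w, V' w)].
Proof.
move=> mA [_ _ /(_ 0 0 0)] E.
have h (X Y : {RV P >-> R}) : P [set w | A (X w, Y w)] =
   (\int[P]_w (\1_A (X w, Y w) * cos (0 * X w + 0 * Y w + 0)))%:E.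
  have mXY : measurable_fun setT (fun w => (X w, Y w)) by exact: measurable_fun_pair.
  have mB : measurable [set w | A (X w, Y w)].
    by rewrite -[X in measurable X]setTI; exact: mXY.
  rewrite -(setIT [set w | _]) -integral_indic// /Rintegral fineK.
    by apply: eq_integral => w _; rewrite !mul0r !addr0 cos0 mulr1 !indicE.
  under eq_integral => w _ do rewrite !mul0r !addr0 cos0 mulr1.
  rewrite (_ : integral _ _ _ = P [set w | A (X w, Y w)]) ?fin_num_measure//.
  by rewrite -[RHS](congr1 P (setIT _)) -integral_indic.
by rewrite !h E.
Qed.

(** With s = sg u * sg v, the indicator of u v < 0 is (s^2 - s) / 2. *)
Lemma same_transform_lt0 :
  P [set w | U w * V w < 0] = P [set w | U' w * V' w < 0].
Proof.
apply: (@twin_probability [set z | z.1 * z.2 < 0]).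
  rewrite -[X in measurable X]setTI.
  have : measurable_fun [set: R * R] (fun z => z.1 * z.2) by exact: measurable_funM.
  by move/(_ measurableT `]-oo, 0[%classic (measurable_itv _)); rewrite set_itvE.
have t1 := @twin_sgn _ 0 1 0 (@twin_sgn _ 1 0 0 twin1).
have t2 := @twin_sgn _ 0 1 0 (@twin_sgn _ 1 0 0 t1).
have t0 := @twinD (-1) _ _ twin1 twin1.
have := @twinD (2^-1) _ _ (@twinD (-1) _ _ t1 t2) t0; congr twin.
apply/funext => -[u v]; rewrite /phase/= !mul0r !mul1r !addr0 add0r indicE.
rewrite (_ : ((u, v) \in _) = (u * v < 0)); last first.
  by apply/idP/idP; rewrite in_setE.
rewrite -sgr_lt0 sgrM.
by case: (sgrP u); case: (sgrP v) => _ _; rewrite ?(mulr0, mul0r, mulr1, mul1r, mulrN1, opprK, ltxx, ltr01, ltrN10, ltr10)/=; lra.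
Qed.

(** As the sign is 0 at 0, (s + s^2) / 2 with s = sg (u - e) is the indicator of u > e, and (s^2 -
    s) / 2 with s = sg (u + e) that of u < - e. Removing both from 1 leaves the closed ball. *)
Lemma same_transform_ball (e : R) : 0 <= e ->
  P [set w | `|U w| <= e] = P [set w | `|U' w| <= e].
Proof.
move=> e0; apply: (@twin_probability [set z | `|z.1| <= e]).
  rewrite -[X in measurable X]setTI.
  have : measurable_fun [set: R * R] (fun z => `|z.1|) by exact: measurableT_comp.
  by move/(_ measurableT `]-oo, e]%classic (measurable_itv _)); rewrite set_itvE.
have s1 := @twin_sgn _ 1 0 (- e) twin1.
have s1s1 := @twin_sgn _ 1 0 (- e) s1.
have s2 := @twin_sgn _ 1 0 e twin1.
have s2s2 := @twin_sgn _ 1 0 e s2.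
have p1 := @twinD 1 _ _ s1 s1s1.
have p2 := @twinD (-1) _ _ s2 s2s2.
have := @twinD (- 2^-1) _ _ (@twinD 1 _ _ p1 p2) twin1; congr twin.
apply/funext => -[u v]; rewrite /phase/= !mul0r !mul1r !addr0 indicE.
rewrite (_ : ((u, v) \in _) = (`|u| <= e)); last first.
  by apply/idP/idP; rewrite in_setE.
rewrite ler_norml.
case: (sgrP (u - e)) => h1; case: (sgrP (u + e)) => h2.
all: rewrite ?mulr0 ?mulr1.
all: by have [h3|h3] := leP (- e) u; have [h4|h4] := leP u e; rewrite /=; lra.
Qed.
End twin_pairs.

(* Applied to the probability that the Gaussian variables a cos t + b sin t at t = 0 and t = c have
   opposite signs: it is additive in c, which gives c / pi without computing a density. *)
Lemma additive_linear (R : realType) (L : R) (p : R -> R) : 0 < L ->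
  (forall c, 0 < c -> c <= L -> 0 <= p c) ->
  (forall c c', 0 < c -> 0 < c' -> c + c' <= L -> p (c + c') = p c + p c') ->
  p L = 1 -> forall c, 0 < c -> c <= L -> p c = c / L.
Proof.
move=> L0 p0 pD pL c c0 cL.
have pM n x : 0 < x -> n.+1%:R * x <= L -> p (n.+1%:R * x) = n.+1%:R * p x.
  move=> x0; elim: n => [|n IHn] nx; first by rewrite !mul1r.
  have nx' : n.+1%:R * x + x <= L by rewrite -[X in _ + X]mul1r -mulrDl -natr1 in nx *.
  have n0 : 0 < n.+1%:R * x by rewrite mulr_gt0.
  rewrite -natr1 mulrDl mul1r pD// IHn; first by rewrite -[in RHS]natr1; ring.
  by rewrite (le_trans _ nx')// lerDl ltW.
have mono x y : 0 < x -> x <= y -> y <= L -> p x <= p y.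
  move=> x0; rewrite le_eqVlt => /predU1P[->//|xy] yL.
  have -> : y = x + (y - x) by ring.
  by rewrite pD ?subr_gt0//; [rewrite lerDl p0// ?subr_gt0//; lra|lra].
(* [c] is enclosed between consecutive multiples of L / (N + 1), where [p] is known exactly by
   additivity; monotonicity does the rest. When the upper multiple exceeds [L], the bound p c <= p L
   = 1 replaces it. *)
have bnd N : `|p c - c / L| <= N.+1%:R^-1.
  have N0 : 0 < N.+1%:R :> R by rewrite ltr0n.
  set h := L / N.+1%:R; have h0 : 0 < h by rewrite divr_gt0.
  have hL : N.+1%:R * h = L by rewrite /h mulrC divfK// gt_eqF.
  have ph : p h = N.+1%:R^-1.
    have := pM N h h0; rewrite hL pL => /(_ (lexx _)) e.
    by apply: (mulfI (lt0r_neq0 N0)); rewrite -e mulfV// gt_eqF.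
  have cL0 : 0 <= c / h by rewrite divr_ge0// ltW.
  set k := Num.truncn (c / h).
  have /andP[k1 k2] := truncn_itv cL0; rewrite -/k in k1 k2.
  have e1 : k%:R * h <= c by rewrite -ler_pdivlMr.
  have e2 : c < k.+1%:R * h by rewrite -ltr_pdivrMr.
  have cE : c / L = (c / h) / N.+1%:R by rewrite -hL; field; rewrite !gt_eqF.
  have lb : k%:R / N.+1%:R <= p c.
    case: (k) e1 => [|j] e1; first by rewrite mul0r p0.
    apply: (@le_trans _ _ (p (j.+1%:R * h))).
      by rewrite pM// ?ph// (le_trans e1).
    by rewrite mono// mulr_gt0.
  have ub : p c <= k.+1%:R / N.+1%:R.
    have [e3|e3] := leP (k.+1%:R * h) L.
      by rewrite -ph -pM// mono// ltW.
    apply: (@le_trans _ _ 1); first by rewrite -pL mono.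
    rewrite ler_pdivlMr// mul1r ler_nat.
    by rewrite -hL ltr_pM2r// ltr_nat in e3; exact: ltnW.
  have f1 : k%:R / N.+1%:R <= c / L by rewrite cE ler_pM2r ?invr_gt0.
  have f2 : c / L <= k.+1%:R / N.+1%:R by rewrite cE ler_pM2r ?invr_gt0// ltW.
  rewrite -natr1 mulrDl mul1r in ub f2.
  rewrite ler_norml lerBrDr lerBlDr; apply/andP; split.
    by apply: le_trans lb; rewrite addrC lerBlDr.
  by apply: (le_trans ub); rewrite addrC lerD2l.
apply/eqP; rewrite -subr_eq0 -normr_eq0 eq_le normr_ge0 andbT.
rewrite leNgt; apply/negP => e0; have := bnd (Num.truncn `|p c - c / L|^-1).
by rewrite leNgt invf_plt ?posrE ?ltr0n// truncnS_gt.
Qed.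

(* With s = sin c, s' = sin c', S = sin (c + c'): if a sinusoid of period 2 pi changes sign on one of two
   adjacent intervals of total length at most pi, it changes sign on their union. *)
Lemma sign_key (R : realDomainType) (s s' S x y z : R) : 0 < s -> 0 < s' -> 0 <= S ->
  y * S = x * s' + z * s -> x * y < 0 \/ y * z < 0 -> x * z < 0.
Proof.
have pos (t t' u v : R) : 0 < t -> 0 < t' -> 0 <= S -> y * S = u * t' + v * t ->
    u * y < 0 -> u * v < 0.
  move=> t0 t'0 S0 e uy.
  have u0 : u != 0 by apply: contraTneq uy => ->; rewrite mul0r ltxx.
  have u2 : 0 < u ^+ 2 * t' by rewrite mulr_gt0// exprn_even_gt0.
  have uS : (u * y) * S <= 0 by rewrite mulr_le0_ge0// ltW.
  have : (u * v) * t < 0.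
    have -> : u * v * t = u * y * S - u ^+ 2 * t'.
      by rewrite -(mulrA u y) e; ring.
    lra.
  by rewrite pmulr_llt0.
move=> s0 s'0 S0 e [h|h]; first exact: pos e h.
by rewrite mulrC; rewrite mulrC in h; apply: pos h; [exact: s'0|exact: s0|by []|rewrite addrC].
Qed.

(** * Sign probabilities by comparison with rotations *)

Section gaussian_pairs.
Context d (T : measurableType d) (R : realType) (P : probability T R).
Variable Phi : R -> R.
Implicit Types (U V X Y : {RV P >-> R}).

(** [Phi] is an arbitrary function: two pairs with the same covariance entries have the same
    transform whatever it is. *)
Definition gaussian_pair U V (s11 s12 s22 : R) := forall p q : R,
  \int[P]_w cos (p * U w + q * V w) =
    Phi (p ^+ 2 * s11 + 2 * p * q * s12 + q ^+ 2 * s22) /\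
  \int[P]_w sin (p * U w + q * V w) = 0.

Lemma gaussian_pair_same_transform U V U' V' s11 s12 s22 :
  gaussian_pair U V s11 s12 s22 -> gaussian_pair U' V' s11 s12 s22 ->
  same_transform U V U' V'.
Proof.
move=> h h' p q th.
have E X Y : gaussian_pair X Y s11 s12 s22 -> \int[P]_w cos (p * X w + q * Y w + th) =
    cos th * Phi (p ^+ 2 * s11 + 2 * p * q * s12 + q ^+ 2 * s22).
  move=> /(_ p q)[h1 h2].
  have m : measurable_fun setT (fun w => p * X w + q * Y w).
    by apply: measurable_funD; exact: measurable_funM.
  have ic : P.-integrable setT (fun w => (cos (p * X w + q * Y w))%:E).
    apply: (@bounded_integrable _ _ _ _ _ 1).
      by apply: measurableT_comp => //; apply: continuous_measurable_fun; exact: continuous_cos.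
    by move=> w; rewrite ler_norml cos_geN1 cos_le1.
  have is_ : P.-integrable setT (fun w => (sin (p * X w + q * Y w))%:E).
    apply: (@bounded_integrable _ _ _ _ _ 1).
      by apply: measurableT_comp => //; apply: continuous_measurable_fun; exact: continuous_sin.
    by move=> w; rewrite ler_norml sin_geN1 sin_le1.
  rewrite -h1 -[RHS]subr0 -(mulr0 (sin th)) -h2.
  rewrite -!RintegralZl// -RintegralB//; last 2 first.
  - exact: (integrableZl measurableT (cos th) ic).
  - exact: (integrableZl measurableT (sin th) is_).
  by apply: eq_Rintegral => w _; rewrite cosD; ring.
by rewrite !E.
Qed.

Variables X Y : {RV P >-> R}.
Hypothesis XY : gaussian_pair X Y 1 0 1.

Lemma measurable_rotation (r c : R) :
  measurable_fun setT (fun w => r * (cos c * X w + sin c * Y w)).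
Proof. by apply: measurable_funM => //; apply: measurable_funD; exact: measurable_funM. Qed.

(** The plane vector of length [r] and angle [c], paired with (X, Y). Covariances are dot products,
    so two such vectors realise any prescribed variances and correlation. *)
Definition rotation (r c : R) : {RV P >-> R} :=
  HB.pack (fun w => r * (cos c * X w + sin c * Y w))
    (isMeasurableFun.Build _ _ _ _ _ (measurable_rotation r c)).

Lemma gaussian_pair_rotation (r c r' c' : R) :
  gaussian_pair (rotation r c) (rotation r' c') (r ^+ 2) (r * r' * cos (c' - c)) (r' ^+ 2).
Proof.
move=> p q; have := XY (p * r * cos c + q * r' * cos c') (p * r * sin c + q * r' * sin c').
have E w : (p * r * cos c + q * r' * cos c') * X w + (p * r * sin c + q * r' * sin c') * Y w =
    p * rotation r c w + q * rotation r' c' w by rewrite /=; ring.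
have -> : (p * r * cos c + q * r' * cos c') ^+ 2 * 1 +
   2 * (p * r * cos c + q * r' * cos c') * (p * r * sin c + q * r' * sin c') * 0 +
   (p * r * sin c + q * r' * sin c') ^+ 2 * 1 =
   p ^+ 2 * r ^+ 2 + 2 * p * q * (r * r' * cos (c' - c)) + q ^+ 2 * r' ^+ 2.
  rewrite cosB.
  have h1 := cos2Dsin2 c; have h2 := cos2Dsin2 c'.
  have {}h1 : sin c ^+ 2 = 1 - cos c ^+ 2 by rewrite -h1; ring.
  have {}h2 : sin c' ^+ 2 = 1 - cos c' ^+ 2 by rewrite -h2; ring.
  ring: h1 h2.
by move=> [<- <-]; split; apply: eq_Rintegral => w _; rewrite E.
Qed.

Hypothesis X0 : P [set w | X w = 0] = 0%E.

Let Th (c : R) := rotation 1 c.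

Let Th_lt0 c c' e : P [set w | Th c w * Th (c + e) w < 0] = P [set w | Th c' w * Th (c' + e) w < 0].
Proof.
apply: same_transform_lt0; apply: gaussian_pair_same_transform (@gaussian_pair_rotation 1 c' 1 (c' + e)).
have := @gaussian_pair_rotation 1 c 1 (c + e).
by rewrite [c + e - c](_ : _ = c' + e - c')//; ring.
Qed.

Let Th_eq0 c : P [set w | Th c w = 0] = 0%E.
Proof.
have h : P [set w | `|Th c w| <= 0] = P [set w | `|Th 0 w| <= 0].
  apply: (@same_transform_ball _ _ _ _ (Th c) (Th c) (Th 0) (Th 0)) => //.
  apply: gaussian_pair_same_transform (@gaussian_pair_rotation 1 0 1 0).
  have := @gaussian_pair_rotation 1 c 1 c.
  by rewrite [c - c](_ : _ = 0 - 0)//; ring.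
move: h; under eq_set do rewrite normr_le0.
under [in X in _ = X -> _]eq_set do rewrite normr_le0 /= sin0 cos0 !mul1r mul0r addr0.
move=> h; transitivity (P [set w | Th c w == 0]).
  by congr (P _); apply/seteqP; split => w /=; [move=> ->; rewrite eqxx|move/eqP].
by rewrite h -X0; congr (P _); apply/seteqP; split => w /=; [move/eqP|move=> ->; rewrite eqxx].
Qed.

Let mlt0 U V : measurable [set w | U w * V w < 0].
Proof.
rewrite -[X in measurable X]setTI.
have : measurable_fun setT (fun w => U w * V w) by exact: measurable_funM.
by move/(_ measurableT `]-oo, 0[%classic (measurable_itv _)); rewrite set_itvE.
Qed.

Let meq0 U : measurable [set w | U w = 0].
Proof.
rewrite -[X in measurable X]setTI.
by have /(_ measurableT [set 0] (measurable_set1 _)) : measurable_fun setT U by [].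
Qed.

Let pr c := fine (P [set w | Th 0 w * Th c w < 0]).

Let prE c : P [set w | Th 0 w * Th c w < 0] = (pr c)%:E.
Proof. by rewrite /pr fineK// fin_num_measure. Qed.

Let prD c c' : 0 < c -> 0 < c' -> c + c' <= pi -> pr (c + c') = pr c + pr c'.
Proof.
move=> c0 c'0 cc.
have s0 : 0 < sin c by apply: sin_gt0_pi; rewrite c0/=; lra.
have s'0 : 0 < sin c' by apply: sin_gt0_pi; rewrite c'0/=; lra.
have S0 : 0 <= sin (c + c') by apply: sin_ge0_pi; rewrite cc andbT; lra.
(* The linear relation between three values of a sinusoid. Its coefficients are nonnegative because
   c + c' <= pi, which is what [sign_key] exploits. *)
have idt w : Th c w * sin (c + c') = Th 0 w * sin c' + Th (c + c') w * sin c.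
  rewrite /= cos0 sin0 sinD cosD.
  have h1 := cos2Dsin2 c.
  have {}h1 : sin c ^+ 2 = 1 - cos c ^+ 2 by rewrite -h1; ring.
  ring: h1.
pose A := [set w | Th 0 w * Th (c + c') w < 0].
pose B := [set w | Th 0 w * Th c w < 0].
pose C := [set w | Th c w * Th (c + c') w < 0].
pose N := [set w | Th c w = 0].
have PC : P C = (pr c')%:E by rewrite -prE; have := Th_lt0 c 0 c'; rewrite add0r.
have BA : B `|` C `<=` A.
  have key x y z : y * sin (c + c') = x * sin c' + z * sin c ->
      x * y < 0 \/ y * z < 0 -> x * z < 0.
    by move: s0 s'0 S0; move: (sin c) (sin c') (sin (c + c')) => s s' S s0 s'0 S0; exact: sign_key.
  by move=> w; apply: key; exact: idt.
have AB : A `<=` (B `|` C) `|` N.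
  have key (x y z : R) : x * z < 0 -> (x * y < 0 \/ y * z < 0) \/ y = 0.
    move=> h; have [->|y0] := eqVneq y 0; [by right|left].
    have [h1|h1] := ltP (x * y) 0; [by left|right].
    rewrite ltNge; apply/negP => h2.
    have : 0 < y ^+ 2 by rewrite exprn_even_gt0.
    have := mulr_ge0 h1 h2; nra.
  by move=> w; exact: key.
(* Two sign changes would restore the initial sign, whereas [sign_key] forces opposite signs at the
   ends. *)
have BC : B `&` C = set0.
  apply/seteqP; split => // w [].
  have key (x y z : R) : y * sin (c + c') = x * sin c' + z * sin c ->
      x * y < 0 -> y * z < 0 -> False.
    move: s0 s'0 S0; move: (sin c) (sin c') (sin (c + c')) => s s' S s0 s'0 S0 e h1 h2.
    have : x * z < 0 by apply: (sign_key s0 s'0 S0 e); left.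
    have := mulr_ge0 (ltW s0) (sqr_ge0 y); have : 0 < (x * y) * (y * z) by rewrite nmulr_rgt0.
    have : 0 <= y ^+ 2 := sqr_ge0 y; nra.
  exact: key (idt w).
have mBC : measurable (B `|` C) by apply: measurableU; exact: mlt0.
have PBC : P (B `|` C) = (pr c + pr c')%:E.
  have mB : measurable B by exact: mlt0.
  have mC : measurable C by exact: mlt0.
  transitivity (P B + P C)%E; first exact: measureU.
  by rewrite PC (prE c : P B = _).
have h : P A = P (B `|` C).
  apply/eqP; rewrite eq_le; apply/andP; split; last by apply: le_measure; rewrite ?in_setE//; exact: mlt0.
  apply: (@le_trans _ _ (P ((B `|` C) `|` N))).
    by apply: le_measure; rewrite ?in_setE//; [exact: mlt0|apply: measurableU => //; exact: meq0].
  by rewrite measureU0//; [exact: meq0|exact: Th_eq0].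
by apply: EFin_inj; rewrite -PBC -h -prE.
Qed.

Lemma rotation_lt0 c : 0 <= c <= pi ->
  P [set w | rotation 1 0 w * rotation 1 c w < 0] = (c / pi)%:E.
Proof.
move=> /andP[c0 cpi].
move: c0; rewrite le_eqVlt => /predU1P[<-|c0].
  transitivity (P set0); last by rewrite mul0r measure0.
  congr (P _); apply/seteqP; split => // w.
  by rewrite /= ltNge -expr2 sqr_ge0.
rewrite [LHS]prE (additive_linear (pi_gt0 R) _ prD)//.
  by move=> e _ _; rewrite fine_ge0.
(* Rotation by pi is negation, so a sign change fails only where the variable vanishes. *)
have -> : pr pi = fine (P (~` [set w | Th 0 w = 0])).
  congr (fine (P _)); apply/seteqP; split => w /=.
    by rewrite cospi sinpi cos0 sin0 => h e; move: h; nra.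
  rewrite cospi sinpi cos0 sin0 !mul0r !addr0 !mul1r mulN1r mulrN oppr_lt0 => /eqP h.
  by rewrite -expr2 exprn_even_gt0.
by rewrite probability_setC; [rewrite Th_eq0 sube0|exact: meq0].
Qed.

(** The pair has the transform of two vectors of lengths sqrt s11 and sqrt s22 at angle [acos] of
    the correlation; the positive lengths do not affect signs. *)
Lemma gaussian_pair_lt0 U V (s11 s12 s22 : R) : 0 < s11 -> 0 < s22 ->
  `|s12 / (Num.sqrt s11 * Num.sqrt s22)| <= 1 ->
  gaussian_pair U V s11 s12 s22 ->
  P [set w | U w * V w < 0] =
  (acos (s12 / (Num.sqrt s11 * Num.sqrt s22)) / pi)%:E.
Proof.
move=> s110 s220 s1 UV; set k := _ / _ in s1 *.
have k1 : -1 <= k <= 1 by rewrite -ler_norml.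
rewrite -rotation_lt0; last by rewrite acos_ge0//= acos_lepi.
have r1 : 0 < Num.sqrt s11 by rewrite sqrtr_gt0.
have r2 : 0 < Num.sqrt s22 by rewrite sqrtr_gt0.
transitivity (P [set w | rotation (Num.sqrt s11) 0 w * rotation (Num.sqrt s22) (acos k) w < 0]).
  apply: same_transform_lt0; apply: gaussian_pair_same_transform UV _.
  have := @gaussian_pair_rotation (Num.sqrt s11) 0 (Num.sqrt s22) (acos k).
  rewrite subr0 acosK// !sqr_sqrtr ?ltW// /k.
  by rewrite [_ * (s12 / _)]mulrC divfK// mulf_neq0// gt_eqF.
congr (P _); apply/seteqP; split => w /=; rewrite !mul1r mulrACA.
  by rewrite pmulr_rlt0 ?mulr_gt0.
by move=> h; rewrite pmulr_rlt0 ?mulr_gt0.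
Qed.

(** The degenerate pair (U, U) has the transform of the variable sqrt s11 * X taken twice, so the
    small ball bound of X rescales. *)
Lemma gaussian_pair_ball U V (s11 s12 s22 e C : R) : 0 < s11 -> 0 <= e ->
  (forall r : R, 0 <= r -> (P [set w | (`|X w| <= r)%R] <= (C * r)%:E)%E) ->
  gaussian_pair U V s11 s12 s22 ->
  (P [set w | (`|U w| <= e)%R] <= (C * (e / Num.sqrt s11))%:E)%E.
Proof.
move=> s110 e0 XC UV.
have r1 : 0 < Num.sqrt s11 by rewrite sqrtr_gt0.
have UU : gaussian_pair U U s11 s11 s11.
  move=> p q; have := UV (p + q) 0.
  rewrite [X in Phi X](_ : _ = p ^+ 2 * s11 + 2 * p * q * s11 + q ^+ 2 * s11); last by ring.
  move=> [h1 h2]; split; [rewrite -h1|rewrite -[RHS]h2]; apply: eq_Rintegral => w _;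
    [congr cos|congr sin]; ring.
have -> : P [set w | `|U w| <= e] = P [set w | `|rotation (Num.sqrt s11) 0 w| <= e].
  apply: (@same_transform_ball _ _ _ _ U U _ (rotation (Num.sqrt s11) 0)) => //.
  apply: gaussian_pair_same_transform UU _.
  have := @gaussian_pair_rotation (Num.sqrt s11) 0 (Num.sqrt s11) 0.
  by rewrite subr0 cos0 mulr1 -expr2 sqr_sqrtr// ltW.
rewrite (_ : [set w | _] = [set w | `|X w| <= e / Num.sqrt s11]).
  by apply: XC; rewrite divr_ge0// ltW.
apply/seteqP; split => w /=; rewrite cos0 sin0 mul0r addr0 mul1r normrM (gtr0_norm r1).
  by rewrite ler_pdivlMr// mulrC.
by rewrite ler_pdivlMr// mulrC.
Qed.
End gaussian_pairs.

(** * Dirichlet kernels and the covariance of the process *)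

Section dirichlet.
Context {R : realType}.
Implicit Types (n : nat) (t s x alpha : R).

Lemma natSM n x : n.+1%:R * x = n%:R * x + x.
Proof. by rewrite -natr1 mulrDl mul1r. Qed.

Lemma is_derive_mulr (a t : R) : is_derive t 1 (fun x => x * a) a.
Proof.
rewrite (_ : (fun x => x * a) = (fun x => 0 + a * x)).
  by apply: is_derive_eq; rewrite add0r mul1r /GRing.scale/= mulr1.
by apply/funext => x; rewrite add0r mulrC.
Qed.

Lemma is_derive_mull (a t : R) : is_derive t 1 (fun x => a * x) a.
Proof. by under eq_fun do rewrite mulrC; exact: is_derive_mulr. Qed.

(** The Chebyshev polynomial of the second kind of index n - 1. Using a polynomial in cos(t / 2)
    makes the kernel below smooth at the zeros of sin(t / 2). *)
Fixpoint chebU n : {poly R} :=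
  match n with
  | 0 => 0
  | m.+1 => match m with 0 => 1 | k.+1 => 2 *: ('X * chebU m) - chebU k end
  end.

(* The kernel sin(n t / 2) / sin(t / 2), extended by continuity. *)
Definition dirichlet n t : R := (chebU n).[cos (t / 2)].

Lemma dirichlet0 t : dirichlet 0 t = 0. Proof. by rewrite /dirichlet horner0. Qed.

Lemma dirichlet1 t : dirichlet 1 t = 1. Proof. by rewrite /dirichlet hornerC. Qed.

Lemma dirichletSS n t :
  dirichlet n.+2 t = 2 * cos (t / 2) * dirichlet n.+1 t - dirichlet n t.
Proof. rewrite /dirichlet -[chebU n.+2]/(2 *: ('X * chebU n.+1) - chebU n).
by rewrite hornerD hornerN hornerZ hornerM hornerX mulrA. Qed.

Lemma sin_dirichlet n t : sin (t / 2) * dirichlet n t = sin (n%:R * (t / 2)).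
Proof.
suff : sin (t / 2) * dirichlet n t = sin (n%:R * (t / 2)) /\
       sin (t / 2) * dirichlet n.+1 t = sin (n.+1%:R * (t / 2)) by case.
elim: n => [|n [IH1 IH2]].
  by rewrite dirichlet0 dirichlet1 mulr0 mul0r sin0 mulr1 mul1r.
split => //; rewrite dirichletSS mulrBr IH1.
have -> : sin (t / 2) * (2 * cos (t / 2) * dirichlet n.+1 t) =
  2 * cos (t / 2) * (sin (t / 2) * dirichlet n.+1 t) by ring.
rewrite IH2; set x := t / 2; rewrite !natSM !(sinD, cosD).
have h := sin2cos2 x.
ring: h.
Qed.

Lemma dirichletS n t :
  dirichlet n.+1 t = cos (n%:R * (t / 2)) + cos (t / 2) * dirichlet n t.
Proof.
suff : dirichlet n.+1 t = cos (n%:R * (t / 2)) + cos (t / 2) * dirichlet n t /\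
       dirichlet n.+2 t = cos (n.+1%:R * (t / 2)) + cos (t / 2) * dirichlet n.+1 t by case.
elim: n => [|n [IH1 IH2]].
  by rewrite dirichletSS dirichlet0 dirichlet1 !mul0r mul1r cos0; split; ring.
split => //; rewrite [LHS]dirichletSS IH2.
have := sin_dirichlet n.+1 t; have := sin_dirichlet n t.
move: IH1 IH2; set x := t / 2 => IH1 IH2.
rewrite !natSM !(sinD, cosD) => h1 h2.
rewrite IH1 -h1.
have h := sin2cos2 x.
ring: h.
Qed.

Lemma sum_cos_dirichlet n t :
  \sum_(1 <= k < n.+1) cos (k%:R * t) = cos (n.+1%:R * (t / 2)) * dirichlet n t.
Proof.
elim: n => [|n IH]; first by rewrite big_geq// dirichlet0 mulr0.
rewrite big_nat_recr//= IH dirichletS.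
have h1 := sin_dirichlet n t.
have -> : n.+1%:R * t = n%:R * (t / 2) + n%:R * (t / 2) + (t / 2 + t / 2).
  by rewrite natSM; field.
set x := t / 2 in h1 *; rewrite !natSM !(sinD, cosD) -h1.
have h := sin2cos2 x.
have h2 : cos (n%:R * x) ^+ 2 = 1 - (sin x * dirichlet n t) ^+ 2.
  by have := cos2Dsin2 (n%:R * x); rewrite h1; lra.
ring: h h2.
Qed.

Lemma sum_sin_dirichlet n t :
  \sum_(1 <= k < n.+1) sin (k%:R * t) = sin (n.+1%:R * (t / 2)) * dirichlet n t.
Proof.
elim: n => [|n IH]; first by rewrite big_geq// dirichlet0 mulr0.
rewrite big_nat_recr//= IH dirichletS.
have h1 := sin_dirichlet n t.
have -> : n.+1%:R * t = n%:R * (t / 2) + n%:R * (t / 2) + (t / 2 + t / 2).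
  by rewrite natSM; field.
set x := t / 2 in h1 *; rewrite !natSM !(sinD, cosD) -h1.
have h := sin2cos2 x.
have h2 : cos (n%:R * x) ^+ 2 = 1 - (sin x * dirichlet n t) ^+ 2.
  by have := cos2Dsin2 (n%:R * x); rewrite h1; lra.
ring: h h2.
Qed.

Lemma dirichletD2pi n t : dirichlet n (t + 2 * pi) = (- 1) ^+ n.+1 * dirichlet n t.
Proof.
suff : dirichlet n (t + 2 * pi) = (- 1) ^+ n.+1 * dirichlet n t /\
       dirichlet n.+1 (t + 2 * pi) = (- 1) ^+ n.+2 * dirichlet n.+1 t by case.
elim: n => [|n [IH1 IH2]]; first by rewrite !dirichlet0 !dirichlet1; split; ring.
split => //; rewrite !dirichletSS IH1 IH2.
have -> : (t + 2 * pi) / 2 = t / 2 + pi by field.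
by rewrite cosDpi !exprS; ring.
Qed.

Definition dirichlet' n t : R := - (2^-1 * sin (t / 2)) * (chebU n)^`().[cos (t / 2)].

Global Instance is_derive_dirichlet n t : is_derive t 1 (dirichlet n) (dirichlet' n t).
Proof.
have h1 := is_derive_mulr 2^-1 t.
have h2 : is_derive t 1 (fun x => cos (x / 2)) (- (2^-1 * sin (t / 2))).
  have := @is_derive1_comp _ cos (fun x => x / 2) t _ _ (is_derive_cos (t / 2)) h1.
  by move=> h; apply: (is_derive_eq h); rewrite mulNr mulrC.
have h3 : is_derive (cos (t / 2)) 1 (fun x => (chebU n).[x]) (chebU n)^`().[cos (t / 2)].
  exact: is_derive_poly.
have := @is_derive1_comp _ (fun x => (chebU n).[x]) (fun x => cos (x / 2)) t _ _ h3 h2.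
by move=> h; apply: (is_derive_eq h); rewrite /dirichlet' mulrC.
Qed.

Lemma continuous_half : continuous (fun x : R => x / 2).
Proof. by move=> x; apply: cvgM; [exact: cvg_id|exact: cvg_cst]. Qed.

Lemma continuous_dirichlet n : continuous (dirichlet n).
Proof.
move=> t; apply: differentiable_continuous; apply/derivable1_diffP.
by have [] := is_derive_dirichlet n t.
Qed.

Lemma continuous_dirichlet' n : continuous (dirichlet' n).
Proof.
move=> t; apply: cvgM.
  apply: cvgN; apply: cvgM; first exact: cvg_cst.
  by apply: (@continuous_comp _ _ _ (fun x => x / 2) sin); [exact: continuous_half|exact: continuous_sin].
apply: (@continuous_comp _ _ _ (fun x => cos (x / 2)) (fun x => (chebU n)^`().[x])).
  by apply: (@continuous_comp _ _ _ (fun x => x / 2) cos); [exact: continuous_half|exact: continuous_cos].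
exact: continuous_horner.
Qed.

(** Obtained by differentiating both sides of [sin_dirichlet] and using uniqueness of the
    derivative. *)
Lemma sin_dirichlet' n t : sin (t / 2) * dirichlet' n t =
  n%:R / 2 * cos (n%:R * (t / 2)) - 2^-1 * cos (t / 2) * dirichlet n t.
Proof.
suff : sin (t / 2) * dirichlet' n t + 2^-1 * cos (t / 2) * dirichlet n t =
    n%:R / 2 * cos (n%:R * (t / 2)) by move=> <-; ring.
have h1 := is_derive_mulr 2^-1 t.
have h2 : is_derive t 1 (fun x => sin (x / 2)) (2^-1 * cos (t / 2)).
  have := @is_derive1_comp _ sin (fun x => x / 2) t _ _ (is_derive_sin (t / 2)) h1.
  by move=> h; apply: (is_derive_eq h); rewrite mulrC.
have h4 : is_derive t 1 (fun x => n%:R * (x / 2) : R) (n%:R / 2).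
  rewrite (_ : (fun x => _) = (fun x => x * (n%:R / 2))); first exact: is_derive_mulr.
  by apply/funext => x; ring.
have h5 : is_derive t 1 (fun x => sin (n%:R * (x / 2))) (n%:R / 2 * cos (n%:R * (t / 2))).
  have := @is_derive1_comp _ sin (fun x => n%:R * (x / 2)) t _ _ (is_derive_sin (n%:R * (t / 2))) h4.
  by move=> h; apply: (is_derive_eq h); rewrite mulrC.
have h6 : is_derive t 1 (fun x => sin (x / 2) * dirichlet n x)
   (sin (t / 2) * dirichlet' n t + dirichlet n t * (2^-1 * cos (t / 2))).
  exact: is_deriveM.
have e : (fun x => sin (x / 2) * dirichlet n x) = (fun x => sin (n%:R * (x / 2))).
  by apply/funext => x; exact: sin_dirichlet.
rewrite e in h6; have := @derive_val _ _ _ _ _ _ _ h6; rewrite (@derive_val _ _ _ _ _ _ _ h5) => ->.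
ring.
Qed.

Lemma modpiE t : exists k : int, t = modpi t + k%:~R * pi.
Proof. by exists (Num.floor (t / pi)); rewrite /modpi subrK. Qed.

Lemma modpi_itv t : 0 <= modpi t < pi.
Proof.
have pi0 := pi_gt0 R; rewrite /modpi subr_ge0 ltrBlDr.
have /andP[h1 h2] := floor_itv (t / pi).
apply/andP; split; first by rewrite -ler_pdivlMr.
rewrite intrD mulr1z in h2.
by rewrite -[X in X + _]mul1r -mulrDl addrC -ltr_pdivrMr.
Qed.

Lemma sin_cosDintpi (k : int) t : exists b : bool,
  sin (t + k%:~R * pi) = (- 1) ^+ b * sin t /\ cos (t + k%:~R * pi) = (- 1) ^+ b * cos t.
Proof.
have nat_case (m : nat) (u : R) : exists b : bool,
    sin (u + m%:R * pi) = (- 1) ^+ b * sin u /\ cos (u + m%:R * pi) = (- 1) ^+ b * cos u.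
  elim: m u => [|m IH] u; first by exists false; rewrite mul0r addr0 !mul1r.
  have [b [h1 h2]] := IH (u + pi).
  exists (~~ b); rewrite natSM (addrC (m%:R * pi)) addrA h1 h2 sinDpi cosDpi.
  by case: (b) => /=; rewrite ?expr0 ?expr1; split; ring.
case: k => m; first exact: nat_case.
have [b [h1 h2]] := nat_case m.+1 (t + (Negz m)%:~R * pi).
exists b; rewrite NegzE mulrNz mulNr -[(m.+1)%:~R]/(m.+1%:R) subrK in h1 h2 *.
by rewrite h1 h2; split; case: b {h1 h2} => /=; rewrite ?expr0 ?expr1; ring.
Qed.

Lemma sin_neq0 t : (forall k : int, t <> k%:~R * pi) -> sin t != 0.
Proof.
move=> tk; have [k tE] := modpiE t.
have [b [+ _]] := sin_cosDintpi k (modpi t); rewrite -tE => ->.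
rewrite mulf_neq0 ?signr_eq0//.
have /andP[+ h2] := modpi_itv t; rewrite le_eqVlt => /predU1P[h|h1].
  by case: (tk k); rewrite {1}tE -h add0r.
by rewrite gt_eqF// sin_gt0_pi// h1.
Qed.

End dirichlet.

(** * Covariance of the trigonometric polynomial and the angular speed *)

Section trig_covariance.
Context {R : realType}.
Variables (alpha : R) (n : nat).
Implicit Types (s t p q : R).

Definition dirichlet_dot s t : R :=
  dirichlet n (t - alpha) * dirichlet n (s - alpha) +
  dirichlet n (t + alpha) * dirichlet n (s + alpha).

Definition trig_cov s t : R :=
  (2 * n%:R)^-1 * cos (n.+1%:R / 2 * (t - s)) * dirichlet_dot s t.

(** The rank 2 of the covariance made visible: the variance is the squared modulus of the sum of c_k
    exp(i k alpha). *)
Lemma combination_var_cos (c : nat -> R) :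
  combination_var (fun m : int => cos (m%:~R * alpha)) c n =
  (\sum_(1 <= k < n.+1) c k * cos (k%:R * alpha)) ^+ 2 +
  (\sum_(1 <= k < n.+1) c k * sin (k%:R * alpha)) ^+ 2.
Proof.
rewrite !expr2 !big_distrlr/= -big_split/=; apply: eq_bigr => k _.
rewrite -big_split/=; apply: eq_bigr => l _.
by rewrite rmorphB/= mulrBl cosB; ring.
Qed.

(** Product-to-sum formulas move the sums to the points u + alpha and u - alpha, where they are
    Dirichlet kernels with a phase. Between s and t this phase advances by (n + 1)(t - s) / 2 for
    either sign of alpha, hence the common cosine factor. *)
Lemma combination_var_trig p q s t : (0 < n)%N ->
  let rho := fun m : int => cos (m%:~R * alpha) in
  combination_var rho (fun k => (Num.sqrt n%:R)^-1 *
    (p * cos (k%:R * s) + q * cos (k%:R * t))) n +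
  combination_var rho (fun k => (Num.sqrt n%:R)^-1 *
    (p * sin (k%:R * s) + q * sin (k%:R * t))) n =
  p ^+ 2 * trig_cov s s + 2 * p * q * trig_cov s t + q ^+ 2 * trig_cov t t.
Proof.
move=> n0 rho; rewrite !combination_var_cos.
pose C u := \sum_(1 <= k < n.+1) cos (k%:R * u) : R.
pose S u := \sum_(1 <= k < n.+1) sin (k%:R * u) : R.
set x := (Num.sqrt n%:R)^-1.
have x2 : x ^+ 2 = n%:R^-1 by rewrite exprVn sqr_sqrtr.
have cc u : \sum_(1 <= k < n.+1) cos (k%:R * u) * cos (k%:R * alpha) = 2^-1 * (C (u + alpha) + C (u - alpha)).
  rewrite /C -big_split/= big_distrr/=; apply: eq_bigr => k _.
  by rewrite (mulrDr k%:R u alpha) (mulrBr k%:R u alpha) cosB cosD; field.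
have cs u : \sum_(1 <= k < n.+1) cos (k%:R * u) * sin (k%:R * alpha) = 2^-1 * (S (u + alpha) - S (u - alpha)).
  rewrite /S -sumrB big_distrr/=; apply: eq_bigr => k _.
  by rewrite (mulrDr k%:R u alpha) (mulrBr k%:R u alpha) sinB sinD; field.
have sc u : \sum_(1 <= k < n.+1) sin (k%:R * u) * cos (k%:R * alpha) = 2^-1 * (S (u + alpha) + S (u - alpha)).
  rewrite /S -big_split/= big_distrr/=; apply: eq_bigr => k _.
  by rewrite (mulrDr k%:R u alpha) (mulrBr k%:R u alpha) sinB sinD; field.
have ss u : \sum_(1 <= k < n.+1) sin (k%:R * u) * sin (k%:R * alpha) = 2^-1 * (C (u - alpha) - C (u + alpha)).
  rewrite /C -sumrB big_distrr/=; apply: eq_bigr => k _.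
  by rewrite (mulrDr k%:R u alpha) (mulrBr k%:R u alpha) cosB cosD; field.
have lin (F G H : nat -> R) : \sum_(1 <= k < n.+1) x * (p * F k + q * G k) * H k =
   x * (p * \sum_(1 <= k < n.+1) F k * H k + q * \sum_(1 <= k < n.+1) G k * H k).
  rewrite !big_distrr/= -big_split/= big_distrr/=.
  by apply: eq_bigr => k _; ring.
rewrite !lin !(cc, cs, sc, ss) /C /S !sum_cos_dirichlet !sum_sin_dirichlet.
rewrite /trig_cov /dirichlet_dot !exprMn x2 !subrr !mulr0 cos0 !mulr1.
set m := n.+1%:R.
have n1 : n%:R != 0 :> R by rewrite pnatr_eq0 -lt0n.
have h1 : cos (m * ((s + alpha) / 2)) * cos (m * ((t + alpha) / 2)) =
    cos (m / 2 * (t - s)) - sin (m * ((s + alpha) / 2)) * sin (m * ((t + alpha) / 2)).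
  have -> : m / 2 * (t - s) = m * ((t + alpha) / 2) - m * ((s + alpha) / 2) by field.
  by rewrite cosB; ring.
have h2 : cos (m * ((s - alpha) / 2)) * cos (m * ((t - alpha) / 2)) =
    cos (m / 2 * (t - s)) - sin (m * ((s - alpha) / 2)) * sin (m * ((t - alpha) / 2)).
  have -> : m / 2 * (t - s) = m * ((t - alpha) / 2) - m * ((s - alpha) / 2) by field.
  by rewrite cosB; ring.
have h3 := sin2cos2 (m * ((s + alpha) / 2)).
have h4 := sin2cos2 (m * ((s - alpha) / 2)).
have h5 := sin2cos2 (m * ((t + alpha) / 2)).
have h6 := sin2cos2 (m * ((t - alpha) / 2)).
move: h1 h2 h3 h4 h5 h6.
move: (cos (m / 2 * (t - s))) (cos (m * ((s + alpha) / 2))) (cos (m * ((s - alpha) / 2)))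
  (cos (m * ((t + alpha) / 2))) (cos (m * ((t - alpha) / 2))) (sin (m * ((s + alpha) / 2)))
  (sin (m * ((s - alpha) / 2))) (sin (m * ((t + alpha) / 2))) (sin (m * ((t - alpha) / 2)))
  (dirichlet n (s + alpha)) (dirichlet n (s - alpha))
  (dirichlet n (t + alpha)) (dirichlet n (t - alpha)).
move=> K c1 c2 c3 c4 s1 s2 s3 s4 d1 d2 d3 d4 h1 h2 h3 h4 h5 h6.
rewrite invfM; move: (n%:R^-1) => y.
by field: h1 h2 h3 h4 h5 h6.
Qed.

Hypothesis n_gt0 : (0 < n)%N.
Hypothesis sin_na : sin (n%:R * alpha) != 0.

(** If both kernels vanished, so would the sines of n (t + alpha) / 2 and n (t - alpha) / 2, hence
    that of their difference n alpha. *)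
Lemma dirichlet_dot_gt0 t : 0 < dirichlet_dot t t.
Proof.
rewrite lt_neqAle addr_ge0 -?expr2 ?sqr_ge0// andbT; apply: contra sin_na.
rewrite eq_sym paddr_eq0 ?sqr_ge0// !sqrf_eq0 => /andP[/eqP d1 /eqP d2].
have h1 := sin_dirichlet n (t - alpha); have h2 := sin_dirichlet n (t + alpha).
rewrite d1 mulr0 in h1; rewrite d2 mulr0 in h2.
have -> : n%:R * alpha = n%:R * ((t + alpha) / 2) - n%:R * ((t - alpha) / 2) by field.
by rewrite sinB -h1 -h2 mul0r mulr0 subrr.
Qed.

(* The angular speed of the plane curve of coordinates D(t - alpha), D(t + alpha). *)
Definition wronskian t : R :=
  (dirichlet n (t - alpha) * dirichlet' n (t + alpha) -
   dirichlet n (t + alpha) * dirichlet' n (t - alpha)) / dirichlet_dot t t.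

(** The parts of the derivatives that carry the factor n combine by the subtraction formula into
    sin(n alpha), the others into sin(alpha) / n. In the limit the former gives the numerator of
    [g_fun] up to sign, and the latter disappears. *)
Lemma wronskianE t : sin ((t - alpha) / 2) != 0 -> sin ((t + alpha) / 2) != 0 ->
  2 * wronskian t / n%:R =
  ((n%:R)^-1 * sin alpha * sin (n%:R * ((t - alpha) / 2)) * sin (n%:R * ((t + alpha) / 2)) -
   sin (n%:R * alpha) * sin ((t - alpha) / 2) * sin ((t + alpha) / 2)) /
  (sin (n%:R * ((t - alpha) / 2)) ^+ 2 * sin ((t + alpha) / 2) ^+ 2 +
   sin (n%:R * ((t + alpha) / 2)) ^+ 2 * sin ((t - alpha) / 2) ^+ 2).
Proof.
move=> sm0 sp0; have D0 := dirichlet_dot_gt0 t.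
have n0 : n%:R != 0 :> R by rewrite pnatr_eq0 -lt0n.
have h1 := sin_dirichlet n (t - alpha); have h2 := sin_dirichlet n (t + alpha).
have h3 := sin_dirichlet' n (t - alpha); have h4 := sin_dirichlet' n (t + alpha).
have e1 : sin (n%:R * alpha) = sin (n%:R * ((t + alpha) / 2)) * cos (n%:R * ((t - alpha) / 2)) -
   cos (n%:R * ((t + alpha) / 2)) * sin (n%:R * ((t - alpha) / 2)).
  by rewrite -sinB; congr sin; field.
have e2 : sin alpha = sin ((t + alpha) / 2) * cos ((t - alpha) / 2) -
   cos ((t + alpha) / 2) * sin ((t - alpha) / 2).
  by rewrite -sinB; congr sin; field.
rewrite /wronskian e1 e2.
rewrite /dirichlet_dot in D0 *.
move: (dirichlet n (t - alpha)) (dirichlet n (t + alpha)) (dirichlet' n (t - alpha))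
  (dirichlet' n (t + alpha)) D0 h1 h2 h3 h4 => d1 d2 d1' d2' D0 h1 h2 h3 h4.
rewrite -h1 -h2 in h3 h4 *.
move: (sin ((t - alpha) / 2)) (sin ((t + alpha) / 2)) sm0 sp0 h1 h2 h3 h4 => sm sp sm0 sp0 h1 h2 h3 h4.
move: (cos ((t - alpha) / 2)) (cos ((t + alpha) / 2)) h3 h4 => cm cp h3 h4.
move: (cos (n%:R * ((t - alpha) / 2))) (cos (n%:R * ((t + alpha) / 2))) h3 h4 => Cm Cp h3 h4.
have -> : d1' = (n%:R / 2 * Cm - 2^-1 * cm * d1) / sm by rewrite -h3; field.
have -> : d2' = (n%:R / 2 * Cp - 2^-1 * cp * d2) / sp by rewrite -h4; field.
have D1 : d1 * d1 + d2 * d2 != 0 by rewrite gt_eqF.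
have -> : (sm * d1) ^+ 2 * sp ^+ 2 + (sp * d2) ^+ 2 * sm ^+ 2 =
   (sm * sp) ^+ 2 * (d1 * d1 + d2 * d2) by ring.
by field; rewrite sm0 sp0 D1 n0.
Qed.

Lemma continuous_wronskian : continuous wronskian.
Proof.
have cm (f : R -> R) c : continuous f -> continuous (fun t => f (t + c)).
  move=> cf t; apply: (@continuous_comp _ _ _ (fun t => t + c) f); last exact: cf.
  by apply: cvgD; [exact: cvg_id|exact: cvg_cst].
have c1 := cm _ (- alpha) (@continuous_dirichlet _ n).
have c2 := cm _ alpha (@continuous_dirichlet _ n).
have c3 := cm _ (- alpha) (@continuous_dirichlet' _ n).
have c4 := cm _ alpha (@continuous_dirichlet' _ n).
move=> t; apply: cvgM.
  by apply: cvgB; apply: cvgM; [exact: c1|exact: c4|exact: c2|exact: c3].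
apply: cvgV; first by rewrite gt_eqF// dirichlet_dot_gt0.
by apply: cvgD; apply: cvgM; [exact: c1|exact: c1|exact: c2|exact: c2].
Qed.

Lemma dirichlet'D2pi t : dirichlet' n (t + 2 * pi) = (- 1) ^+ n.+1 * dirichlet' n t.
Proof.
have h1 : is_derive t 1 (fun x => dirichlet n (x + 2 * pi)) (dirichlet' n (t + 2 * pi)).
  have hs : is_derive t 1 (fun x => x + 2 * pi : R) 1.
    by apply: is_derive_eq; rewrite addr0.
  have := @is_derive1_comp _ (dirichlet n) (fun x => x + 2 * pi) t _ _ (is_derive_dirichlet n (t + 2 * pi)) hs.
  by move=> h; apply: (is_derive_eq h); rewrite mulr1.
have e : (fun x : R => dirichlet n (x + 2 * pi)) = (fun x => (-1) ^+ n.+1 * dirichlet n x).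
  by apply/funext => x; exact: dirichletD2pi.
rewrite e in h1.
have h2 : is_derive t 1 (fun x => (-1) ^+ n.+1 * dirichlet n x) ((-1) ^+ n.+1 * dirichlet' n t).
  exact: is_deriveZ.
by rewrite -(@derive_val _ _ _ _ _ _ _ h1) -(@derive_val _ _ _ _ _ _ _ h2).
Qed.

(** Kernels and derivatives are multiplied by the same sign, and numerator and denominator are both
    quadratic in them. *)
Lemma wronskianD2pi t : wronskian (t + 2 * pi) = wronskian t.
Proof.
rewrite /wronskian /dirichlet_dot.
have -> : t + 2 * pi - alpha = t - alpha + 2 * pi by ring.
have -> : t + 2 * pi + alpha = t + alpha + 2 * pi by ring.
rewrite !dirichletD2pi !dirichlet'D2pi.
have -> : (-1) ^+ n.+1 = (- 1) ^+ (odd n.+1) :> R by rewrite signr_odd.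
by case: (odd n.+1); rewrite ?expr0 ?expr1; congr (_ / _); ring.
Qed.
End trig_covariance.

(** * Counting zeros by sign changes *)

Section sign_changes.
Context {R : realType}.
Notation mu := (@lebesgue_measure R).
Variables (f : R -> R) (L : R).
Hypothesis cf : continuous f.

Definition sign_change_set (h : R) := [set t | 0 <= t <= L - h /\ f t * f (t + h) < 0].

Lemma measurable_sign_change_set h : measurable (sign_change_set h).
Proof.
apply: measurableI.
  by have := @measurable_itv R `[0, L - h]; rewrite set_itvE.
have : measurable_fun setT (fun t => f t * f (t + h)).
  apply: measurable_funM; first exact: continuous_measurable_fun.
  apply: continuous_measurable_fun => t.
  apply: (@continuous_comp _ _ _ (fun t => t + h) f); last exact: cf.
  by apply: cvgD; [exact: cvg_id|exact: cvg_cst].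
by move/(_ measurableT `]-oo, 0[%classic (measurable_itv _)); rewrite set_itvE setTI.
Qed.

Lemma sign_change_zero (h t : R) : 0 <= h -> f t * f (t + h) < 0 ->
  exists2 z, t < z < t + h & f z = 0.
Proof.
move=> h0 ft.
have [z zI fz] : exists2 z, z \in `[t, t + h] & f z = 0.
  apply: (@IVT _ f t (t + h) 0).
  - by rewrite lerDl.
  - by apply: continuous_subspaceT.
  - have [h1|h1] := leP (f t) (f (t + h)).
      by apply/andP; split; nra.
    by apply/andP; split; nra.
exists z => //; move: zI; rewrite in_itv/= => /andP[]; rewrite !le_eqVlt.
move=> /predU1P[e|h1]; first by exfalso; move: ft; rewrite e fz mul0r ltxx.
move=> /predU1P[e|h2]; first by exfalso; move: ft; rewrite -e fz mulr0 ltxx.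
by rewrite h1.
Qed.

Lemma measure_itv_cover (h : R) (s : seq R) : 0 <= h ->
  (mu (\big[setU/set0]_(z <- s) `[(z - h)%R, z]%classic) <= ((size s)%:R * h)%:E)%E.
Proof.
move=> h0; elim: s => [|z s IH]; first by rewrite big_nil measure0 mul0r.
rewrite big_cons; apply: (@le_trans _ _ (mu `[(z - h)%R, z]%classic + mu (\big[setU/set0]_(z <- s) `[(z - h)%R, z]%classic))%E).
  apply: measureU2 => //; apply: bigsetU_measurable => //.
have -> : mu `[z - h, z]%classic = h%:E.
  rewrite lebesgue_measure_itv/= lte_fin ltrBlDr ltrDl.
  move: h0; rewrite le_eqVlt => /predU1P[<-|h0]; first by rewrite ltxx.
  by rewrite h0 -EFinB; congr EFin; ring.
rewrite /= -natr1 mulrDl mul1r addeC EFinD.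
by rewrite leeD2r.
Qed.

(** By the intermediate value theorem a sign change between t and t + h puts t in [z - h, z] for
    some zero z. *)
Lemma sign_change_le_zeros (h : R) (s : seq R) : 0 <= h ->
  (forall z, 0 <= z <= L -> f z = 0 -> z \in s) ->
  (mu (sign_change_set h) <= ((size s)%:R * h)%:E)%E.
Proof.
move=> h0 sz; apply: le_trans (measure_itv_cover s h0).
have m1 := @measurable_sign_change_set h.
have m2 : measurable (\big[setU/set0]_(z <- s) `[z - h, z]%classic) by exact: bigsetU_measurable.
apply: (le_measure mu (mem_set m1) (mem_set m2)).
move=> t [/andP[t0 tL] /(sign_change_zero h0)[z /andP[tz zt] fz]].
have zs : z \in s by apply: sz => //; apply/andP; split; lra.
rewrite -bigcup_seq; exists z => //=; rewrite in_itv/=; apply/andP; split; lra.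
Qed.

Lemma sign_change_le_nb_zeros (h : R) : 0 < h ->
  (mu (sign_change_set h) <= h%:E * nb_zeros f `[0%R, L])%E.
Proof.
move=> h0; rewrite /nb_zeros /counting; case: asboolP => [finZ|_]; last first.
  by rewrite gt0_muley ?lte_fin// leey.
rewrite -EFinM mulrC; set Z := fset_set _.
apply: sign_change_le_zeros; first exact: ltW.
move=> z zI fz; suff : z \in Z by [].
by rewrite in_fset_set//; apply/mem_set; split => //; rewrite /= in_itv.
Qed.

Lemma measure_itv_disjoint (h : R) (s : seq R) : 0 <= h -> uniq s ->
  {in s &, forall z z', z != z' -> h <= `|z - z'|} ->
  mu (\big[setU/set0]_(z <- s) `]z - h, z[%classic) = ((size s)%:R * h)%:E.
Proof.
move=> h0; elim: s => [|z s IH]; first by rewrite big_nil measure0 mul0r.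
move=> /= /andP[zs us] hs; rewrite big_cons.
transitivity (mu `](z - h)%R, z[%classic + mu (\big[setU/set0]_(z <- s) `](z - h)%R, z[%classic))%E.
  apply: measureU => //; first exact: bigsetU_measurable.
  apply/seteqP; split => // t []; rewrite -bigcup_seq/= in_itv/= => /andP[h1 h2] [y /= ys].
  rewrite in_itv/= => /andP[h3 h4].
  have zy : z != y by apply: contraNneq zs => ->.
  have := hs z y; rewrite !inE eqxx ys orbT => /(_ isT isT zy).
  by rewrite leNgt => /negP; apply; rewrite ltr_norml; apply/andP; split; lra.
- rewrite IH//; last by move=> x y xs ys; apply: hs; rewrite inE ?xs ?ys orbT.
  have -> : mu `]z - h, z[%classic = h%:E.
    rewrite lebesgue_measure_itv/= lte_fin ltrBlDr ltrDl.
    move: h0; rewrite le_eqVlt => /predU1P[<-|h0]; first by rewrite ltxx.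
    by rewrite h0 -EFinB; congr EFin; ring.
  by rewrite -EFinD; congr EFin; rewrite -natr1; ring.
Qed.

(** [e] stands for the derivative at [z]; the Taylor bound with an explicit [M] gives the size of
    the neighbourhood where the linear term dominates. *)
Definition simple_zero (M z e : R) := e != 0 /\ forall t, `|f t - e * (t - z)| <= M * (t - z) ^+ 2.

Lemma simple_zero_sign_change M z : 0 < z < L -> (exists e, simple_zero M z e) ->
  exists2 d, 0 < d & forall h, 0 < h < d -> `]z - h, z[%classic `<=` sign_change_set h.
Proof.
move=> /andP[z0 zL] [e [e0 fe]].
pose M1 := `|M| + 1; have M10 : 0 < M1 by rewrite ltr_wpDl.
have e1 : 0 < `|e| by rewrite normr_gt0.
(* Below |e| / M1 the linear term decides the sign on either side of z; below z and L - z the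
   interval stays inside [0, L - h]. *)
exists (Num.min (`|e| / M1) (Num.min z (L - z))).
  by rewrite !lt_min divr_gt0// z0 subr_gt0.
move=> h; rewrite !lt_min => /and4P[h0 h1 h2 h3] t /=.
rewrite in_itv/= => /andP[t1 t2]; split; first by apply/andP; split; lra.
rewrite ltr_pdivlMr// in h1.
have fM u : `|u - z| < h -> u != z -> 0 < f u * (e * (u - z)).
  move=> uz uz0; have uz1 : 0 < `|u - z| by rewrite normr_gt0 subr_eq0.
  have h4 : `|f u - e * (u - z)| < `|e * (u - z)|.
    apply: (le_lt_trans (fe u)); rewrite normrM -(real_normK (num_real (u - z))) expr2 mulrA ltr_pM2r//.
    apply: (@le_lt_trans _ _ (h * M1)) => //; rewrite [leRHS]mulrC.
    apply: (@le_trans _ _ (M1 * `|u - z|)); last by rewrite ler_pM2l// ltW.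
    by rewrite ler_pM2r// (le_trans (ler_norm _))// /M1 lerDl.
  move: h4; move: (e * (u - z)) (f u) => x y.
  have [x0|x0|->] := ltgtP x 0; last by rewrite normr0 ltNge normr_ge0.
    by rewrite (ltr0_norm x0) ltr_norml => /andP[h4 h5]; rewrite nmulr_lgt0//; lra.
  by rewrite (gtr0_norm x0) ltr_norml => /andP[h4 h5]; rewrite pmulr_lgt0//; lra.
have f1 := fM t; have f2 := fM (t + h).
have {}f1 : 0 < f t * (e * (t - z)) by apply: f1; [rewrite ltr_norml; apply/andP; split; lra|rewrite lt_eqF].
have {}f2 : 0 < f (t + h) * (e * (t + h - z)).
  by apply: f2; [rewrite ltr_norml; apply/andP; split; lra|rewrite gt_eqF//; lra].
have : 0 < (f t * (e * (t - z))) * (f (t + h) * (e * (t + h - z))) by rewrite mulr_gt0.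
have -> : (f t * (e * (t - z))) * (f (t + h) * (e * (t + h - z))) =
  (f t * f (t + h)) * (e ^+ 2 * ((t - z) * (t + h - z))) by ring.
rewrite nmulr_lgt0//.
have : 0 < e ^+ 2 by rewrite exprn_even_gt0.
by move=> e2; rewrite pmulr_rlt0// nmulr_rlt0; lra.
Qed.

(** Once h is below the gaps and the individual radii, the intervals ]z - h, z[ are disjoint and
    consist of sign changes. *)
Lemma zeros_le_sign_change M (s : seq R) : uniq s ->
  (forall z, z \in s -> 0 < z < L /\ exists e, simple_zero M z e) ->
  exists2 d, 0 < d & forall h, 0 < h < d ->
    (((size s)%:R * h)%:E <= mu (sign_change_set h))%E.
Proof.
move=> us sP.
have [d1 d10 gap] : exists2 d : R, 0 < d & {in s &, forall z z', z != z' -> d <= `|z - z'|}.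
  elim: s us {sP} => [|z s IH]; first by exists 1.
  move=> /= /andP[zs /IH[d d0 dP]].
  have [d' d'0 d'P] : exists2 d : R, 0 < d & {in s, forall z', d <= `|z - z'|}.
    elim: s zs {IH dP} => [|y s IH]; first by exists 1.
    rewrite inE negb_or => /andP[zy /IH[e e0 eP]].
    exists (Num.min e `|z - y|); first by rewrite lt_min e0 normr_gt0 subr_eq0.
    move=> x; rewrite inE => /predU1P[->|/eP h]; first by rewrite ge_min lexx orbT.
    by rewrite ge_min h.
  exists (Num.min d d'); first by rewrite lt_min d0.
  move=> x y; rewrite !inE => /predU1P[->|xs] /predU1P[->|ys] xy.
  - by rewrite eqxx in xy.
  - by rewrite ge_min d'P// orbT.
  - by rewrite ge_min distrC d'P// orbT.
  - by rewrite ge_min dP.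
have [d2 d20 sub] : exists2 d : R, 0 < d & forall h, 0 < h < d ->
    forall z, z \in s -> `]z - h, z[%classic `<=` sign_change_set h.
  elim: s sP {us gap} => [|z s IH] sP; first by exists 1.
  have [d d0 dP] := IH (fun y ys => sP y ltac:(by rewrite inE ys orbT)).
  have [z0L ez] := sP z (mem_head _ _).
  have [d' d'0 d'P] := simple_zero_sign_change z0L ez.
  exists (Num.min d d'); first by rewrite lt_min d0.
  move=> h; rewrite lt_min => /and3P[h0 hd hd'] y; rewrite inE => /predU1P[->|ys].
    by apply: d'P; rewrite h0.
  by apply: dP => //; rewrite h0.
exists (Num.min d1 d2); first by rewrite lt_min d10.
move=> h; rewrite lt_min => /and3P[h0 hd1 hd2].
rewrite -(measure_itv_disjoint (ltW h0) us); last first.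
  by move=> z z' zs zs' zz'; rewrite (le_trans (ltW hd1))// gap.
have m1 := @measurable_sign_change_set h.
have m2 : measurable (\big[setU/set0]_(z <- s) `]z - h, z[%classic) by exact: bigsetU_measurable.
apply: (le_measure mu (mem_set m2) (mem_set m1)).
move=> t; rewrite -bigcup_seq => -[z /= zs]; apply: sub => //; by rewrite h0.
Qed.
End sign_changes.

(** * Zeros of combinations of two shifted Dirichlet kernels *)

Section dirichlet_roots.
Context {R : realType}.
Implicit Types (n : nat) (t s x y alpha beta : R).
Notation mu := (@lebesgue_measure R).

Lemma nb_zeros_le (f : R -> R) (I : set R) (k : nat) :
  (forall s : seq R, uniq s -> (forall z, z \in s -> I z /\ f z = 0) -> (size s <= k)%N) ->
  (nb_zeros f I <= k%:R%:E)%E.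
Proof.
move=> sk; rewrite /nb_zeros /counting; case: asboolP => [finZ|infZ]; last first.
  have [B BZ kB] := infinite_set_fset k.+1 infZ.
  have : (size (enum_fset B) <= k)%N.
    by apply: sk; [exact: fset_uniq|move=> z zB; apply: BZ].
  by rewrite leqNgt kB.
rewrite lee_fin ler_nat; apply: sk; first exact: fset_uniq.
by move=> z zZ; have : z \in fset_set _ := zZ; rewrite in_fset_set// => /set_mem.
Qed.

(* [dirichlet n (t + beta)] as a polynomial in tan (t / 2), up to a power of cos (t / 2). *)
Fixpoint dirichlet_tan beta n : {poly R} :=
  match n with
  | 0 => 0
  | m.+1 => match m with 0 => 1 | k.+1 =>
     2 *: ((cos (beta / 2))%:P - (sin (beta / 2))%:P * 'X) * dirichlet_tan beta m
     - (1 + 'X ^+ 2) * dirichlet_tan beta k end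
  end.

Lemma size_dirichlet_tan beta n : (size (dirichlet_tan beta n) <= n)%N.
Proof.
suff : ((size (dirichlet_tan beta n) <= n)%N /\ (size (dirichlet_tan beta n.+1) <= n.+1)%N) by case.
elim: n => [|n [IH1 IH2]]; first by rewrite /= size_poly0 size_polyC oner_eq0.
split => //.
rewrite -[dirichlet_tan _ n.+2]/(2 *: ((cos (beta / 2))%:P - (sin (beta / 2))%:P * 'X) * dirichlet_tan beta n.+1
     - (1 + 'X ^+ 2) * dirichlet_tan beta n).
apply: (leq_trans (size_polyD _ _)); rewrite size_polyN geq_max; apply/andP; split.
  apply: (leq_trans (size_polyMleq _ _)).
  have : (size (2 *: ((cos (beta / 2))%:P - (sin (beta / 2))%:P * 'X : {poly R})) <= 2)%N.
    apply: (leq_trans (size_scale_leq _ _)); apply: (leq_trans (size_polyD _ _)).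
    rewrite size_polyN geq_max (leq_trans (size_polyC_leq1 _))//.
    apply: (leq_trans (size_polyMleq _ _)); rewrite size_polyX.
    by have := size_polyC_leq1 (sin (beta / 2)); case: (size _) => [|[]].
  by move=> h; have := leq_add h IH2; case: (_ + _)%N.
apply: (leq_trans (size_polyMleq _ _)).
have : (size (1 + 'X ^+ 2 : {poly R})%R <= 3)%N.
  by apply: (leq_trans (size_polyD _ _)); rewrite size_polyXn size_polyC geq_max oner_eq0.
move=> h; have : (size (1 + 'X^2 : {poly R})%R + size (dirichlet_tan beta n) <= 3 + n)%N by rewrite leq_add.
by case: (_ + _)%N.
Qed.

(** In the three-term recursion, cos((t + beta) / 2) is cos(t / 2) times an affine function of tan(t
    / 2), and the factor 1 + tan^2 makes up for the two powers of the cosine missing in the last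
    term. *)
Lemma horner_dirichlet_tan beta n t : cos (t / 2) != 0 ->
  dirichlet n.+1 (t + beta) = cos (t / 2) ^+ n * (dirichlet_tan beta n.+1).[tan (t / 2)].
Proof.
move=> c0.
suff : cos (t / 2) * dirichlet n (t + beta) = cos (t / 2) ^+ n * (dirichlet_tan beta n).[tan (t / 2)] /\
  dirichlet n.+1 (t + beta) = cos (t / 2) ^+ n * (dirichlet_tan beta n.+1).[tan (t / 2)] by case.
elim: n => [|n [IH1 IH2]].
  by rewrite dirichlet0 dirichlet1 horner0 hornerC !mulr0 mulr1.
split; first by rewrite IH2 exprS mulrA.
rewrite -[dirichlet_tan _ n.+2]/(2 *: ((cos (beta / 2))%:P - (sin (beta / 2))%:P * 'X) * dirichlet_tan beta n.+1
     - (1 + 'X ^+ 2) * dirichlet_tan beta n).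
rewrite hornerD hornerN !hornerM hornerZ hornerD hornerN hornerM !hornerC hornerX hornerD hornerC hornerXn.
rewrite dirichletSS IH2.
have -> : dirichlet n (t + beta) = cos (t / 2) ^+ n * (dirichlet_tan beta n).[tan (t / 2)] / cos (t / 2).
  by rewrite -IH1 mulrAC divff// mul1r.
have -> : (t + beta) / 2 = t / 2 + beta / 2 by field.
rewrite cosD exprS.
have -> : sin (t / 2) = tan (t / 2) * cos (t / 2) by rewrite /tan divfK.
have h : tan (t / 2) ^+ 2 = (cos (t / 2) ^+ 2)^-1 - 1.
  have := cos2_tan2 c0; lra.
rewrite h; move: (_.[_]) (_.[_]) => u v; field => //.
Qed.

Lemma sin_half_inj (t s : R) : 0 <= t < 2 * pi -> 0 <= s < 2 * pi -> sin ((t - s) / 2) = 0 -> t = s.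
Proof.
move=> /andP[t0 t1] /andP[s0 s1] h.
have [ts|ts|//] := ltgtP t s.
  have : 0 < sin ((s - t) / 2) by apply: sin_gt0_pi; apply/andP; split; lra.
  have -> : (s - t) / 2 = - ((t - s) / 2) by field.
  by rewrite sinN h oppr0 ltxx.
have : 0 < sin ((t - s) / 2) by apply: sin_gt0_pi; apply/andP; split; lra.
by rewrite h ltxx.
Qed.

Lemma cos_half_neq0 (t : R) : 0 <= t <= 2 * pi -> t != pi -> cos (t / 2) != 0.
Proof.
move=> /andP[t0 t1] tp; apply/eqP => c0.
have h : sin ((t - pi) / 2) = 0.
  have -> : (t - pi) / 2 = t / 2 - pi / 2 by field.
  by rewrite sinB cos_pihalf c0 mulr0 mul0r subrr.
have p0 := pi_gt0 R.
have [tE|tE] := eqVneq t (2 * pi).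
  by move: c0; rewrite tE (_ : 2 * pi / 2 = pi) ?cospi; [lra|field].
move/eqP: tp; apply; apply: (@sin_half_inj t pi) => //.
  by rewrite t0 lt_neqAle tE.
by apply/andP; split; lra.
Qed.

(* As a function of tan (t / 2) the combination is a polynomial of degree < n, up to a power of
   cos (t / 2), so apart from t = pi and t = 2 pi it has fewer than n zeros. *)
Lemma dirichlet_pair_sign_change alpha n x y (h : R) : 0 < h ->
  (mu (sign_change_set (fun t : R => x * dirichlet n (t - alpha) + y * dirichlet n (t + alpha))%R
        (2 * pi)%R h) <= (h * n.+2%:R)%:E)%E.
Proof.
move=> h0; have p0 := pi_gt0 R.
set f := fun t : R => _.
have cf : continuous f.
  have cm c : continuous (fun t => dirichlet n (t + c)).
    move=> t; apply: (@continuous_comp _ _ _ (fun t => t + c) (dirichlet n)); last exact: continuous_dirichlet.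
    by apply: cvgD; [exact: cvg_id|exact: cvg_cst].
  by move=> t; apply: cvgD; apply: cvgM; [exact: cvg_cst|exact: cm|exact: cvg_cst|exact: cm].
case: n @f cf => [|n] f cf.
  rewrite (_ : sign_change_set _ _ _ = set0) ?measure0 ?lee_fin ?mulr_ge0//; first exact: ltW.
  by apply/seteqP; split => // t []; rewrite /f !dirichlet0 !mulr0 addr0 mul0r ltxx.
pose q := x *: dirichlet_tan (- alpha) n.+1 + y *: dirichlet_tan alpha n.+1.
have fq t : cos (t / 2) != 0 -> f t = cos (t / 2) ^+ n * q.[tan (t / 2)].
  move=> c0; rewrite /f !horner_dirichlet_tan// hornerD !hornerZ; ring.
have sq : (size q <= n.+1)%N.
  apply: (leq_trans (size_polyD _ _)); rewrite geq_max.
  by rewrite !(leq_trans (size_scale_leq _ _))// size_dirichlet_tan.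
(* If [q] is zero, [f] vanishes on [0, 2 pi] except possibly at pi, so one of the two factors is
   zero and no sign change occurs. *)
have [q0|q0] := eqVneq q 0.
  have f0 t : 0 <= t <= 2 * pi -> t != pi -> f t = 0.
    by move=> tI tp; rewrite fq ?cos_half_neq0// q0 horner0 mulr0.
  rewrite (_ : sign_change_set _ _ _ = set0) ?measure0 ?lee_fin ?mulr_ge0//; first exact: ltW.
  apply/seteqP; split => // t [/andP[t0 t1]].
  move: t0 t1; have [->|tp] := eqVneq t pi => t0 t1.
    by rewrite (f0 (pi + h)) ?mulr0 ?ltxx//; [apply/andP; split; lra|rewrite gt_eqF// ltrDl].
  by rewrite (f0 t) ?mul0r ?ltxx//; apply/andP; split; lra.
apply: (le_trans (sign_change_le_nb_zeros _ cf h0)).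
rewrite EFinM; apply: lee_wpmul2l; first by rewrite lee_fin ltW.
apply: nb_zeros_le => s us sZ.
pose s' := [seq z <- s | (z != pi) && (z != 2 * pi)].
(* At pi the tangent of t / 2 is undefined, and at 2 pi it repeats its value at 0; elsewhere it is
   injective. *)
have s's : (size s <= (size s').+2)%N.
  rewrite -(count_predC (fun z : R => (z != pi) && (z != 2 * pi)) s).
  rewrite -[(size s').+2]addn2 size_filter leq_add2l.
  rewrite (@eq_count _ _ (predU (pred1 pi) (pred1 (2 * pi)))); last first.
    by move=> z /=; rewrite negb_and !negbK.
  apply: (@leq_trans (count (pred1 pi) s + count (pred1 (2 * pi)) s)).
    by rewrite -count_predUI leq_addr.
  by rewrite !count_uniq_mem// -[2%N]/(1 + 1)%N leq_add ?leq_b1.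
apply: (leq_trans s's); rewrite !ltnS.
rewrite -(size_map (fun t => tan (t / 2))).
have s'P z : z \in s' -> [/\ 0 <= z < 2 * pi, cos (z / 2) != 0 & f z = 0].
  rewrite mem_filter => /andP[/andP[z1 z2] /sZ[]]; rewrite /= in_itv/= => zI fz.
  split => //; last exact: cos_half_neq0.
  by case/andP: zI => -> /=; rewrite le_eqVlt (negbTE z2).
rewrite ltnW//; apply: (leq_trans _ sq); apply: max_poly_roots => //.
  apply/allP => _ /mapP[z zs ->]; have [z1 z2 z3] := s'P z zs.
  move: z3; rewrite fq// => /eqP; rewrite mulf_eq0 => /orP[|//].
  by rewrite expf_eq0 (negbTE z2) andbF.
rewrite map_inj_in_uniq; first exact: filter_uniq.
move=> z z' /s'P[z1 z2 _] /s'P[z1' z2' _] e; apply: sin_half_inj => //.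
have -> : (z - z') / 2 = z / 2 - z' / 2 by field.
move: e; rewrite /tan sinB => /(congr1 (fun v => v * (cos (z / 2) * cos (z' / 2)))).
have -> : sin (z / 2) / cos (z / 2) * (cos (z / 2) * cos (z' / 2)) = sin (z / 2) * cos (z' / 2) by field.
have -> : sin (z' / 2) / cos (z' / 2) * (cos (z / 2) * cos (z' / 2)) = cos (z / 2) * sin (z' / 2) by field.
by move->; rewrite subrr.
Qed.
End dirichlet_roots.

(** * Bounds for the arc cosine near 1 *)

Section acos_bounds.
Context {R : realType}.
Implicit Types (c x y : R).

Lemma sin_le_id c : 0 <= c -> sin c <= c.
Proof.
move=> c0; have [z _ h] := @MVT_segment R sin cos 0 c c0
  (fun x _ => is_derive_sin x) (continuous_subspaceT (@continuous_sin R)).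
rewrite sin0 !subr0 in h; rewrite h -[leRHS]mul1r ler_wpM2r// cos_le1.
Qed.

Lemma mul_cos_le_sin c : 0 <= c <= pi -> c * cos c <= sin c.
Proof.
move=> /andP[c0 cpi]; have [z zI h] := @MVT_segment R sin cos 0 c c0
  (fun x _ => is_derive_sin x) (continuous_subspaceT (@continuous_sin R)).
rewrite sin0 !subr0 in h; rewrite h mulrC ler_wpM2r//.
move: zI; rewrite in_itv/= => /andP[z0 zc].
by rewrite leNgt ltr_cos ?in_itv/= ?c0 ?z0 ?(le_trans zc)// -leNgt.
Qed.

Lemma one_sub_cos_le y : 1 - cos y <= y ^+ 2 / 2.
Proof.
have -> : 1 - cos y = 2 * sin (y / 2) ^+ 2.
  have -> : y = y / 2 + y / 2 by field.
  rewrite {1}cosD; have -> : (y / 2 + y / 2) / 2 = y / 2 by field.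
  have h := cos2Dsin2 (y / 2); lra.
wlog y0 : y / 0 <= y => [H|].
  have [|y0] := leP 0 y; first exact: H.
  have := H (- y); rewrite mulNr sinN !sqrrN; apply; lra.
have [ypi|ypi] := leP (y / 2) pi.
  have h1 : sin (y / 2) <= y / 2 by apply: sin_le_id; lra.
  have h2 : 0 <= sin (y / 2) by apply: sin_ge0_pi; rewrite ypi; lra.
  nra.
have p2 := pi_ge2 R.
have := sin_le1 (y / 2); have := sin_geN1 (y / 2); nra.
Qed.

(** The constant comes from 1 - cos c = 2 sin(c / 2)^2 and sin(c / 2) >= c / 4; the latter follows
    from sin(c / 2) >= 2 (c / 4) cos(c / 4)^2, where the squared cosine is at least 1 / 2. *)
Lemma sq_le_one_sub_cos c : 0 <= c <= pi -> c ^+ 2 <= 8 * (1 - cos c).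
Proof.
move=> /andP[c0 cpi].
have e1 : cos c = 1 - 2 * sin (c / 2) ^+ 2.
  have -> : c = c / 2 + c / 2 by field.
  rewrite {1}cosD; have -> : (c / 2 + c / 2) / 2 = c / 2 by field.
  have h := cos2Dsin2 (c / 2); lra.
have e2 : sin (c / 2) = 2 * sin (c / 4) * cos (c / 4).
  have -> : c / 2 = c / 4 + c / 4 by field.
  by rewrite sinD; ring.
have h1 : c / 4 * cos (c / 4) <= sin (c / 4).
  by apply: mul_cos_le_sin; apply/andP; split; lra.
have h2 : 2^-1 <= cos (c / 4) ^+ 2.
  have : 0 <= cos (c / 2) by apply: cos_ge0_pihalf; apply/andP; split; lra.
  have -> : c / 2 = c / 4 + c / 4 by field.
  by rewrite cosD; have := cos2Dsin2 (c / 4); nra.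
have h3 : 0 <= cos (c / 4) by apply: cos_ge0_pihalf; apply/andP; split; lra.
have h4 : c / 4 <= sin (c / 2).
  rewrite e2; apply: (@le_trans _ _ (2 * (c / 4 * cos (c / 4)) * cos (c / 4))).
    have -> : 2 * (c / 4 * cos (c / 4)) * cos (c / 4) = 2 * (c / 4) * cos (c / 4) ^+ 2 by ring.
    nra.
  by rewrite ler_wpM2r// ler_wpM2l.
rewrite e1; nra.
Qed.

Lemma acos_sq_le x : -1 <= x <= 1 -> acos x ^+ 2 <= 8 * (1 - x).
Proof.
move=> xI; rewrite -[in leRHS](@acosK _ x) ?in_itv//.
by apply: sq_le_one_sub_cos; rewrite acos_ge0// acos_lepi.
Qed.

(** With c = acos x, this bound and the next are sin c <= c and c <= tan c. They replace an
    expansion of [acos] at 1, where it is not differentiable. *)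
Lemma acos_ge_sqrt x : -1 <= x <= 1 -> Num.sqrt (1 - x ^+ 2) <= acos x.
Proof. by move=> xI; rewrite -sin_acos//; apply: sin_le_id; exact: acos_ge0. Qed.

Lemma acos_le_sqrt x : 0 < x <= 1 -> acos x <= Num.sqrt (1 - x ^+ 2) / x.
Proof.
move=> /andP[x0 x1]; have xI : -1 <= x <= 1 by apply/andP; split; lra.
rewrite -sin_acos// ler_pdivlMr// -[X in _ * X](@acosK _ x) ?in_itv//.
by apply: mul_cos_le_sin; rewrite acos_ge0// acos_lepi.
Qed.
End acos_bounds.

(** * Correlations along a plane curve at small distance *)

Section angular_speed.
Context {R : realType}.
Variables (A B A' B' : R -> R) (m L : R).
Hypothesis dA : forall t, is_derive t (1 : R) A (A' t).
Hypothesis dB : forall t, is_derive t (1 : R) B (B' t).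
Hypothesis cA' : continuous A'.
Hypothesis cB' : continuous B'.
Hypothesis AB_gt0 : forall t, 0 < A t ^+ 2 + B t ^+ 2.
Implicit Types (s t : R).

Let cA : continuous A.
Proof. by move=> t; apply: differentiable_continuous; apply/derivable1_diffP; case: (dA t). Qed.

Let cB : continuous B.
Proof. by move=> t; apply: differentiable_continuous; apply/derivable1_diffP; case: (dB t). Qed.

Definition radius t := Num.sqrt (A t ^+ 2 + B t ^+ 2).

(** The second factor is the cosine of the angle between the curve points at s and t, of which
    [curve_cross] is the sine; the first is a uniform rotation of speed [m]. *)
Definition curve_corr s t := cos (m * (t - s)) * ((A s * A t + B s * B t) / (radius s * radius t)).

Definition angular_speed t := (A t * B' t - B t * A' t) / (A t ^+ 2 + B t ^+ 2).

Definition curve_cross s t := (A s * B t - B s * A t) / (radius s * radius t).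

Lemma radius_gt0 t : 0 < radius t. Proof. by rewrite sqrtr_gt0. Qed.

Lemma radius_sqr t : radius t ^+ 2 = A t ^+ 2 + B t ^+ 2.
Proof. by rewrite sqr_sqrtr// ltW. Qed.

Lemma continuous_radius : continuous radius.
Proof.
move=> t; apply: (@continuous_comp _ _ _ (fun t => A t ^+ 2 + B t ^+ 2) (@Num.sqrt R)); last exact: sqrt_continuous.
apply: cvgD.
  by apply: (@continuous_comp _ _ _ A (fun x => x ^+ 2)); [exact: cA|exact: exprn_continuous].
by apply: (@continuous_comp _ _ _ B (fun x => x ^+ 2)); [exact: cB|exact: exprn_continuous].
Qed.

Let lagrange s t : ((A s * A t + B s * B t) / (radius s * radius t)) ^+ 2 + curve_cross s t ^+ 2 = 1.
Proof.
rewrite /curve_cross !exprMn !exprVn !exprMn -mulrDl !radius_sqr.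
have h1 := AB_gt0 s; have h2 := AB_gt0 t.
by field; apply/andP; split; rewrite gt_eqF.
Qed.

Lemma curve_corr_itv s t : -1 <= curve_corr s t <= 1.
Proof.
rewrite -ler_norml /curve_corr normrM.
have h1 : `|cos (m * (t - s))| <= 1 by rewrite ler_norml cos_geN1 cos_le1.
have h2 : `|(A s * A t + B s * B t) / (radius s * radius t)| <= 1.
  by rewrite -[leRHS]sqrtr1 -sqrtr_sqr ler_sqrt// -(lagrange s t) lerDl sqr_ge0.
by rewrite mulr_ile1.
Qed.

Lemma one_sub_curve_corr_sqr s t : 1 - curve_corr s t ^+ 2 =
  sin (m * (t - s)) ^+ 2 + cos (m * (t - s)) ^+ 2 * curve_cross s t ^+ 2.
Proof.
have := lagrange s t; rewrite /curve_corr exprMn.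
by have := cos2Dsin2 (m * (t - s)); nra.
Qed.

(** Serves the domination: unlike the identity for 1 minus the square, it also excludes correlations
    near -1. The second term comes from 2 (|P_s| |P_t| - P_s . P_t) <= |P_t - P_s|^2. *)
Lemma one_sub_curve_corr_le s t : 1 - curve_corr s t <= m ^+ 2 * (t - s) ^+ 2 / 2 +
  ((A t - A s) ^+ 2 + (B t - B s) ^+ 2) / (2 * (radius s * radius t)).
Proof.
have r1 := radius_gt0 s; have r2 := radius_gt0 t.
have e1 := radius_sqr s; have e2 := radius_sqr t.
have h1 := one_sub_cos_le (m * (t - s)); rewrite exprMn in h1.
have h2 := lagrange s t.
have h3 : 1 - (A s * A t + B s * B t) / (radius s * radius t) <=
   ((A t - A s) ^+ 2 + (B t - B s) ^+ 2) / (2 * (radius s * radius t)).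
  have r0 : 0 < radius s * radius t by rewrite mulr_gt0.
  rewrite ler_pdivlMr ?mulr_gt0//.
  have -> : (1 - (A s * A t + B s * B t) / (radius s * radius t)) * (2 * (radius s * radius t)) =
    2 * (radius s * radius t) - 2 * (A s * A t + B s * B t) by field; apply/andP; split; rewrite gt_eqF.
  have := sqr_ge0 (radius s - radius t); nra.
rewrite /curve_corr.
move: h1 h3 h2; set q := (A s * A t + _) / _.
move=> h1 h3 h2.
have q1 : q <= 1 by have := sqr_ge0 (curve_cross s t); nra.
have c1 := cos_le1 (m * (t - s)); have c2 := cos_geN1 (m * (t - s)).
have : cos (m * (t - s)) * (1 - q) <= 1 - q by rewrite ler_piMl// subr_ge0.
lra.
Qed.

Lemma curve_cross_cvg t (h : R^nat) : (forall k, h k != 0) -> h @ \oo --> 0 ->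
  (fun k => curve_cross t (t + h k) / h k) @ \oo --> angular_speed t.
Proof.
move=> h0 hk.
have lim (f f' : R -> R) : is_derive t (1 : R) f (f' t) -> (fun k => (f (t + h k) - f t) / h k) @ \oo --> f' t.
  move=> [df <-].
  have /cvgr_dnbhsP := df; move/(_ h (conj h0 hk)).
  apply: cvg_trans; apply: near_eq_cvg; near=> k.
  by rewrite /= /GRing.scale/= mulr1 mulrC (addrC (h k)).
have lA := lim _ _ (dA t); have lB := lim _ _ (dB t).
have cr : (fun k => radius (t + h k)) @ \oo --> radius t.
  apply: (@continuous_cvg _ _ _ _ _ (fun k => t + h k) radius); first exact: continuous_radius.
  by rewrite -[X in _ --> X]addr0; apply: cvgD; [exact: cvg_cst|].
have -> : (fun k => curve_cross t (t + h k) / h k) = (fun k =>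
  (A t * ((B (t + h k) - B t) / h k) - B t * ((A (t + h k) - A t) / h k)) / (radius t * radius (t + h k))).
  apply/funext => k; rewrite /curve_cross; field.
  by rewrite h0 !gt_eqF ?radius_gt0.
rewrite /angular_speed -radius_sqr expr2.
apply: cvgM; first by apply: cvgB; apply: cvgM => //; exact: cvg_cst.
apply: cvgV; first by rewrite mulf_neq0// gt_eqF// radius_gt0.
by apply: cvgM => //; exact: cvg_cst.
Unshelve. all: by end_near. Qed.

Lemma curve_corr_cvg t (h : R^nat) : h @ \oo --> 0 ->
  (fun k => curve_corr t (t + h k)) @ \oo --> (1 : R).
Proof.
move=> hk.
have ct : (fun k => t + h k) @ \oo --> t.
  by rewrite -[X in _ --> X]addr0; apply: cvgD; [exact: cvg_cst|].
have cf (f : R -> R) : continuous f -> (fun k => f (t + h k)) @ \oo --> f t.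
  by move=> cf; apply: (@continuous_cvg _ _ _ _ _ (fun k => t + h k) f); [exact: cf|].
have e : curve_corr t t = 1.
  rewrite /curve_corr subrr mulr0 cos0 mul1r -!expr2 radius_sqr divff// gt_eqF//.
rewrite -[X in _ --> X]e; apply: cvgM.
  by apply: (@cf (fun u => cos (m * (u - t)))) => u;
     apply: (@continuous_comp _ _ _ (fun u => m * (u - t)) cos); [
     apply: cvgM; [exact: cvg_cst|apply: cvgB; [exact: cvg_id|exact: cvg_cst]]|exact: continuous_cos].
apply: cvgM.
  by apply: cvgD; apply: cvgM; [exact: cvg_cst|exact: cf|exact: cvg_cst|exact: cf].
apply: cvgV; first by rewrite mulf_neq0// gt_eqF// radius_gt0.
by apply: cvgM; [exact: cvg_cst|apply: cf; exact: continuous_radius].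
Qed.

(** The quotient is squeezed between sqrt (1 - r^2) / h and the same divided by r, with r the
    correlation, which tends to 1. By [one_sub_curve_corr_sqr], (1 - r^2) / h^2 tends to the sum of
    the two squared speeds. *)
Lemma acos_curve_corr_cvg t (h : R^nat) : (forall k, 0 < h k) -> h @ \oo --> 0 ->
  (fun k => acos (curve_corr t (t + h k)) / h k) @ \oo --> Num.sqrt (m ^+ 2 + angular_speed t ^+ 2).
Proof.
move=> h0 hk; have h0' k : h k != 0 by rewrite gt_eqF.
have cc := curve_corr_cvg t hk.
have sq (u : R^nat) (l : R) : u @ \oo --> l -> (fun k => u k ^+ 2) @ \oo --> l ^+ 2.
  by move=> ul; exact: (cvg_comp _ _ ul (@exprn_continuous R 2 l)).
pose q k := Num.sqrt (1 - curve_corr t (t + h k) ^+ 2) / h k.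
have cq : q @ \oo --> Num.sqrt (m ^+ 2 + angular_speed t ^+ 2).
  have -> : q = fun k => Num.sqrt ((sin (m * h k) / h k) ^+ 2 +
     cos (m * h k) ^+ 2 * (curve_cross t (t + h k) / h k) ^+ 2).
    apply/funext => k; rewrite /q one_sub_curve_corr_sqr.
    have -> : t + h k - t = h k by ring.
    rewrite -[X in _ / X](gtr0_norm (h0 k)) -sqrtr_sqr -sqrtrV ?sqr_ge0//.
    rewrite -sqrtrM; last by rewrite -exprMn addr_ge0 ?sqr_ge0.
    by congr Num.sqrt; field.
  apply: (@continuous_cvg _ _ _ _ _ _ (@Num.sqrt R)); first exact: sqrt_continuous.
  apply: cvgD.
    apply: sq.
    have ds : is_derive (0 : R) 1 (fun x => sin (m * x)) m.
      have dm := is_derive_mull m 0.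
      have := @is_derive1_comp _ sin (fun x => m * x) 0 _ _ (is_derive_sin (m * 0)) dm.
      by move=> H; apply: (is_derive_eq H); rewrite mulr0 cos0 mul1r.
    move: ds => [ds em]; have /cvgr_dnbhsP := ds; move/(_ h (conj h0' hk)).
    rewrite -[X in _ --> X -> _]/('D_1 (fun x => sin (m * x)) 0) em.
    apply: cvg_trans; apply: near_eq_cvg; near=> k.
    by rewrite /= /GRing.scale/= mulr1 addr0 mulr0 sin0 subr0 mulrC.
  rewrite -[X in _ --> X]mul1r; apply: cvgM.
    rewrite -[X in _ --> X](expr1n _ 2); apply: sq.
    rewrite -(cos0 R); apply: (@continuous_cvg _ _ _ _ _ _ (@cos R)); first exact: continuous_cos.
    by rewrite -(mulr0 m); apply: cvgM => //; exact: cvg_cst.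
  by apply: sq; exact: curve_cross_cvg.
apply: (@squeeze_cvgr _ _ _ _ q (fun k => q k / curve_corr t (t + h k))) => //.
  have : \forall k \near \oo, 0 < curve_corr t (t + h k).
    by apply: (cvgr_gt 1 cc); rewrite ltr01.
  apply: filterS => k ck; have /andP[c1 c2] := curve_corr_itv t (t + h k).
  apply/andP; split; rewrite /q.
    by rewrite ler_pM2r ?invr_gt0//; apply: acos_ge_sqrt; rewrite c1.
  rewrite mulrAC ler_pM2r ?invr_gt0//; apply: acos_le_sqrt; by rewrite ck.
rewrite -[X in _ --> X]divr1; apply: cvgM => //; apply: cvgV => //; exact: oner_neq0.
Unshelve. all: by end_near. Qed.

Let lipschitz (f f' : R -> R) (a b : R) : a <= b -> (forall t, is_derive t (1 : R) f (f' t)) -> continuous f' ->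
  exists2 C, 0 <= C & forall s t, a <= s -> s <= t -> t <= b -> (f t - f s) ^+ 2 <= C * (t - s) ^+ 2.
Proof.
move=> ab df cf'.
have cf : continuous f.
  by move=> t; apply: differentiable_continuous; apply/derivable1_diffP; case: (df t).
have [c cab hc] := @EVT_max R (fun x => f' x ^+ 2) a b ab (continuous_subspaceT
   (fun x => @continuous_comp _ _ _ f' (fun y => y ^+ 2) x (cf' x) (@exprn_continuous _ 2 _))).
exists (f' c ^+ 2); first exact: sqr_ge0.
move=> s t sa st tb.
have [z zI ->] := @MVT_segment R f f' s t st (fun x _ => df x) (continuous_subspaceT cf).
rewrite exprMn ler_wpM2r ?sqr_ge0//; apply: hc.
by move: zI; rewrite !in_itv/= => /andP[z1 z2]; rewrite (le_trans sa)// (le_trans z2).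
Qed.

Lemma acos_curve_corr_le : 0 <= L -> exists2 C, 0 <= C &
  forall t h, 0 <= t <= L -> 0 < h <= 1 -> acos (curve_corr t (t + h)) / h <= C.
Proof.
(* The compact [0, L + 1] contains t + h for every h <= 1. *)
move=> L0; have L1 : 0 <= L + 1 by rewrite addr_ge0.
have [C1 C10 hA] := lipschitz L1 dA cA'.
have [C2 C20 hB] := lipschitz L1 dB cB'.
have [c _ rc] := @EVT_min R radius 0 (L + 1) L1 (continuous_subspaceT continuous_radius).
have rc0 := radius_gt0 c.
pose K := m ^+ 2 / 2 + (C1 + C2) / (2 * (radius c * radius c)).
have K0 : 0 <= K by rewrite addr_ge0// ?divr_ge0 ?sqr_ge0// ?addr_ge0// ?mulr_ge0 ?ltW.
exists (Num.sqrt (8 * K)); first exact: sqrtr_ge0.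
move=> t h /andP[t0 tL] /andP[h0 h1].
have I1 := curve_corr_itv t (t + h).
rewrite ler_pdivrMr//.
have -> : Num.sqrt (8 * K) * h = Num.sqrt (8 * K * h ^+ 2).
  by rewrite [RHS]sqrtrM ?mulr_ge0// sqrtr_sqr gtr0_norm.
rewrite -[leLHS]ger0_norm ?acos_ge0// -sqrtr_sqr ler_sqrt; last by rewrite mulr_ge0 ?sqr_ge0// mulr_ge0.
apply: (le_trans (acos_sq_le I1)); rewrite -mulrA ler_pM2l//.
apply: (le_trans (one_sub_curve_corr_le _ _)).
have eh : t + h - t = h by ring.
rewrite eh; have -> : K * h ^+ 2 = m ^+ 2 * h ^+ 2 / 2 + (C1 + C2) * h ^+ 2 / (2 * (radius c * radius c)).
  by rewrite /K; field; rewrite gt_eqF.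
rewrite lerD2l.
have r1 : radius c <= radius t by apply: rc; rewrite in_itv/= t0; lra.
have r2 : radius c <= radius (t + h) by apply: rc; rewrite in_itv/=; apply/andP; split; lra.
have hA1 : (A (t + h) - A t) ^+ 2 <= C1 * h ^+ 2 by rewrite -{2}eh; apply: hA; lra.
have hB1 : (B (t + h) - B t) ^+ 2 <= C2 * h ^+ 2 by rewrite -{2}eh; apply: hB; lra.
apply: ler_pM; rewrite ?addr_ge0 ?sqr_ge0//.
- by rewrite invr_ge0 mulr_ge0// mulr_ge0// ltW// radius_gt0.
- by rewrite mulrDl lerD.
- rewrite lef_pV2 ?posrE ?mulr_gt0 ?radius_gt0// ler_pM2l// ler_pM// ltW//.
Qed.
End angular_speed.

(** * The Kac formula *)

Section lower_limits.
Context {R : realType}.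
Implicit Types (u : (\bar R)^nat) (x : \bar R).
Local Open Scope ereal_scope.

Lemma limn_einf_ge u x : (\forall k \near \oo, x <= u k) -> x <= limn_einf u.
Proof.
move=> [m _ um]; rewrite limn_einf_lim; apply: lime_ge; first exact: is_cvg_einfs.
exists m => // k /= mk; apply: le_ereal_inf_tmp => _ [p /= kp <-].
by apply: um => /=; exact: leq_trans kp.
Qed.

Lemma nb_zeros_le_ereal (f : R -> R) (I : set R) x :
  (forall s : seq R, uniq s -> (forall z, z \in s -> I z /\ f z = 0%R) -> (size s)%:R%:E <= x) ->
  nb_zeros f I <= x.
Proof.
move=> sk; rewrite /nb_zeros /counting; case: asboolP => [finZ|infZ].
  apply: (sk (enum_fset (fset_set _))); first exact: fset_uniq.
  by move=> z zZ; have : z \in fset_set _ := zZ; rewrite in_fset_set// => /set_mem.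
have xn n : n%:R%:E <= x.
  have [B BZ kB] := infinite_set_fset n infZ.
  apply: (@le_trans _ _ (#|` B|%:R%:E)); first by rewrite lee_fin ler_nat.
  by apply: (sk (enum_fset B)); [exact: fset_uniq|move=> z zB; apply: BZ].
case: x xn {sk} => [r|//|] xn; last by have := xn 0%N.
have := xn (Num.bound `|r|); rewrite lee_fin leNgt => /negP[].
by apply: (le_lt_trans (ler_norm r)); apply: archi_boundP.
Qed.

Lemma ge0_le_integral_nonmeasurable d (T : measurableType d)
    (mu : {measure set T -> \bar R}) (f g : T -> \bar R) :
  (forall w, 0 <= f w) -> (forall w, f w <= g w) -> \int[mu]_w f w <= \int[mu]_w g w.
Proof.
move=> f0 fg; have g0 w : 0 <= g w by exact: le_trans (fg w).
rewrite !ge0_integralTE//; apply: le_ereal_sup => _ [h /= hf <-].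
by exists h => //= w; exact: le_trans (fg w).
Qed.

(** Raising [g] to +oo on the null set makes the inequality hold everywhere without changing the
    integral of [g]. *)
Lemma ge0_ae_le_integral_nonmeasurable d (T : measurableType d)
    (mu : {measure set T -> \bar R}) (f g : T -> \bar R) :
  (forall w, 0 <= f w) -> (forall w, 0 <= g w) -> measurable_fun setT g ->
  {ae mu, forall w, f w <= g w} -> \int[mu]_w f w <= \int[mu]_w g w.
Proof.
move=> f0 g0 mg [N [mN N0 fgN]].
pose g' w := if w \in N then +oo else g w.
have mg' : measurable_fun setT g'.
  apply: measurable_fun_if => //.
    by apply: (measurable_fun_bool true); rewrite setTI preimage_mem_true.
  exact: measurable_funTS.
have g'0 w : 0 <= g' w by rewrite /g'; case: ifP => // _; exact: leey.
rewrite (_ : \int[mu]_w g w = \int[mu]_w g' w).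
  apply: ge0_le_integral_nonmeasurable => // w; rewrite /g'; case: ifPn => [_|/negP wN]; first exact: leey.
  by apply: contrapT => fg; apply: wN; apply/mem_set; apply: fgN.
apply: ge0_ae_eq_integral => //; exists N; split => // w /= h.
by apply: contrapT => wN; apply: h => _; rewrite /g' memNset.
Qed.
End lower_limits.

Section kac.
Context d (T : measurableType d) (R : realType) (P : probability T R).
Notation mu := (@lebesgue_measure R).
Variables (F : T -> R -> R) (A B A' B' : R -> R) (m L : R).
Hypothesis dA : forall t, is_derive t (1 : R) A (A' t).
Hypothesis dB : forall t, is_derive t (1 : R) B (B' t).
Hypothesis cA' : continuous A'.
Hypothesis cB' : continuous B'.
Hypothesis AB_gt0 : forall t, 0 < A t ^+ 2 + B t ^+ 2.
Hypothesis L_gt0 : 0 < L.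
Hypothesis mF : measurable_fun setT (fun p : T * R => F p.1 p.2).
Hypothesis cF : forall w, continuous (F w).
Hypothesis F_corr : forall s t,
  P [set w | F w s * F w t < 0] = (acos (curve_corr A B m s t) / pi)%:E.

Let E h := [set p : T * R | p.2 \in `[0, L - h] /\ F p.1 p.2 * F p.1 (p.2 + h) < 0].

Let mE h : measurable (E h).
Proof.
apply: measurableI.
  have : measurable_fun setT (@snd T R) by exact: measurable_snd.
  by move/(_ measurableT `[0, L - h]%classic (measurable_itv _)); rewrite setTI.
have : measurable_fun setT (fun p : T * R => F p.1 p.2 * F p.1 (p.2 + h)).
  apply: measurable_funM => //.
  apply: (@measurableT_comp _ _ _ _ _ _ (fun p : T * R => F p.1 p.2) _ (fun p : T * R => (p.1, p.2 + h))) => //.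
  apply/measurable_fun_pairP; split => /=.
    exact: measurable_fst.
  apply: measurable_funD => //; exact: measurable_snd.
by move/(_ measurableT `]-oo, 0[%classic (measurable_itv _)); rewrite set_itvE setTI.
Qed.

Let xsectionE h w : xsection (E h) w = sign_change_set (F w) L h.
Proof.
apply/seteqP; split => t.
  by rewrite /xsection/= => /set_mem[/=]; rewrite in_itv.
by move=> [tI Ft]; rewrite /xsection/=; apply/mem_set; split => //=; rewrite in_itv.
Qed.

Let ysectionE h t : ysection (E h) t =
  if t \in `[0, L - h] then [set w | F w t * F w (t + h) < 0] else set0.
Proof.
apply/seteqP; split => w.
  by rewrite /ysection/= => /set_mem[/= ->].
by case: ifP => // tI Ft; rewrite /ysection/=; apply/mem_set; split.
Qed.

Lemma measurable_sign_change_measure h :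
  measurable_fun setT (fun w => mu (sign_change_set (F w) L h)).
Proof.
have := measurable_fun_xsection mu (mE h).
by apply: eq_measurable_fun => w _ /=; rewrite xsectionE.
Qed.

Lemma expected_sign_change h : (\int[P]_w mu (sign_change_set (F w) L h) =
  \int[mu]_t P (ysection (E h) t))%E.
Proof.
have := indic_fubini_tonelli P mu (mE h).
rewrite (indic_fubini_tonelli_FE mu (mE h)) => e.
transitivity (\int[mu]_t fubini_G P (EFin \o \1_(E h)) t)%E.
  by rewrite -e; apply: eq_integral => w _ /=; rewrite xsectionE.
by apply: eq_integral => t _; rewrite (indic_fubini_tonelli_GE P (mE h)).
Qed.

Let h (k : nat) : R := k.+1%:R^-1.

Let h_gt0 k : 0 < h k. Proof. by rewrite invr_gt0. Qed.

Let h_cvg : h @ \oo --> 0.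
Proof. exact: (@cvg_harmonic R). Qed.

Let speed t := Num.sqrt (m ^+ 2 + angular_speed A B A' B' t ^+ 2).

Lemma continuous_speed : continuous speed.
Proof.
have cA : continuous A by move=> t; apply: differentiable_continuous; apply/derivable1_diffP; case: (dA t).
have cB : continuous B by move=> t; apply: differentiable_continuous; apply/derivable1_diffP; case: (dB t).
move=> t; apply: (@continuous_comp _ _ _ (fun t => m ^+ 2 + angular_speed A B A' B' t ^+ 2) (@Num.sqrt R)); last exact: sqrt_continuous.
apply: cvgD; first exact: cvg_cst.
apply: (@continuous_comp _ _ _ (angular_speed A B A' B') (fun x => x ^+ 2)); last exact: exprn_continuous.
apply: cvgM.
  by apply: cvgB; apply: cvgM; [exact: cA|exact: cB'|exact: cB|exact: cA'].
apply: cvgV; first by rewrite gt_eqF.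
by under eq_fun do rewrite !expr2; apply: cvgD; apply: cvgM; [exact: cA|exact: cA|exact: cB|exact: cB].
Qed.

(** Tonelli turns the expectation into an integral over t of sign probabilities;
    [acos_curve_corr_le] dominates their quotients by h. *)
Lemma kac_cvg : ((fun k => ((k.+1%:R)%:E * \int[P]_w mu (sign_change_set (F w) L k.+1%:R^-1))%E) @ \oo -->
  (pi^-1%:E * \int[mu]_(t in `[0%R, L[) (speed t)%:E)%E).
Proof.
have p0 := pi_gt0 R.
have [C C0 Cb] := acos_curve_corr_le m dA dB cA' cB' AB_gt0 (ltW L_gt0).
pose f_ k t := ((h k)^-1%:E * P (ysection (E (h k)) t))%E.
have mf_ k : measurable_fun setT (f_ k).
  by apply: measurable_funeM; exact: measurable_fun_ysection.
have f_E k t : t \in `[0, L - h k] -> f_ k t = (pi^-1 * (acos (curve_corr A B m t (t + h k)) / h k))%:E.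
  move=> tI; rewrite /f_ ysectionE tI F_corr -EFinM; congr EFin.
  by rewrite mulrC [RHS]mulrCA mulrA.
have f_0 k t : t \notin `[0, L - h k] -> f_ k t = 0%E.
  by move=> /negbTE tI; rewrite /f_ ysectionE tI measure0 mule0.
have intf k : (k.+1%:R%:E * \int[P]_w mu (sign_change_set (F w) L k.+1%:R^-1) =
    \int[mu]_(t in `[0%R, L[) f_ k t)%E.
  rewrite expected_sign_change -/(h k) -[in LHS](invrK k.+1%:R) -/(h k) -ge0_integralZl//=; last 2 first.
  - by apply: measurable_fun_ysection; exact: mE.
  - by rewrite lee_fin invr_ge0 ltW.
  rewrite [RHS]integral_mkcond; apply: eq_integral => t _ /=.
  rewrite patchE; case: ifPn => // /negP tI; rewrite -/(f_ k t) f_0//.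
  apply/negP; rewrite in_itv/= => /andP[t0 tL]; apply: tI; apply/mem_set => /=.
  by rewrite in_itv/= t0 (le_lt_trans tL)// ltrBlDr ltrDl.
rewrite (_ : (fun k => _) = (fun k => \int[mu]_(t in `[0%R, L[) f_ k t)%E); last exact/funext.
have ms : measurable_fun setT (fun t => (speed t)%:E).
  by apply/measurable_EFinP; apply: continuous_measurable_fun; exact: continuous_speed.
rewrite -ge0_integralZl//=; last 3 first.
- exact: measurable_funTS.
- by move=> t _; rewrite lee_fin sqrtr_ge0.
- by rewrite lee_fin invr_ge0 ltW.
have mI : measurable `[0, L[%classic by exact: measurable_itv.
(* For t < L the constraint t <= L - h k holds once k is large; this is the reason for the half-open
   interval. *)
have f_cvg : {ae mu, forall t, `[0, L[%classic t -> f_ ^~ t @ \oo --> (pi^-1%:E * (speed t)%:E)%E}.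
  apply: aeW => t /=; rewrite in_itv/= => /andP[t0 tL].
  have cv := @acos_curve_corr_cvg _ A B A' B' m dA dB AB_gt0 t h h_gt0 h_cvg.
  have : (pi^-1 * (acos (curve_corr A B m t (t + h k)) / h k))%:E @[k --> \oo] --> (pi^-1 * speed t)%:E.
    by apply: cvg_EFin; [near=> k|apply: cvgM; [exact: cvg_cst|exact: cv]].
  apply: cvg_trans; apply: near_eq_cvg.
  have : \forall k \near \oo, h k < L - t by apply: (cvgr_lt 0 h_cvg); rewrite subr_gt0.
  by apply: filterS => k hk; rewrite f_E// in_itv/= t0/= lerBrDr -lerBrDl ltW.
have ig : mu.-integrable `[0, L[%classic (fun=> (pi^-1 * C)%:E).
  apply/integrableP; split; first exact: measurable_cst.
  by rewrite integral_cst//= lebesgue_measure_itv/= lte_fin L_gt0 -EFinD -EFinM ltry.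
have fg : {ae mu, forall t k, `[0, L[%classic t -> (`|f_ k t| <= (pi^-1 * C)%:E)%E}.
  apply: aeW => t k /=; rewrite in_itv/= => /andP[t0 tL].
  have [tI|tI] := boolP (t \in `[0, L - h k]).
    rewrite f_E//= lee_fin.
    have tc := Cb t (h k) ltac:(by rewrite t0 ltW) ltac:(by rewrite h_gt0/= invf_le1// ler1n).
    have c0 : 0 <= acos (curve_corr A B m t (t + h k)) / h k.
      by rewrite divr_ge0 ?(ltW (h_gt0 k))// acos_ge0// curve_corr_itv.
    have pc : 0 <= pi^-1 * (acos (curve_corr A B m t (t + h k)) / h k) by rewrite mulr_ge0// invr_ge0 ltW.
    by rewrite (ger0_norm pc) ler_pM2l ?invr_gt0.
  by rewrite f_0// abse0 lee_fin mulr_ge0 ?invr_ge0 ?(ltW p0).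
have mf : measurable_fun `[0, L[%classic (fun t => pi^-1%:E * (speed t)%:E)%E.
  by apply: measurable_funTS; exact: measurable_funeM.
by have [] := @dominated_convergence _ _ R mu _ mI f_ _ _
  (fun k => measurable_funTS (mf_ k)) mf f_cvg ig fg.
Unshelve. all: by end_near. Qed.

(** * Almost sure simplicity of the zeros *)

Section zeros.
Variables (F' : T -> R -> R) (K : T -> R) (C : R).
Hypothesis taylor : forall (w : T) (z t : R), `|F w t - F w z - F' w z * (t - z)| <= K w * (t - z) ^+ 2.
Hypothesis small_ball : forall t e : R, 0 <= t <= L -> 0 <= e -> (P [set w | (`|F w t| <= e)%R] <= (C * e)%:E)%E.

Let mFt t : measurable_fun setT (fun w => F w t).
Proof.
apply: (@measurableT_comp _ _ _ _ _ _ (fun p : T * R => F p.1 p.2) _ (fun w => (w, t))) => //.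
Qed.

Let mball t e : measurable [set w | (`|F w t| <= e)%R].
Proof.
have : measurable_fun setT (fun w => `|F w t|).
  by apply: measurableT_comp => //; exact: normr_measurable.
by move/(_ measurableT `]-oo, e]%classic (measurable_itv _)); rewrite set_itvE setTI.
Qed.

Lemma zero_negligible t : 0 <= t <= L -> P.-negligible [set w | F w t = 0].
Proof.
move=> tL; exists [set w | `|F w t| <= 0]; split; first exact: mball.
  apply/eqP; rewrite eq_le measure_ge0 andbT; have := small_ball tL (lexx 0); by rewrite mulr0.
by move=> w /= ->; rewrite normr0.
Qed.

(* A double zero forces |F| <= K (L h)^2 at a neighbouring point of the grid of step L h, while there are
   O(1 / h) grid points, each with probability O(h^2). *)
Lemma double_zero_negligible :
  P.-negligible [set w | exists z : R, [/\ 0 <= z <= L, F w z = 0 & F' w z = 0]].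
Proof.
(* The Taylor constant [K] is random, so the event is cut into countably many pieces on which it is
   bounded. *)
pose D M := [set w | K w <= M%:R /\ exists z : R, [/\ 0 <= z <= L, F w z = 0 & F' w z = 0]].
apply: (@negligibleS _ _ _ _ (\bigcup_M D M)).
  move=> w wz; exists (Num.bound `|K w|) => //; split => //.
  by apply: ltW; apply: (le_lt_trans (ler_norm _)); apply: archi_boundP.
apply: negligible_bigcup => M.
pose e N : R := M%:R * (L * h N) ^+ 2.
(* Since h N = 1 / (N + 1), these N + 2 grid points run from 0 to L inclusive. *)
pose U N := \big[setU/set0]_(i < N.+2) [set w | `|F w (i%:R * (L * h N))| <= e N].
have mU N : measurable (U N) by apply: bigsetU_measurable => i _; exact: mball.
have PU N : (P (U N) <= (2 * C * M%:R * L ^+ 2 * h N)%:E)%E.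
  have C0 : 0 <= C.
    have := @small_ball 0 1 ltac:(by rewrite lexx ltW) ler01; rewrite mulr1; have := measure_ge0 P [set w | (`|F w 0%R| <= 1)%R].
    by move=> h1 h2; have := le_trans h1 h2; rewrite lee_fin.
  have e0 : 0 <= e N by rewrite mulr_ge0// sqr_ge0.
  apply: (@le_trans _ _ (\sum_(i < N.+2) P [set w | (`|F w (i%:R * (L * h N))| <= e N)%R])%E).
    apply: (@Boole_inequality _ _ _ P (fun i : nat => [set w | (`|F w (i%:R * (L * h N))| <= e N)%R]) N.+2) => i _; exact: mball.
  apply: (@le_trans _ _ (\sum_(i < N.+2) (C * e N)%:E)%E).
    apply: lee_sum => i _; apply: small_ball => //; rewrite mulr_ge0 ?mulr_ge0 ?(ltW L_gt0) ?(ltW (h_gt0 N))//=.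
    rewrite mulrCA ler_piMr ?(ltW L_gt0)// /h ler_pdivrMr// mul1r ler_nat -ltnS.
    by rewrite ltn_ord.
  rewrite sumEFin lee_fin sumr_const card_ord /e -[leLHS]mulr_natl /h.
  have -> : N.+2%:R * (C * (M%:R * (L * N.+1%:R^-1) ^+ 2)) =
     (C * M%:R * L ^+ 2 * N.+1%:R^-1) * (N.+2%:R / N.+1%:R) by field.
  have -> : 2 * C * M%:R * L ^+ 2 * N.+1%:R^-1 = (C * M%:R * L ^+ 2 * N.+1%:R^-1) * 2 by ring.
  rewrite ler_wpM2l ?mulr_ge0 ?invr_ge0 ?(ltW L_gt0)//.
  by rewrite ler_pdivrMr// -natrM ler_nat mul2n doubleS !ltnS -addnn leq_addr.
exists (\bigcap_N U N); split.
- by apply: bigcapT_measurable.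
- apply/eqP; rewrite eq_le measure_ge0 andbT.
  have cv : (2 * C * M%:R * L ^+ 2 * h N)%:E @[N --> \oo] --> 0%E.
    apply: cvg_EFin; first by near=> N.
    by rewrite -[X in _ --> X](mulr0 (2 * C * M%:R * L ^+ 2)); apply: cvgM; [exact: cvg_cst|exact: h_cvg].
  rewrite -(cvg_lim _ cv)//; apply: lime_ge; first by apply/cvg_ex; eexists; exact: cv.
  near=> N; apply: (le_trans _ (PU N)).
  have mI : measurable (\bigcap_N U N) by apply: bigcapT_measurable.
  by apply: (le_measure P (mem_set mI) (mem_set (mU N))) => w; exact.
- move=> w [KM [z [/andP[z0 zL] Fz F'z]]] N _.
  have Lh : 0 < L * h N by rewrite mulr_gt0.
  have zN : 0 <= z / (L * h N) by rewrite divr_ge0// ltW.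
  pose i := Num.truncn (z / (L * h N)).
  have /andP[i1 i2] := truncn_itv zN; rewrite -/i in i1 i2.
  have iN : (i < N.+2)%N.
    rewrite -(ltr_nat R); apply: (le_lt_trans i1); apply: (@le_lt_trans _ _ N.+1%:R); last by rewrite ltr_nat.
    rewrite ler_pdivrMr// /h mulrCA mulfV ?mulr1 ?pnatr_eq0//.
  rewrite /U (bigD1 (Ordinal iN))//=; left; rewrite /=.
  have := taylor w z (i%:R * (L * h N)); rewrite Fz F'z mul0r !subr0 => ht.
  apply: (le_trans ht); rewrite /e; apply: (@le_trans _ _ (M%:R * (i%:R * (L * h N) - z) ^+ 2)).
    by rewrite ler_wpM2r ?sqr_ge0.
  rewrite ler_wpM2l//; rewrite ler_pdivlMr// in i1; rewrite ltr_pdivrMr// natSM in i2.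
  nra.
Unshelve. all: by end_near. Qed.

(* [nb_zeros] is not known to be measurable here, so its integral is only used as the supremum of the
   integrals of the simple functions below it, which is still monotone. *)
Theorem kac_formula : (\int[P]_w nb_zeros (F w) `[0%R, L] =
  pi^-1%:E * \int[mu]_(t in `[0%R, L[) (speed t)%:E)%E.
Proof.
have nb0 w : (0 <= nb_zeros (F w) `[0%R, L])%E.
  by rewrite /nb_zeros; exact: (measure_ge0 counting).
have kS k w : ((k.+1%:R)%:E * mu (sign_change_set (F w) L k.+1%:R^-1) <= nb_zeros (F w) `[0%R, L])%E.
  have := sign_change_le_nb_zeros L (@cF w) (h_gt0 k) => H.
  apply: (@le_trans _ _ ((k.+1%:R)%:E * ((h k)%:E * nb_zeros (F w) `[0%R, L]))%E).
    by apply: lee_wpmul2l => //; rewrite lee_fin.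
  by rewrite muleA -EFinM /h mulfV ?mul1e// pnatr_eq0.
have mS k : measurable_fun setT (fun w => (k.+1%:R%:E * mu (sign_change_set (F w) L k.+1%:R^-1))%E).
  by apply: measurable_funeM; exact: measurable_sign_change_measure.
have intS k : (\int[P]_w (k.+1%:R%:E * mu (sign_change_set (F w) L k.+1%:R^-1)) =
   k.+1%:R%:E * \int[P]_w mu (sign_change_set (F w) L k.+1%:R^-1))%E.
  by rewrite ge0_integralZl//; exact: measurable_sign_change_measure.
have S0 k w : (0 <= k.+1%:R%:E * mu (sign_change_set (F w) L k.+1%:R^-1))%E.
  by rewrite mule_ge0.
(* Lower bound: at every scale the rescaled measure of sign changes is at most the number of
   zeros. *)
apply/eqP; rewrite eq_le; apply/andP; split; last first.
  rewrite -(cvg_lim _ kac_cvg)//; apply: lime_le; first by apply/cvg_ex; eexists; exact: kac_cvg.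
  near=> k; rewrite -intS; exact: ge0_le_integral_nonmeasurable.
(* Upper bound: almost surely the number of zeros is at most the lower limit of the rescaled
   measures, which are measurable, and Fatou's lemma applies to them. *)
have [e _] := cvg_limn_einf_sup kac_cvg; rewrite -e.
apply: (@le_trans _ _ (\int[P]_w limn_einf (fun k => (k.+1%:R%:E * mu (sign_change_set (F w) L k.+1%:R^-1))))%E); last first.
  by under [in leRHS]eq_fun do rewrite -intS; apply: fatou => //.
apply: ge0_ae_le_integral_nonmeasurable => //.
- by move=> w; apply: limn_einf_ge; near=> k.
- rewrite /limn_einf; apply: measurableT_comp => //.
  by apply: measurable_fun_limn_esup => k; apply: measurableT_comp.
(* Zeros at the two ends are discarded along with double zeros, since their intervals ]z - h, z[
   could leave [0, L - h]. *)
- pose N0 := [set w | exists z : R, [/\ 0 <= z <= L, F w z = 0 & F' w z = 0]] `|`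
    [set w | F w 0 = 0] `|` [set w | F w L = 0].
  have nN0 : P.-negligible N0.
    apply: negligibleU; [apply: negligibleU; [exact: double_zero_negligible|]|];
      by apply: zero_negligible; rewrite lexx ltW.
  apply: negligibleS nN0 => w /= hw; apply: contrapT => wN0; apply: hw.
  apply: nb_zeros_le_ereal => s us sZ.
  have [dl dl0 dP] : exists2 dl : R, 0 < dl & forall h, 0 < h < dl ->
      (((size s)%:R * h)%:E <= mu (sign_change_set (F w) L h))%E.
    apply: (@zeros_le_sign_change _ _ _ (@cF w) (K w)) => // z zs.
    have [] := sZ z zs; rewrite /= in_itv/= => zI Fz; split.
      move: zI => /andP[z0 zL]; rewrite !lt_neqAle z0 zL !andbT; apply/andP; split; apply/eqP => ez.
        by apply: wN0; left; right; rewrite /= [X in F w X]ez.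
      by apply: wN0; right; rewrite /= -ez.
    exists (F' w z); split.
      apply/eqP => F'z; apply: wN0; left; left; exists z; split => //.
    by move=> t; have := taylor w z t; rewrite Fz subr0.
  apply: limn_einf_ge.
  have : \forall k \near \oo, h k < dl by apply: (cvgr_lt 0 h_cvg).
  apply: filterS => k hk; have := dP (h k) ltac:(by rewrite h_gt0 hk).
  move=> hS; apply: (@le_trans _ _ (k.+1%:R%:E * ((size s)%:R * h k)%:E)%E).
    by rewrite -EFinM mulrCA /h mulfV ?mulr1// pnatr_eq0.
  by apply: lee_wpmul2l => //; rewrite lee_fin.
Unshelve. all: by end_near. Qed.
End zeros.
End kac.

(** * The expected number of zeros of f_n *)

Section small_ball.
Context d (T : measurableType d) (R : realType) (P : probability T R).
Notation mu := (@lebesgue_measure R).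
Notation nu := (@normal_prob R 0 1).

Lemma normal_prob_itv_le (r : R) : 0 <= r -> (nu `[(- r)%R, r]%classic <= (normal_peak 1 * (2 * r))%:E)%E.
Proof.
move=> r0.
have n1 : (1 : R) != 0 by exact: oner_neq0.
have -> : (normal_peak 1 * (2 * r))%:E = (\int[mu]_(x in `[(- r)%R, r]) (normal_peak (1 : R))%:E)%E.
  rewrite integral_cst//= lebesgue_measure_itv/= lte_fin.
  move: r0; rewrite le_eqVlt => /predU1P[<-|r0]; first by rewrite oppr0 ltxx !mulr0 mule0.
  have -> : - r < r by lra.
  by rewrite -EFinB -EFinM; congr EFin; ring.
rewrite /normal_prob; apply: ge0_le_integral => //.
- by move=> x _; rewrite lee_fin normal_pdf_ge0.
- by apply/measurable_EFinP; apply: measurable_funTS; exact: measurable_normal_pdf.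
- by move=> x _; rewrite lee_fin normal_pdf_ub.
Qed.

(** The law is tested against continuous functions, so the indicator of the ball is replaced by the
    tent [G], at least 1 on |x| <= r, at most 2, and 0 beyond 2 r. The constant 8 / s is 2 times the
    length 4 r / s, divided by r. *)
Lemma gaussian_small_ball (a : nat -> {RV P >-> R}) (rho : int -> R) : rho 0 = 1 ->
  centered_gaussian_process_cov rho a ->
  exists C : R, forall r : R, 0 <= r -> (P [set w | (`|a 1%N w| <= r)%R] <= (C * r)%:E)%E.
Proof.
move=> rho0 acov.
have [s [s0 sk aG]] := combination_gaussian (fun=> 1) 1 acov.
have a1 w : combination a (fun=> 1) 1 w = a 1%N w by rewrite /= big_nat1 mul1r.
have {s0 sk}s0 : 0 < s.
  rewrite lt_neqAle s0 andbT; apply/eqP => s00; move: sk.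
  rewrite -s00 expr0n/= mul0e /combination_var !big_nat1 subrr rho0 !mul1r => /eqP.
  by rewrite eqe eq_sym oner_eq0.
pose C := normal_peak 1 * (8 / s).
have mball (r : R) : measurable [set w | `|a 1%N w| <= r].
  have : measurable_fun setT (fun w => `|a 1%N w|).
    by apply: measurableT_comp => //; exact: normr_measurable.
  by move/(_ measurableT `]-oo, r]%classic (measurable_itv _)); rewrite set_itvE setTI.
have pos (r : R) : 0 < r -> (P [set w | (`|a 1%N w| <= r)%R] <= (C * r)%:E)%E.
  move=> r0.
  pose G (x : R) := Num.max 0 (2 - `|x| / r).
  have cG : continuous G.
    move=> x; apply: (@continuous_max R R (fun=> 0) (fun x => 2 - `|x| / r)); first exact: cvg_cst.
    apply: cvgB; first exact: cvg_cst.
    by apply: cvgM; [exact: norm_continuous|exact: cvg_cst].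
  have G0 x : 0 <= G x by rewrite le_max lexx.
  apply: (@le_trans _ _ (\int[P]_w (G (a 1%N w))%:E)%E).
    rewrite -(setIT [set w | _]) -integral_indic//.
    apply: ge0_le_integral => //.
    - by apply/measurable_EFinP; exact: measurable_indic.
    - apply/measurable_EFinP; apply: measurableT_comp => //; exact: continuous_measurable_fun.
    - move=> w _; rewrite lee_fin indicE; case: (boolP (_ \in _)) => // /set_mem/= h.
      rewrite le_max; apply/orP; right.
      have : `|a 1%N w| / r <= 1 by rewrite ler_pdivrMr// mul1r.
      lra.
  under eq_integral do rewrite -a1.
  rewrite aG//.
  have rs0 : 0 <= 2 * r / s by rewrite divr_ge0 ?mulr_ge0 ?ltW.
  apply: (@le_trans _ _ (\int[nu]_x (2 * \1_(`[- (2 * r / s), 2 * r / s]%classic) x)%R%:E)%E).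
    apply: ge0_le_integral => //.
    - by move=> w _; rewrite lee_fin.
    - apply/measurable_EFinP; apply: measurableT_comp => //.
      exact: continuous_measurable_fun.
    - by apply/measurable_EFinP; apply: measurable_funM.
    - move=> x _; rewrite lee_fin indicE; case: (boolP (_ \in _)) => [_|xI].
        rewrite mulr1 ge_max ler0n/= gerBl divr_ge0// ltW//.
      rewrite mulr0 ge_max lexx/= subr_le0 ler_pdivlMr//.
      rewrite leNgt; apply/negP => h; move/negP: xI; apply; apply/mem_set => /=.
      rewrite in_itv/= -ler_norml ler_pdivlMr//.
      by rewrite normrM (gtr0_norm s0) mulrC in h; exact: ltW.
  under eq_integral do rewrite EFinM.
  rewrite ge0_integralZl//; last by apply/measurable_EFinP; exact: measurable_indic.
  rewrite integral_indic// setIT.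
  apply: (@le_trans _ _ (2%:E * (normal_peak 1 * (2 * (2 * r / s)))%:E)%E).
    by apply: lee_wpmul2l => //; exact: normal_prob_itv_le.
  rewrite -EFinM lee_fin /C le_eqVlt; apply/orP; left; apply/eqP; field.
  by rewrite gt_eqF.
exists C => r; rewrite le_eqVlt => /predU1P[<-|]; last exact: pos.
rewrite mulr0; apply/lee_addgt0Pr => e e0; rewrite add0e.
have C0 : 0 < C by rewrite mulr_gt0 ?normal_peak_gt0 ?oner_eq0// divr_gt0.
have eC : 0 < e / C by rewrite divr_gt0.
apply: (le_trans _ (le_trans (pos _ eC) _)); last by rewrite lee_fin mulrC divfK ?gt_eqF.
apply: (le_measure P (mem_set (mball _)) (mem_set (mball _))) => w /= h.
by rewrite (le_trans h)// ltW.
Qed.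
End small_ball.

(** * The Kac formula for [f_n] and for the kernel process *)

Section trig_zeros.
Context d (T : measurableType d) (R : realType) (P : probability T R).
Notation mu := (@lebesgue_measure R).
Variables (a b : nat -> {RV P >-> R}) (alpha : R).
Notation rho := (fun m : int => cos (m%:~R * alpha)).
Hypothesis a_gauss : centered_gaussian_process_cov rho a.
Hypothesis b_gauss : centered_gaussian_process_cov rho b.
Hypothesis ab_indep : independent_processes a b.

Let rho0 : rho 0 = 1. Proof. by rewrite /= mul0r cos0. Qed.

Let Rintegral_of_add1 (g : T -> R) (r : R) : measurable_fun setT g -> (forall w, `|g w| <= 1) ->
  (\int[P]_w (1 + g w)%:E = r%:E)%E -> \int[P]_w g w = r - 1.
Proof.
move=> mg g1 h; have ig := bounded_integrable P mg g1.
have i1 := @finite_measure_integrable_cst _ _ _ P setT 1 measurableT.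
rewrite /Rintegral; have e : (\int[P]_w (g w)%:E = (r - 1)%:E)%E.
  have : (\int[P]_w (1%:E + (g w)%:E) = r%:E)%E by rewrite -h.
  rewrite integralD// integral_cst_probability => h'.
  have fi : (\int[P]_w (g w)%:E)%E \is a fin_num by exact: integrable_fin_num.
  move: h'; rewrite -(fineK fi) -EFinD => -[<-].
  by congr EFin; rewrite addrC addKr.
by rewrite e.
Qed.

Let gaussian_combination : exists Phi : R -> R, forall n (c e : nat -> R),
  \int[P]_w cos (combination a c n w + combination b e n w) =
    Phi (combination_var rho c n + combination_var rho e n) /\
  \int[P]_w sin (combination a c n w + combination b e n w) = 0.
Proof.
have [Phi PhiE] := gaussian_transform rho0 a_gauss b_gauss ab_indep.
exists (fun v => Phi v - 1) => n c e; have [h1 h2] := PhiE n c e.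
have mU : measurable_fun setT (fun w => combination a c n w + combination b e n w).
  exact: measurable_funD.
split.
  apply: Rintegral_of_add1 h1.
    by apply: measurableT_comp => //; apply: continuous_measurable_fun; exact: continuous_cos.
  by move=> w; rewrite ler_norml cos_geN1 cos_le1.
rewrite -[RHS](subrr 1); apply: Rintegral_of_add1 h2.
  by apply: measurableT_comp => //; apply: continuous_measurable_fun; exact: continuous_sin.
by move=> w; rewrite ler_norml sin_geN1 sin_le1.
Qed.

Definition dirichlet_process n (w : T) (t : R) :=
  dirichlet n (t - alpha) * a 1%N w + dirichlet n (t + alpha) * b 1%N w.

Lemma measurable_dirichlet_process n t : measurable_fun setT (dirichlet_process n ^~ t).
Proof. by apply: measurable_funD; exact: measurable_funM. Qed.

Definition dirichlet_rv n t : {RV P >-> R} := HB.pack (dirichlet_process n ^~ t)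
  (isMeasurableFun.Build _ _ _ _ _ (measurable_dirichlet_process n t)).

Lemma measurable_trig_poly n t : measurable_fun setT (fun w => trig_poly a b n w t).
Proof.
by apply: measurable_funM => //; apply: measurable_sum => k; apply: measurable_funD; exact: measurable_funM.
Qed.

Definition trig_rv n t : {RV P >-> R} := HB.pack (fun w => trig_poly a b n w t)
  (isMeasurableFun.Build _ _ _ _ _ (measurable_trig_poly n t)).

(** A single [Phi] must serve all three families, since values of both processes are compared with
    rotations of the pair of first coordinates. *)
Lemma gaussian_pairs : exists Phi : R -> R,
  [/\ gaussian_pair Phi (a 1%N) (b 1%N) 1 0 1,
      forall n s t, gaussian_pair Phi (dirichlet_rv n s) (dirichlet_rv n t)
        (dirichlet_dot alpha n s s) (dirichlet_dot alpha n s t) (dirichlet_dot alpha n t t) &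
      forall n s t, (0 < n)%N -> gaussian_pair Phi (trig_rv n s) (trig_rv n t)
        (trig_cov alpha n s s) (trig_cov alpha n s t) (trig_cov alpha n t t)].
Proof.
have [Phi PhiE] := gaussian_combination; exists Phi.
have first (x y : R) : \int[P]_w cos (x * a 1%N w + y * b 1%N w) = Phi (x ^+ 2 + y ^+ 2) /\
    \int[P]_w sin (x * a 1%N w + y * b 1%N w) = 0.
  have [h1 h2] := PhiE 1%N (fun=> x) (fun=> y).
  have cE w : combination a (fun=> x) 1 w + combination b (fun=> y) 1 w = x * a 1%N w + y * b 1%N w.
    by rewrite /= !big_nat1.
  have vE : combination_var rho (fun=> x) 1 + combination_var rho (fun=> y) 1 = x ^+ 2 + y ^+ 2.
    by rewrite /combination_var !big_nat1 subrr rho0 !mulr1 -!expr2.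
  rewrite vE in h1; split; [rewrite -h1|rewrite -[RHS]h2];
    by apply: eq_Rintegral => w _; rewrite cE.
split.
- move=> p q; rewrite mulr1 mulr0 addr0 mulr1; exact: first.
- move=> n s t p q.
  have := first (p * dirichlet n (s - alpha) + q * dirichlet n (t - alpha))
                (p * dirichlet n (s + alpha) + q * dirichlet n (t + alpha)).
  rewrite [X in Phi X](_ : _ = p ^+ 2 * dirichlet_dot alpha n s s + 2 * p * q * dirichlet_dot alpha n s t +
    q ^+ 2 * dirichlet_dot alpha n t t); last by rewrite /dirichlet_dot; ring.
  move=> [h1 h2]; split; [rewrite -h1|rewrite -[RHS]h2]; apply: eq_Rintegral => w _;
    [congr cos|congr sin]; rewrite /= /dirichlet_process; ring.
- move=> n s t n0 p q; rewrite -combination_var_trig//.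
  set c := fun k => _ * (p * cos _ + _); set e := fun k => _ * (p * sin _ + _).
  have [h1 h2] := PhiE n c e.
  have E w : combination a c n w + combination b e n w = p * trig_rv n s w + q * trig_rv n t w.
    rewrite /= /trig_poly -big_split/= !big_distrr/= -big_split/=.
    by apply: eq_bigr => k _; rewrite /c /e; ring.
  split; [rewrite -h1|rewrite -[RHS]h2]; apply: eq_Rintegral => w _; by rewrite E.
Qed.

Let small_ball1 : exists C : R, forall r : R, 0 <= r -> (P [set w | (`|a 1%N w| <= r)%R] <= (C * r)%:E)%E.
Proof. exact: gaussian_small_ball rho0 a_gauss. Qed.

Let a1_neq0 : P [set w | a 1%N w = 0] = 0%E.
Proof.
have [C aC] := small_ball1.
have := aC 0 (lexx 0); rewrite mulr0 => h.
apply/eqP; rewrite eq_le measure_ge0 andbT; apply: le_trans h.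
rewrite [X in (P X <= _)%E](_ : _ = [set w | `|a 1%N w| <= 0])//.
by apply/seteqP; split => w /=; [move=> ->; rewrite normr0|rewrite normr_le0 => /eqP].
Qed.

Variable n : nat.
Hypothesis n_gt0 : (0 < n)%N.
Hypothesis sin_na : sin (n%:R * alpha) != 0.

Let Dm t := dirichlet n (t - alpha).
Let Dp t := dirichlet n (t + alpha).
Let Dm' t := dirichlet' n (t - alpha).
Let Dp' t := dirichlet' n (t + alpha).

Let is_derive_shift (c t : R) : is_derive t (1 : R) (fun t => dirichlet n (t + c)) (dirichlet' n (t + c)).
Proof.
have hs : is_derive t 1 (fun x => x + c : R) 1 by apply: is_derive_eq; rewrite addr0.
have := @is_derive1_comp _ (dirichlet n) (fun x => x + c) t _ _ (is_derive_dirichlet n (t + c)) hs.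
by move=> h; apply: (is_derive_eq h); rewrite mulr1.
Qed.

Let continuous_shift (f : R -> R) (c : R) : continuous f -> continuous (fun t => f (t + c)).
Proof.
move=> cf t; apply: (@continuous_comp _ _ _ (fun t => t + c) f); last exact: cf.
by apply: cvgD; [exact: cvg_id|exact: cvg_cst].
Qed.

Let dDm t : is_derive t (1 : R) Dm (Dm' t). Proof. exact: is_derive_shift. Qed.
Let dDp t : is_derive t (1 : R) Dp (Dp' t). Proof. exact: is_derive_shift. Qed.
Let cDm' : continuous Dm'. Proof. by apply: continuous_shift; exact: continuous_dirichlet'. Qed.
Let cDp' : continuous Dp'. Proof. by apply: continuous_shift; exact: continuous_dirichlet'. Qed.

Let dot_gt0 t : 0 < dirichlet_dot alpha n t t. Proof. exact: dirichlet_dot_gt0. Qed.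

Let dotE t : dirichlet_dot alpha n t t = Dm t ^+ 2 + Dp t ^+ 2.
Proof. by rewrite !expr2. Qed.

Let D_gt0 t : 0 < Dm t ^+ 2 + Dp t ^+ 2. Proof. by rewrite -dotE. Qed.

Let speedE t : angular_speed Dm Dp Dm' Dp' t = wronskian alpha n t.
Proof. by rewrite /angular_speed /wronskian dotE. Qed.

Let dirichlet_process_lt0 s t :
  P [set w | dirichlet_process n w s * dirichlet_process n w t < 0] =
  (acos (curve_corr Dm Dp 0 s t) / pi)%:E.
Proof.
have [Phi [ab dir _]] := gaussian_pairs.
have E : curve_corr Dm Dp 0 s t = dirichlet_dot alpha n s t /
    (Num.sqrt (dirichlet_dot alpha n s s) * Num.sqrt (dirichlet_dot alpha n t t)).
  by rewrite /curve_corr mul0r cos0 mul1r /radius -!dotE /dirichlet_dot /Dm /Dp; congr (_ / _); ring.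
have := gaussian_pair_lt0 ab a1_neq0 (dot_gt0 s) (dot_gt0 t) _ (dir n s t).
rewrite -E => -> //; by rewrite ler_norml; apply: curve_corr_itv.
Qed.

Let nR_gt0 : 0 < n%:R :> R. Proof. by rewrite ltr0n. Qed.

Let trig_cov_diag t : trig_cov alpha n t t = (2 * n%:R)^-1 * dirichlet_dot alpha n t t.
Proof. by rewrite /trig_cov subrr mulr0 cos0 mulr1. Qed.

Let trig_cov_gt0 t : 0 < trig_cov alpha n t t.
Proof. by rewrite trig_cov_diag mulr_gt0// invr_gt0 mulr_gt0. Qed.

Let trig_poly_lt0 s t :
  P [set w | trig_poly a b n w s * trig_poly a b n w t < 0] =
  (acos (curve_corr Dm Dp (n.+1%:R / 2) s t) / pi)%:E.
Proof.
have [Phi [ab _ trig]] := gaussian_pairs.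
have E : curve_corr Dm Dp (n.+1%:R / 2) s t = trig_cov alpha n s t /
    (Num.sqrt (trig_cov alpha n s s) * Num.sqrt (trig_cov alpha n t t)).
  have n20 : 0 < (2 * n%:R)^-1 :> R by rewrite invr_gt0 mulr_gt0.
  rewrite !trig_cov_diag !sqrtrM ?(ltW n20)// /curve_corr /trig_cov.
  have -> : Dm s * Dm t + Dp s * Dp t = dirichlet_dot alpha n s t.
    by rewrite /dirichlet_dot /Dm /Dp; ring.
  rewrite /radius -!dotE.
  set x := (2 * n%:R)^-1 in n20 *.
  have xx : Num.sqrt x * Num.sqrt x = x by rewrite -expr2 sqr_sqrtr// ltW.
  have s1 : 0 < Num.sqrt (dirichlet_dot alpha n s s) by rewrite sqrtr_gt0.
  have s2 : 0 < Num.sqrt (dirichlet_dot alpha n t t) by rewrite sqrtr_gt0.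
  have -> : Num.sqrt x * Num.sqrt (dirichlet_dot alpha n s s) * (Num.sqrt x * Num.sqrt (dirichlet_dot alpha n t t)) =
    (Num.sqrt x * Num.sqrt x) * (Num.sqrt (dirichlet_dot alpha n s s) * Num.sqrt (dirichlet_dot alpha n t t)) by ring.
  by rewrite xx; field; rewrite !gt_eqF.
have := gaussian_pair_lt0 ab a1_neq0 (trig_cov_gt0 s) (trig_cov_gt0 t) _ (trig n s t n_gt0).
rewrite -E => -> //; by rewrite ler_norml; apply: curve_corr_itv.
Qed.

Let pi2_gt0 : 0 < 2 * pi :> R. Proof. by rewrite mulr_gt0// pi_gt0. Qed.

(** Uniformity in t comes from the positive minimum of the radius over the compact interval. *)
Let small_ball : exists C : R, forall t e : R, 0 <= t <= 2 * pi -> 0 <= e ->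
  (P [set w | (`|trig_poly a b n w t| <= e)%R] <= (C * e)%:E)%E.
Proof.
have [Phi [ab _ trig]] := gaussian_pairs.
have [C aC] := small_ball1.
have C0 : 0 <= C.
  have := le_trans (measure_ge0 P _) (aC 1 ler01); by rewrite mulr1 lee_fin.
have [c _ rc] := @EVT_min R (radius Dm Dp) 0 (2 * pi) (ltW pi2_gt0)
  (continuous_subspaceT (continuous_radius dDm dDp)).
have rc0 : 0 < radius Dm Dp c by exact: radius_gt0.
have n20 : 0 < Num.sqrt (2 * n%:R)^-1 :> R by rewrite sqrtr_gt0 invr_gt0 mulr_gt0.
exists (C / (Num.sqrt (2 * n%:R)^-1 * radius Dm Dp c)) => t e tI e0.
apply: (le_trans (gaussian_pair_ball ab (trig_cov_gt0 t) e0 aC (trig n t t n_gt0))).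
rewrite lee_fin -mulrA ler_wpM2l// mulrC ler_wpM2r//.
rewrite lef_pV2 ?posrE ?sqrtr_gt0//; last by rewrite mulr_gt0.
by rewrite trig_cov_diag sqrtrM ?invr_ge0 ?mulr_ge0// dotE ler_pM2l// rc.
Qed.

Let cos_taylor (u v : R) : `|cos (v + u) - cos v + sin v * u| <= 2 * u ^+ 2.
Proof.
(* For 0 <= y <= 2, y - sin y <= y (1 - cos y) <= y^3 / 2 <= y^2; for y > 2, y - sin y <= y + 1 <=
   y^2. *)
have su (y : R) : `|sin y - y| <= y ^+ 2.
  wlog y0 : y / 0 <= y => [H|].
    have [|y0] := leP 0 y; first exact: H.
    by have := H (- y); rewrite sinN -opprD normrN sqrrN; apply; lra.
  rewrite ler_norml; have h1 := sin_le_id y0.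
  apply/andP; split; last by have := sqr_ge0 y; lra.
  have [y2|y2] := leP y 2; last by have := sin_geN1 y; nra.
  have h2 : y * cos y <= sin y.
    by apply: mul_cos_le_sin; rewrite y0 (le_trans y2)// pi_ge2.
  have h3 := one_sub_cos_le y.
  have h4 : y * (1 - cos y) <= y * (y ^+ 2 / 2) by rewrite ler_wpM2l.
  have h5 : y * (y ^+ 2 / 2) <= y ^+ 2.
    have -> : y * (y ^+ 2 / 2) = y ^+ 2 * (y / 2) by ring.
    by rewrite ler_piMr ?sqr_ge0// ler_pdivrMr// mul1r.
  lra.
have -> : cos (v + u) - cos v + sin v * u = cos v * (cos u - 1) - sin v * (sin u - u).
  by rewrite cosD; ring.
apply: (le_trans (ler_normB _ _)); rewrite !normrM.
have h1 : `|cos v| * `|cos u - 1| <= u ^+ 2.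
  apply: (@le_trans _ _ `|cos u - 1|).
    by rewrite ler_piMl// ler_norml cos_geN1 cos_le1.
  rewrite ler0_norm ?subr_le0 ?cos_le1// opprB (le_trans (one_sub_cos_le u))//.
  by rewrite ler_pdivrMr// ler_peMr ?sqr_ge0// ler1n.
have h2 : `|sin v| * `|sin u - u| <= u ^+ 2.
  apply: (@le_trans _ _ `|sin u - u|) => //.
  by rewrite ler_piMl// ler_norml sin_geN1 sin_le1.
lra.
Qed.

Let sin_taylor (u v : R) : `|sin (v + u) - sin v - cos v * u| <= 2 * u ^+ 2.
Proof.
have := cos_taylor u (v - pi / 2).
have -> : v - pi / 2 + u = v + u - pi / 2 by ring.
by rewrite !cosB !sinB !cos_pihalf !sin_pihalf !mulr0 !mulr1 !add0r mulNr.
Qed.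

Let trig_poly_taylor : exists (F' : T -> R -> R) (K : T -> R), forall (w : T) (z t : R),
  `|trig_poly a b n w t - trig_poly a b n w z - F' w z * (t - z)| <= K w * (t - z) ^+ 2.
Proof.
exists (fun w z => (Num.sqrt n%:R)^-1 * \sum_(1 <= k < n.+1)
   (- a k w * sin (k%:R * z) * k%:R + b k w * cos (k%:R * z) * k%:R)).
exists (fun w => (Num.sqrt n%:R)^-1 * \sum_(1 <= k < n.+1)
   (`|a k w| * (2 * k%:R ^+ 2) + `|b k w| * (2 * k%:R ^+ 2))).
move=> w z t; have s0 : 0 <= (Num.sqrt n%:R)^-1 :> R by rewrite invr_ge0 sqrtr_ge0.
rewrite /trig_poly -!mulrA -!mulrBr normrM (ger0_norm s0) ler_wpM2l//.
rewrite !big_distrl/= -!sumrB; apply: (le_trans (ler_norm_sum _ _ _)).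
apply: ler_sum => k _.
have ut : k%:R * t = k%:R * z + k%:R * (t - z) by ring.
have h1 := cos_taylor (k%:R * (t - z)) (k%:R * z).
have h2 := sin_taylor (k%:R * (t - z)) (k%:R * z).
rewrite -ut in h1 h2.
have -> : a k w * cos (k%:R * t) + b k w * sin (k%:R * t) -
    (a k w * cos (k%:R * z) + b k w * sin (k%:R * z)) -
    (- a k w * sin (k%:R * z) * k%:R + b k w * cos (k%:R * z) * k%:R) * (t - z) =
  a k w * (cos (k%:R * t) - cos (k%:R * z) + sin (k%:R * z) * (k%:R * (t - z))) +
  b k w * (sin (k%:R * t) - sin (k%:R * z) - cos (k%:R * z) * (k%:R * (t - z))) by ring.
apply: (le_trans (ler_normD _ _)); rewrite !normrM mulrDl.
have e (x : R) : x * (2 * k%:R ^+ 2) * (t - z) ^+ 2 = x * (2 * (k%:R * (t - z)) ^+ 2) by ring.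
by rewrite !e; apply: lerD; apply: ler_wpM2l.
Qed.

Let mtrig : measurable_fun setT (fun p : T * R => trig_poly a b n p.1 p.2).
Proof.
apply: measurable_funM; first exact: measurable_cst.
apply: measurable_sum => k; apply: measurable_funD; apply: measurable_funM.
- by apply: measurableT_comp => //; exact: measurable_fst.
- apply: measurableT_comp => //; first by apply: continuous_measurable_fun; exact: continuous_cos.
  by apply: measurable_funM; [exact: measurable_cst|exact: measurable_snd].
- by apply: measurableT_comp => //; exact: measurable_fst.
- apply: measurableT_comp => //; first by apply: continuous_measurable_fun; exact: continuous_sin.
  by apply: measurable_funM; [exact: measurable_cst|exact: measurable_snd].
Qed.

Let ctrig w : continuous (trig_poly a b n w).
Proof.
move=> t; apply: cvgM; first exact: cvg_cst.
elim: (n) => [|m IH].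
  rewrite (_ : (fun x : R => _) = fun=> 0); last by apply/funext => x; rewrite big_geq.
  by rewrite big_geq//; exact: cvg_cst.
rewrite (_ : (fun x : R => _) = (fun x => \sum_(1 <= k < m.+1) (a k w * cos (k%:R * x) + b k w * sin (k%:R * x)) +
   (a m.+1 w * cos (m.+1%:R * x) + b m.+1 w * sin (m.+1%:R * x)))); last first.
  by apply/funext => x; rewrite big_nat_recr.
rewrite big_nat_recr//=; apply: cvgD => //.
have cm : continuous (fun x : R => m.+1%:R * x) by move=> x; apply: cvgM; [exact: cvg_cst|exact: cvg_id].
apply: cvgD; (apply: cvgM; first exact: cvg_cst).
  by apply: (@continuous_comp _ _ _ (fun x : R => m.+1%:R * x) cos); [exact: cm|exact: continuous_cos].
by apply: (@continuous_comp _ _ _ (fun x : R => m.+1%:R * x) sin); [exact: cm|exact: continuous_sin].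
Qed.

Theorem expected_nb_zeros : (\int[P]_w nb_zeros (trig_poly a b n w) `[0%R, (2 * pi)%R] =
  pi^-1%:E * \int[mu]_(t in `[0%R, (2 * pi)%R[)
    (Num.sqrt ((n.+1%:R / 2) ^+ 2 + wronskian alpha n t ^+ 2))%:E)%E.
Proof.
have [C sb] := small_ball; have [F' [K FK]] := trig_poly_taylor.
rewrite (kac_formula dDm dDp cDm' cDp' D_gt0 pi2_gt0 mtrig ctrig trig_poly_lt0 FK sb).
by congr (_ * _)%E; apply: eq_integral => t _; rewrite speedE.
Qed.

(* The Kac formula for [dirichlet_process], whose number of zeros is bounded. *)
Lemma wronskian_variation :
  (\int[mu]_(t in `[0%R, (2 * pi)%R[) (`|wronskian alpha n t|)%:E <= (pi * n.+2%:R)%:E)%E.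
Proof.
have mV : measurable_fun setT (fun p : T * R => dirichlet_process n p.1 p.2).
  have md (c : R) : measurable_fun setT (fun p : T * R => dirichlet n (p.2 + c)).
    have mf : measurable_fun setT (fun t : R => dirichlet n (t + c)).
      by apply: continuous_measurable_fun; apply: continuous_shift; exact: continuous_dirichlet.
    exact: (measurableT_comp mf (@measurable_snd _ _ T R)).
  apply: measurable_funD; apply: measurable_funM => //.
    by apply: measurableT_comp => //; exact: measurable_fst.
  by apply: measurableT_comp => //; exact: measurable_fst.
have := kac_cvg dDm dDp cDm' cDp' D_gt0 pi2_gt0 mV dirichlet_process_lt0.
have -> : (\int[mu]_(t in `[0%R, (2 * pi)%R[) (Num.sqrt (0 ^+ 2 + angular_speed Dm Dp Dm' Dp' t ^+ 2))%:E =
   \int[mu]_(t in `[0%R, (2 * pi)%R[) (`|wronskian alpha n t|)%:E)%E.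
  by apply: eq_integral => t _; rewrite speedE expr0n/= add0r sqrtr_sqr.
set I := (\int[mu]_(t in `[0%R, (2 * pi)%R[) (`|wronskian alpha n t|)%:E)%E => cv.
suff : (pi^-1%:E * I <= n.+2%:R%:E)%E.
  move=> h; have p0 := pi_gt0 R; rewrite EFinM.
  have -> : I = (pi%:E * (pi^-1%:E * I))%E by rewrite muleA -EFinM divff ?mul1e// gt_eqF.
  by apply: lee_wpmul2l => //; rewrite lee_fin ltW.
rewrite -(cvg_lim _ cv)//; apply: lime_le; first by apply/cvg_ex; eexists; exact: cv.
near=> k.
apply: (@le_trans _ _ (k.+1%:R%:E * (k.+1%:R^-1 * n.+2%:R)%:E)%E); last first.
  by rewrite -EFinM mulrA divff ?mul1r// pnatr_eq0.
apply: lee_wpmul2l => //.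
have k0 : 0 < k.+1%:R^-1 :> R by rewrite invr_gt0.
rewrite -(integral_cst_probability P); apply: ge0_le_integral => //.
- exact: (measurable_sign_change_measure (2 * pi) mV).
- move=> w _; have := dirichlet_pair_sign_change alpha n (a 1%N w) (b 1%N w) k0.
  rewrite [X in sign_change_set X](_ : _ = dirichlet_process n w)//.
  by apply/funext => t; rewrite /dirichlet_process; ring.
Unshelve. all: by end_near. Qed.
End trig_zeros.

(** * The two-scale limit *)

Section periodic_integrals.
Context {R : realType}.
Notation mu := (@lebesgue_measure R).
Implicit Types (c t s u L : R).

Lemma ge0_integral_shift (f : R -> \bar R) c : measurable_fun setT f -> (forall t, 0 <= f t)%E ->
  (\int[mu]_t f (t + c)%R = \int[mu]_t f t)%E.
Proof.
move=> mf f0.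
have mc0 : measurable_fun setT (fun t : R => t + c : R) by exact: measurable_funD.
have mc : @measurable_fun _ _ (measurableTypeR R) (measurableTypeR R) setT (fun t : R => t + c).
  by move=> mT A mA; have := mc0 mT A mA.
pose phi : {mfun measurableTypeR R >-> measurableTypeR R} :=
  HB.pack (fun t : R => t + c : R) (isMeasurableFun.Build _ _ _ _ _ mc).
have E A : measurable A -> mu A = pushforward mu phi A.
  apply: lebesgue_measure_unique => _ [[x y] _ <-] /=.
  rewrite /pushforward /= (_ : (fun t => t + c) @^-1` `]x, y] = `]x - c, y - c]%classic).
    rewrite !lebesgue_measure_itv/= !lte_fin ltrD2r; case: ifP => // _.
    by rewrite -!EFinB; congr EFin; ring.
  by apply/seteqP; split => t /=; rewrite !in_itv/= => /andP[h1 h2]; apply/andP; split; lra.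
rewrite -[RHS](@eq_measure_integral _ _ _ setT mu (pushforward mu phi)); last first.
  by move=> A mA _; symmetry; exact: E.
by rewrite ge0_integral_pushforward//= preimage_setT.
Qed.

Lemma ge0_integral_itv_shift (f : R -> \bar R) a b c : measurable_fun setT f -> (forall t, 0 <= f t)%E ->
  (\int[mu]_(t in `[a, b[) f (t + c)%R = \int[mu]_(t in `[(a + c)%R, (b + c)%R[) f t)%E.
Proof.
move=> mf f0.
rewrite integral_mkcond [RHS]integral_mkcond.
rewrite -[RHS](ge0_integral_shift c); last 2 first.
- by apply: (measurable_restrictT _ _).1; [exact: measurable_itv|exact: measurable_funTS].
- by move=> t; rewrite patchE; case: ifP.
apply: eq_integral => t _; rewrite !patchE.
have -> : (t \in `[a, b[%classic) = (t + c \in `[a + c, b + c[%classic) => //.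
by apply/idP/idP => /set_mem/=; rewrite in_itv/= => /andP[h1 h2]; apply/mem_set => /=;
  rewrite in_itv/=; apply/andP; split; lra.
Qed.

Section period.
Variable L : R.
Hypothesis L_gt0 : 0 < L.

Definition wrap t : R := t - L * (Num.floor (t / L))%:~R.

Lemma wrap_itv t : 0 <= wrap t < L.
Proof.
have /andP[h1 h2] := floor_itv (t / L); rewrite intrD mulr1z in h2.
rewrite ler_pdivlMr// in h1; rewrite ltr_pdivrMr// in h2.
by rewrite /wrap; apply/andP; split; lra.
Qed.

Lemma wrap_id t : 0 <= t < L -> wrap t = t.
Proof.
move=> /andP[t0 tL]; rewrite /wrap.
have -> : Num.floor (t / L) = 0.
  by apply/eqP; rewrite floor_eq// add0r divr_ge0 ?(ltW L_gt0)//= ltr_pdivrMr// mul1r.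
by rewrite mulr0 subr0.
Qed.

Lemma wrapD t : wrap (t + L) = wrap t.
Proof.
rewrite /wrap mulrDl divff ?gt_eqF//.
have -> : Num.floor (t / L + 1) = Num.floor (t / L) + 1.
  by rewrite floorDrz ?rpred1// floor1.
by rewrite intrD mulr1z; ring.
Qed.

Lemma wrapE t : exists k : int, wrap t = t - k%:~R * L.
Proof. by exists (Num.floor (t / L)); rewrite /wrap mulrC. Qed.

Lemma measurable_wrap : measurable_fun setT wrap.
Proof.
apply: measurable_funB; first exact: measurable_id.
apply: measurable_funM; first exact: measurable_cst.
apply: (@measurableT_comp _ _ _ _ _ _ (fun t : R => (Num.floor t)%:~R : R) _ (fun t : R => t / L)).
  apply: nondecreasing_measurable => // x y xy.
  have /andP[h1 _] := floor_itv x.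
  by rewrite ler_int floor_ge_int (le_trans h1).
exact: measurable_funM.
Qed.

Variable f : R -> \bar R.
Hypothesis mf : measurable_fun setT f.
Hypothesis f_ge0 : forall t, (0 <= f t)%E.
Hypothesis f_per : forall t, f (t + L) = f t.

Lemma periodic_int (k : int) t : f (t + k%:~R * L) = f t.
Proof.
have nat_case (m : nat) u : f (u + m%:R * L) = f u.
  elim: m u => [|m IH] u; first by rewrite mul0r addr0.
  by rewrite natSM addrA f_per IH.
case: k => m; first exact: nat_case.
rewrite -(nat_case m.+1 (t + _)) NegzE mulrNz mulNr -[(m.+1)%:~R]/(m.+1%:R).
by rewrite subrK.
Qed.

(** With c reduced to [0, L[, the shifted period is cut at L and the overhang [L, L + c[ is moved
    back to [0, c[. *)
Lemma ge0_integral_periodic c :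
  (\int[mu]_(t in `[0%R, L[) f (t + c)%R = \int[mu]_(t in `[0%R, L[) f t)%E.
Proof.
wlog cI : c / 0 <= c < L => [H|].
  have [k kE] := wrapE c.
  rewrite -(H (wrap c) (wrap_itv c)); apply: eq_integral => t _.
  by rewrite kE addrA -mulNr -mulrNz periodic_int.
have /andP[c0 cL] := cI.
rewrite ge0_integral_itv_shift// add0r.
have split3 a b e : a <= b -> b <= e ->
   (\int[mu]_(t in `[a, e[) f t = \int[mu]_(t in `[a, b[) f t + \int[mu]_(t in `[b, e[) f t)%E.
  move=> ab be.
  have -> : `[a, e[%classic = `[a, b[%classic `|` `[b, e[%classic.
    apply/seteqP; split => t /=; rewrite !in_itv/=.
      move=> /andP[h1 h2]; have [tb|tb] := ltP t b; [left|right]; first by rewrite h1.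
      by rewrite h2.
    by move=> [/andP[h1 h2]|/andP[h1 h2]]; apply/andP; split; lra.
  rewrite ge0_integral_setU//; first exact: measurable_funTS.
  rewrite disj_set2E; apply/eqP/seteqP; split => // t /=; rewrite !in_itv/= => -[/andP[_ h1] /andP[h2 _]].
  by move: h1; rewrite ltNge h2.
rewrite (split3 c L (L + c)) ?(ltW cL) ?lerDl// (split3 0 c L)//; last exact: ltW.
rewrite addeC; congr (_ + _)%E.
have := ge0_integral_itv_shift 0 c L mf f_ge0; rewrite add0r (addrC c) => <-.
by apply: eq_integral => t _; rewrite f_per.
Qed.
End period.

(** * Iterated integrals over rectangles *)

Section product_integral.
Context d1 d2 (T1 : measurableType d1) (T2 : measurableType d2).
Variables (m1 : {sigma_finite_measure set T1 -> \bar R}) (m2 : {sigma_finite_measure set T2 -> \bar R}).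

Lemma ge0_integral_setX (A : set T1) (B : set T2) (f : T1 * T2 -> \bar R) :
  measurable A -> measurable B -> measurable_fun setT f -> (forall p, 0 <= f p)%E ->
  (\int[m1 \x m2]_(p in A `*` B) f p = \int[m1]_(s in A) \int[m2]_(u in B) f (s, u))%E.
Proof.
move=> mA mB mf f0; rewrite integral_mkcond fubini_tonelli1//; last 2 first.
- apply: (measurable_restrictT _ _).1; first exact: measurableX.
  exact: measurable_funTS.
- by move=> p; rewrite patchE; case: ifP.
rewrite [RHS]integral_mkcond; apply: eq_integral => s _.
rewrite patchE; case: ifPn => sA.
  rewrite /fubini_F [RHS]integral_mkcond; apply: eq_integral => u _.
  by rewrite !patchE in_setX sA.
rewrite /fubini_F; under eq_integral do rewrite patchE in_setX (negbTE sA)/=.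
by rewrite integral0.
Qed.

Lemma measurable_integral_section (B : set T2) (f : T1 * T2 -> \bar R) :
  measurable B -> measurable_fun setT f -> (forall p, 0 <= f p)%E ->
  measurable_fun setT (fun x : T1 => \int[m2]_(y in B) f (x, y))%E.
Proof.
move=> mB mf f0.
have mr : measurable_fun setT (f \_ (setT `*` B)).
  apply: (measurable_restrictT _ _).1; first exact: measurableX.
  exact: measurable_funTS.
have r0 q : (0 <= (f \_ (setT `*` B)) q)%E by rewrite patchE; case: ifP.
have : measurable_fun setT (fubini_F m2 (f \_ (setT `*` B))).
  exact: measurable_fun_fubini_tonelli_F.
apply: eq_measurable_fun => s _; rewrite /fubini_F [RHS]integral_mkcond.
by apply: eq_integral => u _; rewrite !patchE in_setX in_setT.
Qed.
End product_integral.

(** * Averaging over the slow and the fast variable *)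

Section averaging.
Variables (L : R) (G : R -> \bar R) (n : nat) (c : R).
Hypothesis L_gt0 : 0 < L.
Hypothesis mG : measurable_fun setT G.
Hypothesis G_ge0 : forall t, (0 <= G t)%E.
Hypothesis G_per : forall t, G (t + L) = G t.

(* The point of [s, s + L / n[ at which n t = u + c modulo L. *)
Definition two_scale s u : R := s + n%:R^-1 * wrap L (u + c - n%:R * s).

Lemma measurable_two_scale : measurable_fun setT (fun p : R * R => two_scale p.1 p.2).
Proof.
apply: measurable_funD; first exact: measurable_fst.
apply: measurable_funM; first exact: measurable_cst.
have m1 : measurable_fun setT (fun p : R * R => p.2 + c - n%:R * p.1).
  apply: measurable_funB.
    by apply: measurable_funD; [exact: measurable_snd|exact: measurable_cst].
  by apply: measurable_funM; [exact: measurable_cst|exact: measurable_fst].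
exact: (measurableT_comp (measurable_wrap L) m1).
Qed.

(* Shifting u by c - n s moves the integrand to G (s + u / n); then Tonelli and a shift of s remove u / n. *)
Lemma integral_two_scale :
  (\int[mu]_(s in `[0%R, L[) \int[mu]_(u in `[0%R, L[) G (two_scale s u) =
   L%:E * \int[mu]_(t in `[0%R, L[) G t)%E.
Proof.
transitivity (\int[mu]_(s in `[0%R, L[) \int[mu]_(u in `[0%R, L[) G (s + n%:R^-1 * u)%R)%E.
  apply: eq_integral => s _.
  have mw : measurable_fun setT (fun u => G (s + n%:R^-1 * wrap L u)).
    apply: (measurableT_comp mG); apply: measurable_funD => //.
    by apply: measurable_funM => //; exact: measurable_wrap.
  have := @ge0_integral_periodic L L_gt0 (fun u => G (s + n%:R^-1 * wrap L u)) mw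
    (fun u => G_ge0 _) (fun u => congr1 (fun x => G (s + n%:R^-1 * x)) (wrapD L_gt0 u)) (c - n%:R * s).
  move=> H; transitivity (\int[mu]_(u in `[0%R, L[) G (s + n%:R^-1 * wrap L u)%R)%E.
    by rewrite -H; apply: eq_integral => u _; rewrite /two_scale addrA.
  by apply: eq_integral => u /set_mem/=; rewrite in_itv/= => uI; rewrite wrap_id.
have mI : measurable `[0, L[%classic by exact: measurable_itv.
have m2 : measurable_fun setT (fun p : R * R => G (p.1 + n%:R^-1 * p.2)).
  apply: (measurableT_comp mG); apply: measurable_funD; first exact: measurable_fst.
  by apply: measurable_funM; [exact: measurable_cst|exact: measurable_snd].
transitivity (\int[mu]_(u in `[0%R, L[) \int[mu]_(s in `[0%R, L[) G (s + n%:R^-1 * u)%R)%E.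
  pose h (p : R * R) := ((fun p : R * R => G (p.1 + n%:R^-1 * p.2)%R) \_ (`[0, L[ `*` `[0, L[)) p.
  have mh : measurable_fun setT h.
    apply: (measurable_restrictT _ _).1; first exact: measurableX.
    exact: measurable_funTS.
  have h0 p : (0 <= h p)%E by rewrite /h patchE; case: ifP.
  transitivity (\int[mu]_s \int[mu]_u h (s, u))%E.
    rewrite integral_mkcond; apply: eq_integral => s _; rewrite patchE; case: ifPn => sI.
      rewrite integral_mkcond; apply: eq_integral => u _.
      by rewrite /h !patchE in_setX sI.
    under eq_integral do rewrite /h patchE in_setX (negbTE sI)/=.
    by rewrite integral0.
  transitivity (\int[mu]_u \int[mu]_s h (s, u))%E.
    exact: (@fubini_tonelli _ _ _ _ _ mu mu h mh h0).
  rewrite [RHS]integral_mkcond; apply: eq_integral => u _; rewrite patchE; case: ifPn => uI.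
    rewrite [RHS]integral_mkcond; apply: eq_integral => s _.
    by rewrite /h !patchE in_setX uI andbT.
  under eq_integral do rewrite /h patchE in_setX (negbTE uI) andbF/=.
  by rewrite integral0.
rewrite (@eq_integral _ _ _ _ _ (fun=> \int[mu]_(t in `[0%R, L[) G t)%E); last first.
  by move=> u _; apply: ge0_integral_periodic.
set I := (\int[mu]_(t in _) G t)%E.
have /= -> := @integral_cst _ _ _ mu _ mI I.
by rewrite lebesgue_measure_itv/= lte_fin L_gt0 oppr0 addr0 muleC.
Qed.
End averaging.
End periodic_integrals.

(** * Total mass of a Poisson kernel *)

Section poisson_kernel.
Context {R : realType}.
Notation mu := (@lebesgue_measure R).
Variables (x l : R).
Hypothesis x_in : 0 < x < pi.
Hypothesis l_gt0 : 0 < l.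

Let sx_gt0 : 0 < sin x. Proof. exact: sin_gt0_pi. Qed.

(** The denominator of [g_fun] after u is shifted by x and sin((s + alpha) / 2)^2 is factored out;
    [l] is the ratio of the two slow sines in absolute value. *)
Definition poisson_den (u : R) : R := sin (u / 2) ^+ 2 + l ^+ 2 * sin (u / 2 + x) ^+ 2.

Lemma poisson_den_gt0 u : 0 < poisson_den u.
Proof.
have q1 := sqr_ge0 (sin (u / 2)).
have q2 : 0 <= l ^+ 2 * sin (u / 2 + x) ^+ 2 by rewrite -exprMn sqr_ge0.
rewrite /poisson_den lt_neqAle (addr_ge0 q1 q2) andbT eq_sym; apply/eqP => /eqP.
rewrite paddr_eq0// => /andP[]; rewrite sqrf_eq0 => /eqP h1.
rewrite -exprMn sqrf_eq0 mulf_eq0 (gt_eqF l_gt0)/= => /eqP; rewrite sinD h1 mul0r add0r => /eqP.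
rewrite mulf_eq0 (gt_eqF sx_gt0) orbF => /eqP h2.
by have := cos2Dsin2 (u / 2); rewrite h1 h2; lra.
Qed.

Lemma continuous_poisson : continuous (fun u => l * sin x / poisson_den u).
Proof.
have csq (f : R -> R) : continuous f -> continuous (fun u => sin (f u) ^+ 2).
  move=> cf u; apply: (@continuous_comp _ _ _ (fun u => sin (f u)) (fun y => y ^+ 2)); last exact: exprn_continuous.
  by apply: (@continuous_comp _ _ _ f sin); [exact: cf|exact: continuous_sin].
move=> u; apply: cvgM; first exact: cvg_cst.
apply: cvgV; first by rewrite gt_eqF// poisson_den_gt0.
apply: cvgD; first by apply: (csq (fun u => u / 2)); exact: continuous_half.
apply: cvgM; first exact: cvg_cst.
apply: (csq (fun u => u / 2 + x)) => v.
by apply: cvgD; [exact: continuous_half|exact: cvg_cst].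
Qed.

(** With y the argument of [atan], sin(u / 2)^2 (1 + y^2) is the denominator of the kernel. The
    cotangent runs from +oo to -oo over a period, whence the mass 2 pi. *)
Let primitive (u : R) : R := - 2 * atan (l * (cos x + sin x * (cos (u / 2) / sin (u / 2)))).

Let is_derive_primitive u : 0 < u < 2 * pi ->
  is_derive u (1 : R) primitive (l * sin x / poisson_den u).
Proof.
move=> /andP[u0 u1].
have su : 0 < sin (u / 2) by apply: sin_gt0_pi; apply/andP; split; lra.
have h1 := is_derive_mulr 2^-1 u.
have h2 : is_derive u 1 (fun x => cos (x / 2)) (- sin (u / 2) * 2^-1).
  exact: (@is_derive1_comp _ cos (fun x => x / 2) u _ _ (is_derive_cos (u / 2)) h1).
have h3 : is_derive u 1 (fun x => sin (x / 2)) (cos (u / 2) * 2^-1).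
  exact: (@is_derive1_comp _ sin (fun x => x / 2) u _ _ (is_derive_sin (u / 2)) h1).
have h4 : is_derive u 1 (fun x => (sin (x / 2))^-1) (- (sin (u / 2)) ^- 2 *: (cos (u / 2) * 2^-1)).
  by apply: is_deriveV => //; rewrite gt_eqF.
have h5 := is_deriveM h2 h4.
have h6 : is_derive u 1 (fun t => l * (cos x + sin x * (cos (t / 2) / sin (t / 2))))
    (l * (sin x * (- 2^-1 / sin (u / 2) ^+ 2))).
  have h7 := is_deriveZ (l * sin x) h5.
  have h8 := is_deriveD (is_derive_cst (l * cos x) u 1) h7.
  have -> : (fun t => l * (cos x + sin x * (cos (t / 2) / sin (t / 2)))) =
      (cst (l * cos x) \+ (l * sin x) \*: ((fun x => cos (x / 2)) \* (fun x => (sin (x / 2))^-1))).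
    by apply/funext => t /=; rewrite /GRing.scale/=; ring.
  apply: (is_derive_eq h8); rewrite /GRing.scale/= add0r.
  have h := cos2Dsin2 (u / 2).
  have {h}-> : cos (u / 2) * (- sin (u / 2) ^- 2 * (cos (u / 2) / 2)) + (sin (u / 2))^-1 * (- sin (u / 2) / 2) =
     - 2^-1 * (cos (u / 2) ^+ 2 + sin (u / 2) ^+ 2) / sin (u / 2) ^+ 2.
    by field; rewrite gt_eqF.
  by rewrite cos2Dsin2; field; rewrite gt_eqF.
have h9 := @is_derive1_comp _ atan _ u _ _ (is_derive1_atan _) h6.
have := is_deriveZ (- 2) h9.
rewrite -[X in is_derive _ _ X]/primitive => h; apply: (is_derive_eq h); rewrite /GRing.scale/=.
have D0 := poisson_den_gt0 u; move: D0; rewrite /poisson_den sinD.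
set s := sin (u / 2) in su *; set c := cos (u / 2); set C := cos x; set S := sin x => D0.
have -> : 1 + (l * (C + S * (c / s))) ^+ 2 = (s ^+ 2 + l ^+ 2 * (s * C + c * S) ^+ 2) / s ^+ 2.
  by field; rewrite gt_eqF.
move: (s ^+ 2 + _) D0 => E E0.
by field; rewrite !gt_eqF.
Qed.

(** The primitive is singular at 0 and 2 pi, so the integral is restricted to [2 th, 2 pi - 2 th]
    with cot th = z. *)
Let truncated (z : R) : 0 < z ->
  ((2 * atan (l * (z * sin x + cos x)) + 2 * atan (l * (z * sin x - cos x)))%:E <=
    \int[mu]_(u in `[0%R, (2 * pi)%R[) (l * sin x / poisson_den u)%:E)%E.
Proof.
move=> z0; pose th := pi / 2 - atan z.
have a0 : 0 < atan z by rewrite -(@atan0 R) lt_atan.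
have a1 := atan_ltpi2 z; have p0 := pi_gt0 R.
have th0 : 0 < th by rewrite /th; lra.
have th1 : th < pi / 2 by rewrite /th; lra.
have cz : 0 < cos (atan z) by apply: cos_gt0_pihalf; apply/andP; split; lra.
have cth : cos th / sin th = z.
  rewrite /th cosB sinB cos_pihalf sin_pihalf !mul0r !mul1r add0r subr0.
  by have := atanK z; rewrite /tan.
have ab : 2 * th < 2 * pi - 2 * th by lra.
have dP u : u \in `[2 * th, 2 * pi - 2 * th] -> is_derive u (1 : R) primitive (l * sin x / poisson_den u).
  by rewrite in_itv/= => /andP[h1 h2]; apply: is_derive_primitive; apply/andP; split; lra.
have cP u : u \in `[2 * th, 2 * pi - 2 * th] -> {for u, continuous primitive}.
  by move=> /dP[du _]; apply: differentiable_continuous; exact/derivable1_diffP.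
have FTC := @continuous_FTC2 R (fun u => l * sin x / poisson_den u) primitive _ _ ab
  (continuous_subspaceT continuous_poisson).
have sub : `[2 * th, 2 * pi - 2 * th]%classic `<=` `[0, 2 * pi[%classic.
  by move=> u /=; rewrite !in_itv/= => /andP[h1 h2]; apply/andP; split; lra.
have e2 : 2 * th / 2 = th by field.
have e3 : (2 * pi - 2 * th) / 2 = pi - th by field.
apply: (@le_trans _ _ (\int[mu]_(u in `[(2 * th)%R, (2 * pi - 2 * th)%R]) (l * sin x / poisson_den u)%:E)%E).
  rewrite FTC.
  - rewrite /primitive e2 e3 cth.
    have -> : cos (pi - th) / sin (pi - th) = - z.
      by rewrite sinB cosB sinpi cospi !mul0r !mulN1r addr0 sub0r opprK mulNr cth.
    rewrite -EFinB lee_fin.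
    have -> : l * (cos x + sin x * - z) = - (l * (z * sin x - cos x)) by ring.
    have -> : l * (cos x + sin x * z) = l * (z * sin x + cos x) by ring.
    by rewrite atanN; lra.
  - split.
    + by move=> u uI; have [] := dP u (subset_itv_oo_cc uI).
    + by apply: cvg_at_right_filter; apply: cP; rewrite in_itv/= lexx ltW.
    + by apply: cvg_at_left_filter; apply: cP; rewrite in_itv/= lexx andbT ltW.
  - by move=> u uI; rewrite derive1E; have du := dP u (subset_itv_oo_cc uI); rewrite derive_val.
apply: ge0_subset_integral => //.
- by apply/measurable_EFinP; apply: measurable_funTS; apply: continuous_measurable_fun; exact: continuous_poisson.
- by move=> u _; rewrite lee_fin divr_ge0 ?mulr_ge0 ?ltW// poisson_den_gt0.
Qed.

(** This is the inequality that excludes loss of mass; Fatou's lemma supplies the reverse one later,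
    after integration over s. Each arc tangent is within e / 4 of pi / 2, and twice their sum is
    within e of 2 pi. *)
Lemma poisson_integral : ((2 * pi)%:E <=
  \int[mu]_(u in `[0%R, (2 * pi)%R[) (l * sin x / poisson_den u)%:E)%E.
Proof.
apply/lee_addgt0Pr => e e0.
have [Y [_ hY]] : \forall y \near +oo, pi / 2 - e / 4 <= atan y.
  by apply: (cvgr_ge (pi / 2) (@cvgy_atan R)); lra.
pose Z := `|Y| + 1; pose z := (Z / l + 1) / sin x.
have Z0 : 0 < Z by rewrite ltr_wpDl.
have z0 : 0 < z by rewrite divr_gt0// addr_gt0// divr_gt0.
have zs : z * sin x = Z / l + 1 by rewrite /z divfK// gt_eqF.
have big y : -1 <= y -> pi / 2 - e / 4 <= atan (l * (z * sin x + y)).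
  move=> y1; apply: hY; apply: (@lt_le_trans _ _ Z).
    by rewrite /Z (le_lt_trans (ler_norm Y))// ltrDl.
  have -> : Z = l * (Z / l) by rewrite mulrC divfK// gt_eqF.
  by rewrite ler_pM2l// zs; lra.
have h1 := big (cos x) (cos_geN1 x).
have h2 : pi / 2 - e / 4 <= atan (l * (z * sin x - cos x)).
  by apply: big; rewrite lerN2 cos_le1.
rewrite -leeBlDr//; apply: (le_trans _ (truncated z0)).
by rewrite -EFinB lee_fin; lra.
Qed.
End poisson_kernel.

(** * Convergence of integrals without loss of mass *)

Section scheffe.
Local Open Scope ereal_scope.
Context d (T : measurableType d) (R : realType) (mu : {measure set T -> \bar R}).
Variables (D : set T) (F : nat -> T -> R) (g : T -> R) (e c_ : nat -> R) (c M : R).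
Hypothesis mD : measurable D.
Hypothesis muD : mu D = M%:E.
Hypothesis mF : forall k, measurable_fun D (F k).
Hypothesis mg : measurable_fun D g.
Hypothesis F_ge0 : forall k t, (0 <= F k t)%R.
Hypothesis g_ge0 : forall t, (0 <= g t)%R.
Hypothesis Fg : {ae mu, forall t, D t -> F ^~ t @ \oo --> g t}.
Hypothesis F_le : forall k, \int[mu]_(t in D) (F k t)%:E <= (c_ k)%:E.
Hypothesis c_cvg : c_ @ \oo --> c.
Hypothesis g_ge : c%:E <= \int[mu]_(t in D) (g t)%:E.
Hypothesis e_ge0 : forall k, (0 <= e k)%R.
Hypothesis e_cvg : e @ \oo --> 0%R.

Lemma limn_einf_le (u : (\bar R)^nat) x : (\forall k \near \oo, u k <= x) -> limn_einf u <= x.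
Proof.
move=> [m _ um]; rewrite limn_einf_lim; apply: lime_le; first exact: is_cvg_einfs.
exists m => // k /= mk; apply: (@le_trans _ _ (u k)); last exact: um.
by apply: ereal_inf_lbound; exists k => /=.
Qed.

(** Fatou's lemma bounds the integral of [g] by the limit of the bounds [c_], which is the value
    assumed as a lower bound. *)
Let g_int : \int[mu]_(t in D) (g t)%:E = c%:E.
Proof.
apply/eqP; rewrite eq_le g_ge andbT; apply/lee_addgt0Pr => r r0.
have mF' k : measurable_fun D (EFin \o F k) by exact/measurable_EFinP.
rewrite (@ge0_ae_eq_integral _ _ _ _ _ _ (fun t => limn_einf (fun k => (F k t)%:E)))//; last 5 first.
- exact/measurable_EFinP.
- rewrite /limn_einf; apply: measurableT_comp => //.
  apply: (@measurable_fun_limn_esup _ _ _ D (fun k t => - (F k t)%:E)) => k.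
  by apply: measurableT_comp => //; exact: mF'.
- by move=> t _; rewrite lee_fin.
- by move=> t _; apply: limn_einf_ge; apply: nearW => k; rewrite lee_fin.
- have [N [mN N0 FN]] := Fg; exists N; split => // t /= h; apply: FN => /= h'; apply: h => Dt.
  have Ft : (fun k => (F k t)%:E) @ \oo --> (g t)%:E.
    by apply: cvg_EFin; [exact: nearW|exact: h'].
  by have [-> _] := cvg_limn_einf_sup Ft.
apply: (@le_trans _ _ (limn_einf (fun k => \int[mu]_(t in D) (F k t)%:E))).
  by apply: fatou => // k t _; rewrite lee_fin.
apply: limn_einf_le.
have : \forall k \near \oo, (c_ k <= c + r)%R by apply: (cvgr_le c c_cvg); rewrite ltrDl.
by apply: filterS => k ck; rewrite (le_trans (F_le k))// -EFinD lee_fin.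
Qed.

Let b k : \bar R := \int[mu]_(t in D) (Num.max 0 (g t - F k t)%R)%:E.

Let mb k : measurable_fun D (fun t => (Num.max 0 (g t - F k t)%R)%:E).
Proof.
apply/measurable_EFinP; apply: measurable_maxr; first exact: measurable_cst.
exact: measurable_funB.
Qed.

Let b_le k : b k <= c%:E.
Proof.
rewrite -g_int; apply: ge0_le_integral => //.
- by move=> t _; rewrite lee_fin le_max lexx.
- exact/measurable_EFinP.
- by move=> t _; rewrite lee_fin ge_max g_ge0/= gerBl.
Qed.

(** The positive part of g - F is dominated by the integrable [g], although [F] itself has no
    dominating function. *)
Let b_cvg : b @ \oo --> 0.
Proof.
have ig : mu.-integrable D (EFin \o g).
  apply/integrableP; split; first exact/measurable_EFinP.
  under eq_integral do rewrite /= ger0_norm//.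
  by rewrite g_int ltry.
have fc : {ae mu, forall t, D t -> (fun k => (Num.max 0 (g t - F k t)%R)%:E) @ \oo --> (cst 0 t : \bar R)}.
  have [N [mN N0 FN]] := Fg; exists N; split => // t /= h; apply: FN => /= h'; apply: h => Dt.
  apply: cvg_EFin; first exact: nearW.
  have {}h' := h' Dt.
  have gF : (fun k => (g t - F k t)%R) @ \oo --> 0%R.
    by rewrite -[X in _ --> X](subrr (g t)); apply: cvgB => //; exact: cvg_cst.
  apply: (@squeeze_cvgr _ _ _ _ (fun=> 0%R) (fun k => `|g t - F k t|%R)).
  - by apply: nearW => k; rewrite le_max lexx/= ge_max normr_ge0 ler_norm.
  - exact: cvg_cst.
  - by rewrite -(@normr0 _ R); apply: cvg_norm.
have fb : {ae mu, forall t k, D t -> `|(Num.max 0 (g t - F k t)%R)%:E| <= (EFin \o g) t}.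
  apply: aeW => t k _; rewrite /= lee_fin ger0_norm ?le_max ?lexx//.
  by rewrite ge_max g_ge0/= gerBl.
have [_ _] := @dominated_convergence _ _ R mu D mD _ (cst 0) _ mb (measurable_cst _) fc ig fb.
by rewrite integral0.
Qed.

Let dist k : \bar R := \int[mu]_(t in D) (`|F k t - g t|%R)%:E.

(** Integrates |F - g| + g = F + 2 max(0, g - F). *)
Let dist_le k : dist k <= (c_ k - c + 2 * fine (b k))%:E.
Proof.
have b0 : 0 <= b k by apply: integral_ge0 => t _; rewrite lee_fin le_max lexx.
have bf : b k \is a fin_num by rewrite ge0_fin_numE// (le_lt_trans (b_le k))// ltry.
have mdist : measurable_fun D (fun t => (`|F k t - g t|%R)%:E).
  by apply/measurable_EFinP; apply: measurableT_comp => //; exact: measurable_funB.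
have : dist k + c%:E <= (c_ k)%:E + 2%:E * b k.
  rewrite -g_int -ge0_integralD//; last 2 first.
  - by move=> t _; rewrite lee_fin.
  - exact/measurable_EFinP.
  rewrite (@eq_integral _ _ _ _ _ (fun t => (F k t)%:E + 2%:E * (Num.max 0 (g t - F k t)%R)%:E)); last first.
    move=> t _; rewrite -!EFinM -!EFinD; congr EFin.
    by have [h|h] := leP (g t - F k t)%R 0%R; [rewrite ger0_norm; lra|rewrite ltr0_norm; lra].
  have p1 t : D t -> 0 <= (F k t)%:E by rewrite lee_fin.
  have p2 t : D t -> 0 <= 2%:E * (Num.max 0 (g t - F k t)%R)%:E.
    by rewrite -EFinM lee_fin mulr_ge0// le_max lexx.
  have m1 : measurable_fun D (fun t => (F k t)%:E) by exact/measurable_EFinP.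
  have m2 := measurable_funeM 2%:E (mb k).
  rewrite ge0_integralD//.
  rewrite leeD//; rewrite ge0_integralZl//.
  by move=> t _; rewrite lee_fin le_max lexx.
rewrite -(fineK bf) -EFinM -EFinD => h.
by rewrite -leeBrDr// in h; rewrite (le_trans h)// -EFinB lee_fin; lra.
Qed.

(** The triangle inequality for the Euclidean norms of (p, x) and (q, y). *)
Let sqrt_lip (x y p q : R) : (0 <= p)%R -> (0 <= q)%R ->
  (Num.sqrt (p ^+ 2 + x ^+ 2) <= Num.sqrt (q ^+ 2 + y ^+ 2) + `|p - q| + `|x - y|)%R.
Proof.
move=> p0 q0; set S := Num.sqrt (q ^+ 2 + _).
have S0 : (0 <= S)%R by exact: sqrtr_ge0.
have S2 : (S ^+ 2 = q ^+ 2 + y ^+ 2)%R by rewrite sqr_sqrtr// addr_ge0 ?sqr_ge0.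
have qS : (q <= S)%R.
  by rewrite -(ger0_norm q0) -sqrtr_sqr ler_sqrt ?addr_ge0 ?sqr_ge0// lerDl sqr_ge0.
have yS : (`|y| <= S)%R.
  by rewrite -sqrtr_sqr ler_sqrt ?addr_ge0 ?sqr_ge0// lerDr sqr_ge0.
have n1 := normr_ge0 (p - q)%R; have n2 := normr_ge0 (x - y)%R.
have R0 : (0 <= S + `|p - q| + `|x - y|)%R by rewrite !addr_ge0.
rewrite -[leRHS](ger0_norm R0) -sqrtr_sqr ler_sqrt ?sqr_ge0//.
have h1 : (p ^+ 2 <= q ^+ 2 + 2 * S * `|p - q| + `|p - q| ^+ 2)%R.
  rewrite real_normK ?num_real//.
  have : (q * (p - q) <= S * `|p - q|)%R.
    by rewrite (le_trans (ler_norm _))// normrM (ger0_norm q0) ler_wpM2r.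
  nra.
have h2 : (x ^+ 2 <= y ^+ 2 + 2 * S * `|x - y| + `|x - y| ^+ 2)%R.
  rewrite real_normK ?num_real//.
  have : (y * (x - y) <= S * `|x - y|)%R.
    by rewrite (le_trans (ler_norm _))// normrM ler_wpM2r.
  nra.
have h3 : (0 <= `|p - q| * `|x - y|)%R by rewrite mulr_ge0.
nra.
Qed.

Let H k t : R := Num.sqrt ((1 + e k) ^+ 2 + F k t ^+ 2)%R.
Let H0 t : R := Num.sqrt (1 + g t ^+ 2)%R.

Let mH k : measurable_fun D (EFin \o H k).
Proof.
apply/measurable_EFinP; apply: (measurableT_comp (continuous_measurable_fun (@sqrt_continuous R))).
by apply: measurable_funD => //; exact: measurable_funX.
Qed.

Let mH0 : measurable_fun D (EFin \o H0).
Proof.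
apply/measurable_EFinP; apply: (measurableT_comp (continuous_measurable_fun (@sqrt_continuous R))).
by apply: measurable_funD => //; exact: measurable_funX.
Qed.

Let H0_fin : \int[mu]_(t in D) (H0 t)%:E \is a fin_num.
Proof.
have M0 : (0 <= M)%R by rewrite -lee_fin -muD measure_ge0.
rewrite ge0_fin_numE; last by apply: integral_ge0 => t _; rewrite lee_fin sqrtr_ge0.
apply: (@le_lt_trans _ _ (M + c)%:E); last exact: ltry.
apply: (@le_trans _ _ (\int[mu]_(t in D) (1%:E + (g t)%:E))).
  apply: ge0_le_integral => //.
  - by move=> t _; rewrite lee_fin sqrtr_ge0.
  - by apply: emeasurable_funD => //; exact/measurable_EFinP.
  - move=> t _; rewrite -EFinD lee_fin /H0.
    have := sqrt_lip (g t) 0 ler01 ler01; rewrite expr1n expr0n/= addr0 sqrtr1 subrr normr0 addr0 subr0.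
    by rewrite (ger0_norm (g_ge0 t)).
rewrite ge0_integralD//; [|by move=> t _; rewrite lee_fin|exact/measurable_EFinP].
by have /= -> := @integral_cst _ _ _ mu _ mD 1%:E; rewrite muD mul1e g_int EFinD.
Qed.

(* The 1-Lipschitz bounds for sqrt (1 + y^2) reduce this to the L^1 convergence of F to g. *)
Lemma cvg_integral_sqrt : \int[mu]_(t in D) (H0 t)%:E \is a fin_num /\
  (fun k => \int[mu]_(t in D) (H k t)%:E) @ \oo --> \int[mu]_(t in D) (H0 t)%:E.
Proof.
have fH0 := H0_fin; split => //; set I := integral _ _ _ in fH0 *.
pose r k := (c_ k - c + 2 * fine (b k))%R.
have mdist k : measurable_fun D (fun t => (`|F k t - g t|%R)%:E).
  by apply/measurable_EFinP; apply: measurableT_comp => //; exact: measurable_funB.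
have Hp k' t : D t -> 0 <= (H k' t)%:E by rewrite lee_fin sqrtr_ge0.
have H0p t : D t -> 0 <= (H0 t)%:E by rewrite lee_fin sqrtr_ge0.
have dp k' t : D t -> 0 <= (`|F k' t - g t|%R)%:E by rewrite lee_fin.
have ep k' t : D t -> 0 <= (e k')%:E by rewrite lee_fin.
have edp k' t : D t -> 0 <= (e k')%:E + (`|F k' t - g t|%R)%:E by rewrite -EFinD lee_fin addr_ge0.
have mH' k' : measurable_fun D (fun t => (H k' t)%:E) := mH k'.
have mH0' : measurable_fun D (fun t => (H0 t)%:E) := mH0.
have med k' : measurable_fun D (fun t => (e k')%:E + (`|F k' t - g t|%R)%:E).
  by apply: emeasurable_funD; [exact: measurable_cst|exact: mdist].
have r_cvg : r @ \oo --> 0%R.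
  have -> : 0%R = (c - c + 2 * 0)%R by ring.
  apply: cvgD; first by apply: cvgB => //; exact: cvg_cst.
  by apply: cvgM; [exact: cvg_cst|exact: fine_cvg].
apply: (@squeeze_cvge _ _ _ _ (fun k => (fine I - r k)%:E) _ (fun k => (fine I + e k * M + r k)%:E)).
- apply: nearW => k; apply/andP; split.
    have : I <= \int[mu]_(t in D) (H k t)%:E + (r k)%:E.
      apply: (@le_trans _ _ (\int[mu]_(t in D) ((H k t)%:E + (`|F k t - g t|%R)%:E))).
        apply: ge0_le_integral => //.
        - by apply: emeasurable_funD; [exact: mH|exact: mdist].
        - move=> t _; rewrite -EFinD lee_fin /H0 /H.
          apply: (@le_trans _ _ (Num.sqrt (1 ^+ 2 + F k t ^+ 2) + `|1 - 1| + `|g t - F k t|))%R.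
            by have := sqrt_lip (g t) (F k t) ler01 ler01; rewrite !expr1n.
          rewrite subrr normr0 addr0 distrC lerD2r ler_sqrt ?addr_ge0 ?sqr_ge0//.
          by rewrite lerD2r ler_pXn2r ?nnegrE ?addr_ge0// lerDl.
      rewrite ge0_integralD//; last exact: Hp.
      by rewrite leeD2l// dist_le.
    by rewrite -(fineK fH0) EFinB leeBlDr.
  apply: (@le_trans _ _ (\int[mu]_(t in D) ((H0 t)%:E + ((e k)%:E + (`|F k t - g t|%R)%:E)))).
    apply: ge0_le_integral => //.
    - exact: Hp.
    - apply: emeasurable_funD; first exact: mH0.
      by apply: emeasurable_funD; [exact: measurable_cst|exact: mdist].
    - move=> t _; rewrite -!EFinD lee_fin /H0 /H.
      have := sqrt_lip (F k t) (g t) (addr_ge0 ler01 (e_ge0 k)) ler01.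
      by rewrite expr1n (addrC 1%R) addrK (ger0_norm (e_ge0 k)) addrA.
  rewrite (ge0_integralD mu mD H0p mH0' (edp k) (med k)).
  rewrite (ge0_integralD mu mD (ep k) (measurable_cst _) (dp k) (mdist k)).
  have /= -> := @integral_cst _ _ _ mu _ mD (e k)%:E; rewrite muD.
  rewrite -/I -(fineK fH0) -EFinM -addrA EFinD leeD2l// EFinD leeD2l//.
  exact: dist_le.
- rewrite -(fineK fH0) -[X in _ --> X%:E]subr0.
  apply: cvg_EFin; first exact: nearW.
  by apply: cvgB => //; exact: cvg_cst.
- suff : (fine I + e k * M + r k)%:E @[k --> \oo] --> (fine I + 0 * M + 0)%R%:E.
    by rewrite mul0r !addr0 (fineK fH0).
  apply: cvg_EFin; first exact: nearW.
  apply: cvgD => //; apply: cvgD; first exact: cvg_cst.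
  by apply: cvgM => //; exact: cvg_cst.
Qed.
End scheffe.

Section measurable_inverse.
Context {R : realType}.

(* y / (y^2 + 1/k) tends to y^-1 also at y = 0, where y^-1 is 0. *)
Lemma measurable_inv : measurable_fun setT (fun y : R => y^-1).
Proof.
pose h (k : nat) (y : R) := y / (y ^+ 2 + k.+1%:R^-1).
have k0 (k : nat) : 0 < k.+1%:R^-1 :> R by rewrite invr_gt0.
apply: (@measurable_fun_cvg _ _ R setT h).
  move=> k; apply: continuous_measurable_fun => y; apply: cvgM; first exact: cvg_id.
  apply: cvgV; first by rewrite gt_eqF// ltr_wpDl ?sqr_ge0.
  by apply: cvgD; [exact: exprn_continuous|exact: cvg_cst].
move=> y _; have [->|y0] := eqVneq y 0.
  by rewrite invr0 /h; under eq_fun do rewrite mul0r; exact: cvg_cst.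
have -> : y^-1 = y / (y ^+ 2 + 0) by rewrite addr0; field.
apply: cvgM; first exact: cvg_cst.
apply: cvgV; first by rewrite addr0 sqrf_eq0.
by apply: cvgD; [exact: cvg_cst|exact: (@cvg_harmonic R)].
Qed.
End measurable_inverse.

(** * Convergence of the rescaled speed to [g_fun] and of the integrals to [ell] *)

Section two_scale_limit.
Context {R : realType}.
Notation mu := (@lebesgue_measure R).
Variables (alpha x : R) (p : nat -> nat).
Hypothesis x_in : 0 < x < pi.
Hypothesis p_gt0 : forall k, (0 < p k)%N.
Hypothesis sin_pa : forall k, sin ((p k)%:R * alpha) != 0.
Hypothesis p_cvg : (fun k => (p k)%:R^-1 : R) @ \oo --> (0 : R).
Hypothesis X_cvg : (fun k => modpi ((p k)%:R * alpha)) @ \oo --> x.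
Hypothesis variation : forall k,
  (\int[mu]_(t in `[0%R, (2 * pi)%R[) (`|wronskian alpha (p k) t|)%:E <= (pi * (p k).+2%:R)%:E)%E.

Let p0 := pi_gt0 R.
Let L_gt0 : 0 < 2 * pi :> R. Proof. by rewrite mulr_gt0. Qed.
Let sx_gt0 : 0 < sin x. Proof. exact: sin_gt0_pi. Qed.
Let nR k : 0 < (p k)%:R :> R. Proof. by rewrite ltr0n. Qed.

(* The integer part of n alpha / pi: the phase that aligns n t +- n alpha with u +- x. *)
Let N k : int := Num.floor ((p k)%:R * alpha / pi).
Let X k := modpi ((p k)%:R * alpha).
Let XE k : (p k)%:R * alpha = X k + (N k)%:~R * pi. Proof. by rewrite /X /modpi subrK. Qed.
Let c k : R := (N k)%:~R * pi.

Let speed k (t : R) := `|2 * wronskian alpha (p k) t / (p k)%:R|.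

Let continuous_speed k : continuous (speed k).
Proof.
move=> t; apply: (@continuous_comp _ _ _ (fun t => 2 * wronskian alpha (p k) t / (p k)%:R) Num.norm); last exact: norm_continuous.
apply: cvgM; last exact: cvg_cst.
by apply: cvgM; [exact: cvg_cst|exact: continuous_wronskian].
Qed.

Let speedD2pi k t : speed k (t + 2 * pi) = speed k t.
Proof. by rewrite /speed wronskianD2pi. Qed.

Let T k s u := two_scale (2 * pi) (p k) (c k) s u.

Let T_cvg s u : (fun k => T k s u) @ \oo --> s.
Proof.
apply: (@squeeze_cvgr _ _ _ _ (fun=> s) (fun k => s + (p k)%:R^-1 * (2 * pi))).
- apply: nearW => k; have /andP[h1 h2] := wrap_itv L_gt0 (u + c k - (p k)%:R * s).
  have i0 : 0 <= (p k)%:R^-1 :> R by rewrite invr_ge0.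
  rewrite /T /two_scale lerDl mulr_ge0//= lerD2l ler_wpM2l//; exact: ltW.
- exact: cvg_cst.
- rewrite -[X in _ --> X]addr0 -(mul0r (2 * pi)); apply: cvgD; first exact: cvg_cst.
  by apply: cvgM => //; exact: cvg_cst.
Qed.

(** At [T k s u], n t equals u + N pi modulo 2 pi, and n alpha = X + N pi. Subtracting cancels N pi;
    adding, in [sin_fast_p], doubles it into a multiple of 2 pi. Halving leaves a multiple of pi,
    that is a sign, in both cases. *)
Let sin_fast_m k s u : exists b : bool,
  sin ((p k)%:R * ((T k s u - alpha) / 2)) = (- 1) ^+ b * sin ((u - X k) / 2).
Proof.
have [j jE] := wrapE (2 * pi) (u + c k - (p k)%:R * s).
have [b [h _]] := sin_cosDintpi (- j) ((u - X k) / 2); exists b; rewrite -h; congr sin.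
rewrite /T /two_scale jE mulrNz.
have := XE k; rewrite /c; move: (nR k) => n0 e.
have -> : alpha = (X k + (N k)%:~R * pi) / (p k)%:R by rewrite -e; field; rewrite gt_eqF.
by field; rewrite gt_eqF.
Qed.

Let sin_fast_p k s u : exists b : bool,
  sin ((p k)%:R * ((T k s u + alpha) / 2)) = (- 1) ^+ b * sin ((u + X k) / 2).
Proof.
have [j jE] := wrapE (2 * pi) (u + c k - (p k)%:R * s).
have [b [h _]] := sin_cosDintpi (N k - j) ((u + X k) / 2); exists b; rewrite -h; congr sin.
rewrite /T /two_scale jE intrB.
have := XE k; rewrite /c; move: (nR k) => n0 e.
have -> : alpha = (X k + (N k)%:~R * pi) / (p k)%:R by rewrite -e; field; rewrite gt_eqF.
by field; rewrite gt_eqF.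
Qed.

Let sin_slow k : exists b : bool, sin ((p k)%:R * alpha) = (- 1) ^+ b * sin (X k).
Proof. by have [b [h _]] := sin_cosDintpi (N k) (X k); exists b; rewrite XE. Qed.

Let den (y s u : R) := sin ((u - y) / 2) ^+ 2 * sin ((s + alpha) / 2) ^+ 2 +
  sin ((u + y) / 2) ^+ 2 * sin ((s - alpha) / 2) ^+ 2.

Let den_ge0 y s u : 0 <= den y s u.
Proof. by rewrite addr_ge0// -exprMn sqr_ge0. Qed.

Let den_gt0 s u : sin ((s - alpha) / 2) != 0 -> sin ((s + alpha) / 2) != 0 -> 0 < den x s u.
Proof.
move=> sm sp; rewrite lt_neqAle den_ge0 andbT eq_sym; apply/eqP => /eqP.
rewrite /den -!exprMn paddr_eq0 ?sqr_ge0// !sqrf_eq0 !mulf_eq0 (negbTE sm) (negbTE sp) !orbF.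
move=> /andP[/eqP h1 /eqP h2].
have : sin x = sin ((u + x) / 2) * cos ((u - x) / 2) - cos ((u + x) / 2) * sin ((u - x) / 2).
  by rewrite -sinB; congr sin; field.
by rewrite h1 h2 mul0r mulr0 subrr => e; move: sx_gt0; rewrite e ltxx.
Qed.

Let sgn (b : bool) (y : R) : `|(- 1) ^+ b * y| = `|y|.
Proof. by rewrite normrM normr_sign mul1r. Qed.

Let sgn2 (b : bool) (y : R) : ((- 1) ^+ b * y) ^+ 2 = y ^+ 2.
Proof. by rewrite exprMn sqrr_sign mul1r. Qed.

(** The unknown signs disappear in absolute values and squares. The term with sin alpha is at most 1
    / n, and slow sines near nonzero limits are nonzero, so [wronskianE] eventually applies. *)
Let speed_T_cvg s u : sin ((s - alpha) / 2) != 0 -> sin ((s + alpha) / 2) != 0 ->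
  (fun k => speed k (T k s u)) @ \oo --> `|g_fun alpha x s u|.
Proof.
move=> sm sp.
have csin (f : R -> R) : continuous f -> continuous (fun t => sin (f t)).
  by move=> cf t; apply: (@continuous_comp _ _ _ f sin); [exact: cf|exact: continuous_sin].
have comp (f : R -> R) (v : R^nat) (y : R) : continuous f -> v @ \oo --> y -> (fun k => f (v k)) @ \oo --> f y.
  by move=> cf vy; exact: (cvg_comp _ _ vy (cf y)).
have cm : continuous (fun t : R => sin ((t - alpha) / 2)).
  by apply: csin => t; apply: cvgM; [apply: cvgB; [exact: cvg_id|exact: cvg_cst]|exact: cvg_cst].
have cp : continuous (fun t : R => sin ((t + alpha) / 2)).
  by apply: csin => t; apply: cvgM; [apply: cvgD; [exact: cvg_id|exact: cvg_cst]|exact: cvg_cst].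
have cum : continuous (fun y : R => sin ((u - y) / 2)).
  by apply: csin => t; apply: cvgM; [apply: cvgB; [exact: cvg_cst|exact: cvg_id]|exact: cvg_cst].
have cup : continuous (fun y : R => sin ((u + y) / 2)).
  by apply: csin => t; apply: cvgM; [apply: cvgD; [exact: cvg_cst|exact: cvg_id]|exact: cvg_cst].
have Tm : (fun k => sin ((T k s u - alpha) / 2)) @ \oo --> sin ((s - alpha) / 2).
  by have := comp (fun t : R => sin ((t - alpha) / 2)) (fun k => T k s u) s cm (@T_cvg s u).
have Tp : (fun k => sin ((T k s u + alpha) / 2)) @ \oo --> sin ((s + alpha) / 2).
  by have := comp (fun t : R => sin ((t + alpha) / 2)) (fun k => T k s u) s cp (@T_cvg s u).
have Um : (fun k => sin ((u - X k) / 2)) @ \oo --> sin ((u - x) / 2).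
  by have := comp (fun y : R => sin ((u - y) / 2)) X x cum X_cvg.
have Up : (fun k => sin ((u + X k) / 2)) @ \oo --> sin ((u + x) / 2).
  by have := comp (fun y : R => sin ((u + y) / 2)) X x cup X_cvg.
have SX : (fun k => sin (X k)) @ \oo --> sin x.
  by have := comp sin X x (@continuous_sin R) X_cvg.
have sq (v : R^nat) (l : R) : v @ \oo --> l -> (fun k => v k ^+ 2) @ \oo --> l ^+ 2.
  by move=> vl; exact: (cvg_comp _ _ vl (@exprn_continuous R 2 l)).
pose num k := (p k)%:R^-1 * sin alpha * sin ((p k)%:R * ((T k s u - alpha) / 2)) * sin ((p k)%:R * ((T k s u + alpha) / 2)) -
   sin ((p k)%:R * alpha) * sin ((T k s u - alpha) / 2) * sin ((T k s u + alpha) / 2).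
pose dk k := sin ((u - X k) / 2) ^+ 2 * sin ((T k s u + alpha) / 2) ^+ 2 +
  sin ((u + X k) / 2) ^+ 2 * sin ((T k s u - alpha) / 2) ^+ 2.
have dk_cvg : dk @ \oo --> den x s u.
  by apply: cvgD; apply: cvgM; exact: sq.
pose main k := `|sin (X k)| * `|sin ((T k s u - alpha) / 2)| * `|sin ((T k s u + alpha) / 2)|.
have main_cvg : main @ \oo --> `|sin x| * `|sin ((s - alpha) / 2)| * `|sin ((s + alpha) / 2)|.
  by apply: cvgM; [apply: cvgM|]; exact: cvg_norm.
have num_cvg : (fun k => `|num k|) @ \oo --> `|sin x| * `|sin ((s - alpha) / 2)| * `|sin ((s + alpha) / 2)|.
  apply: (@squeeze_cvgr _ _ _ _ (fun k => main k - (p k)%:R^-1) (fun k => main k + (p k)%:R^-1)).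
  - apply: nearW => k; have [b bE] := sin_slow k.
    have e1 : main k = `|sin ((p k)%:R * alpha) * sin ((T k s u - alpha) / 2) * sin ((T k s u + alpha) / 2)|.
      by rewrite !normrM bE sgn.
    have e2 : `|(p k)%:R^-1 * sin alpha * sin ((p k)%:R * ((T k s u - alpha) / 2)) *
        sin ((p k)%:R * ((T k s u + alpha) / 2))| <= (p k)%:R^-1.
      have s1 (y : R) : `|sin y| <= 1 by rewrite ler_norml sin_geN1 sin_le1.
      rewrite -!mulrA normrM ger0_norm ?invr_ge0// ler_piMr ?invr_ge0//.
      by rewrite !normrM !mulr_ile1 ?mulr_ge0// mulr_ile1.
    rewrite e1 /num; move: e2; set y := _ * _ * _ * sin _; set z := _ * _ * sin _ => e2.
    have h1 := ler_dist_dist z y; have h2 := ler_normB y z.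
    have h3 := ler_normD (y - z) (- y); rewrite normrN in h3.
    have h4 : `|y - z + - y| = `|z| by rewrite -[RHS]normrN; congr `|_|; ring.
    rewrite h4 in h3.
    by apply/andP; split; lra.
  - by rewrite -[X in _ --> X]subr0; apply: cvgB.
  - by rewrite -[X in _ --> X]addr0; apply: cvgD.
have -> : `|g_fun alpha x s u| = `|sin x| * `|sin ((s - alpha) / 2)| * `|sin ((s + alpha) / 2)| / den x s u.
  by rewrite /g_fun normrM normfV !normrM (ger0_norm (den_ge0 x s u)).
have quot : (fun k => `|num k| / dk k) @ \oo --> `|sin x| * `|sin ((s - alpha) / 2)| * `|sin ((s + alpha) / 2)| / den x s u.
  by apply: cvgM => //; apply: cvgV => //; rewrite gt_eqF// den_gt0.
move: quot; apply: cvg_trans; apply: near_eq_cvg.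
have nm : \forall k \near \oo, sin ((T k s u - alpha) / 2) != 0 by apply: (cvgr_neq0 _ Tm sm).
have np : \forall k \near \oo, sin ((T k s u + alpha) / 2) != 0 by apply: (cvgr_neq0 _ Tp sp).
near=> k.
have h1 : sin ((T k s u - alpha) / 2) != 0 by near: k.
have h2 : sin ((T k s u + alpha) / 2) != 0 by near: k.
rewrite /speed wronskianE// -/(num k) normrM normfV.
have [b1 e1] := sin_fast_m k s u; have [b2 e2] := sin_fast_p k s u.
by rewrite e1 e2 !sgn2 -/(dk k) (ger0_norm (_ : 0 <= dk k))// addr_ge0// -exprMn sqr_ge0.
Unshelve. all: by end_near. Qed.

Let I : set R := `[0, 2 * pi[%classic.
Let D : set (R * R) := I `*` I.
Let mI : measurable I. Proof. exact: measurable_itv. Qed.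
Let mD : measurable D. Proof. exact: measurableX. Qed.
Let muI : mu I = (2 * pi)%:E.
Proof. by rewrite /I lebesgue_measure_itv/= lte_fin L_gt0 oppr0 addr0. Qed.
Let muD : (mu \x mu)%E D = (4 * pi ^+ 2)%:E.
Proof.
have /= -> := @product_measure1E _ _ _ _ _ mu mu I I mI mI.
by rewrite muI -EFinM; congr EFin; ring.
Qed.

Let exceptional : set R := [set s | sin ((s - alpha) / 2) = 0 \/ sin ((s + alpha) / 2) = 0].

Let exceptional_null : measurable exceptional /\ mu exceptional = 0%E.
Proof.
suff ce : countable exceptional.
  split; last exact: countable_lebesgue_measure0.
  exact: countable_measurable.
have zero (y : R) : sin (y / 2) = 0 -> exists k : int, y = 2 * (k%:~R * pi).
  move=> sy; apply: contrapT => h; have : sin (y / 2) != 0.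
    by apply: sin_neq0 => k kE; apply: h; exists k; rewrite -kE; field.
  by rewrite sy eqxx.
(* The exceptional values of s are alpha and - alpha modulo 2 pi. *)
pose lattice (z : bool * int) : R := (if z.1 then alpha else - alpha) + 2 * (z.2%:~R * pi).
apply: (@sub_countable _ _ _ (\bigcup_(z in [set: bool * int]) [set lattice z])).
  apply: subset_card_le => s [/zero[k kE]|/zero[k kE]].
    by exists (true, k) => //=; rewrite /lattice/= -kE; ring.
  by exists (false, k) => //=; rewrite /lattice/= -kE; ring.
by apply: bigcup_countable => [|z _]; [exact: countableP|exact: countable1].
Qed.

Let mg : measurable_fun setT (fun q : R * R => `|g_fun alpha x q.1 q.2|).
Proof.
have msin (f : R * R -> R) : measurable_fun setT f -> measurable_fun setT (fun q => sin (f q)).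
  by move=> mf; apply: (measurableT_comp _ mf); apply: continuous_measurable_fun; exact: continuous_sin.
have m1 : measurable_fun setT (fun q : R * R => q.1) by exact: measurable_fst.
have m2 : measurable_fun setT (fun q : R * R => q.2) by exact: measurable_snd.
have half (f : R * R -> R) (y : R) : measurable_fun setT f -> measurable_fun setT (fun q => sin ((f q + y) / 2)).
  by move=> mf; apply: msin; apply: measurable_funM => //; exact: measurable_funD.
apply: measurableT_comp => //; apply: measurable_funM.
  by apply: measurable_funM; [apply: measurable_funM => //; exact: half|exact: half].
apply: (measurableT_comp measurable_inv).
by apply: measurable_funD; apply: measurable_funM; apply: measurable_funX; exact: half.
Qed.

Let mspeed k : measurable_fun setT (fun q : R * R => speed k (T k q.1 q.2)).
Proof.
have mT : measurable_fun setT (fun q : R * R => T k q.1 q.2) by exact: measurable_two_scale.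
exact: (measurableT_comp (continuous_measurable_fun (@continuous_speed k)) mT).
Qed.

Let average (G : R -> R) k : continuous G -> (forall t, 0 <= G t) -> (forall t, G (t + 2 * pi) = G t) ->
  (\int[mu \x mu]_(q in D) (G (T k q.1 q.2))%:E = (2 * pi)%:E * \int[mu]_(t in I) (G t)%:E)%E.
Proof.
move=> cG G0 Gp.
have mG : measurable_fun setT (fun t => (G t)%:E).
  by apply/measurable_EFinP; exact: continuous_measurable_fun.
rewrite ge0_integral_setX//; last 2 first.
- apply/measurable_EFinP.
  have mT : measurable_fun setT (fun q : R * R => T k q.1 q.2) by exact: measurable_two_scale.
  exact: (measurableT_comp (continuous_measurable_fun cG) mT).
- by move=> q; rewrite lee_fin.
rewrite -(@integral_two_scale R (2 * pi) (fun t => (G t)%:E) (p k) (c k))//.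
by move=> t; rewrite Gp.
Qed.

Let speed_le k : (\int[mu \x mu]_(q in D) (speed k (T k q.1 q.2))%:E <=
  (4 * pi ^+ 2 * (1 + 2 * (p k)%:R^-1))%:E)%E.
Proof.
rewrite (average k (@continuous_speed k) (fun t => normr_ge0 _) (speedD2pi k)).
have -> : (\int[mu]_(t in I) (speed k t)%:E =
    \int[mu]_(t in I) ((2 / (p k)%:R)%:E * (`|wronskian alpha (p k) t|)%:E))%E.
  apply: eq_integral => t _; rewrite -EFinM /speed; congr EFin.
  by rewrite mulrAC normrM ger0_norm// divr_ge0.
rewrite ge0_integralZl//; last first.
  apply/measurable_EFinP; apply: measurable_funTS; apply: measurableT_comp => //.
  by apply: continuous_measurable_fun; exact: continuous_wronskian.
apply: (@le_trans _ _ ((2 * pi)%:E * ((2 / (p k)%:R)%:E * (pi * (p k).+2%:R)%:E))%E).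
  apply: lee_wpmul2l; first by rewrite lee_fin ltW.
  by apply: lee_wpmul2l => //; rewrite lee_fin divr_ge0.
rewrite -!EFinM lee_fin le_eqVlt; apply/orP; left; apply/eqP.
rewrite -addn2 natrD; field; by rewrite gt_eqF.
Qed.

(** By periodicity u may be shifted by x, after which the integrand is the Poisson kernel of
    parameter [l]. *)
Let inner_ge s : ~ exceptional s ->
  ((2 * pi)%:E <= \int[mu]_(u in I) (`|g_fun alpha x s u|)%:E)%E.
Proof.
move=> /not_orP[/eqP sm /eqP sp].
pose l := `|sin ((s - alpha) / 2) / sin ((s + alpha) / 2)|.
have l0 : 0 < l by rewrite normr_gt0 mulf_neq0// invr_neq0.
have m1 : measurable_fun setT (fun u => (`|g_fun alpha x s u|)%:E).
  by apply/measurable_EFinP; exact: (measurableT_comp mg (pair1_measurable s)).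
have per u : (`|g_fun alpha x s (u + 2 * pi)|)%:E = (`|g_fun alpha x s u|)%:E.
  rewrite /g_fun.
  have -> : (u + 2 * pi - x) / 2 = (u - x) / 2 + pi by field.
  have -> : (u + 2 * pi + x) / 2 = (u + x) / 2 + pi by field.
  by rewrite !sinDpi !sqrrN.
rewrite -(@ge0_integral_periodic _ _ L_gt0 (fun u => (`|g_fun alpha x s u|)%:E) m1 _ per x); last first.
  by move=> t; rewrite lee_fin.
have -> : (\int[mu]_(u in `[0%R, (2 * pi)%R[) (`|g_fun alpha x s (u + x)|)%:E =
    \int[mu]_(u in `[0%R, (2 * pi)%R[) (l * sin x / poisson_den x l u)%:E)%E.
  apply: eq_integral => u _; congr EFin; have := den_gt0 (u + x) sm sp.
  rewrite /g_fun /poisson_den /l /den.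
  have -> : (u + x - x) / 2 = u / 2 by field.
  have -> : (u + x + x) / 2 = u / 2 + x by field.
  move=> D0; rewrite normrM normfV (gtr0_norm D0) !normrM normfV (gtr0_norm sx_gt0).
  move: D0; rewrite -(real_normK (num_real (sin ((s - alpha) / 2)))).
  rewrite -(real_normK (num_real (sin ((s + alpha) / 2)))).
  have : `|sin ((s + alpha) / 2)| != 0 by rewrite normr_eq0.
  move: `|_| `|_| => A B A0 D0; field.
  by rewrite A0 /= !exprMn mulrC [X in _ + X]mulrC [X in X + _]mulrC gt_eqF.
exact: poisson_integral.
Qed.

Let g_ge : ((4 * pi ^+ 2)%:E <= \int[mu \x mu]_(q in D) (`|g_fun alpha x q.1 q.2|)%:E)%E.
Proof.
have mg' : measurable_fun setT (fun q : R * R => (`|g_fun alpha x q.1 q.2|)%:E) by exact/measurable_EFinP.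
rewrite ge0_integral_setX//.
have -> : (4 * pi ^+ 2)%:E = (\int[mu]_(s in I) (2 * pi)%:E)%E.
  have /= -> := @integral_cst _ _ _ mu _ mI (2 * pi)%:E.
  by rewrite muI -EFinM; congr EFin; ring.
apply: ae_ge0_le_integral => //.
- by move=> s _; rewrite lee_fin ltW.
- by move=> s _; apply: integral_ge0 => u _; rewrite lee_fin.
- by apply: measurable_funTS; apply: (measurable_integral_section mu mI mg') => q; rewrite lee_fin.
- have [me e0] := exceptional_null.
  exists exceptional; split => // s h; apply: contrapT => hs; apply: h => _.
  exact: inner_ge.
Qed.

Let speed_cvg_ae : {ae (mu \x mu)%E, forall q, D q ->
  (fun k => speed k (T k q.1 q.2)) @ \oo --> `|g_fun alpha x q.1 q.2|}.
Proof.
have [me e0] := exceptional_null.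
exists (exceptional `*` setT); split.
- exact: measurableX.
- have /= -> := @product_measure1E _ _ _ _ _ mu mu exceptional setT me measurableT.
  by rewrite e0 mul0e.
- move=> q h; split => //; apply: contrapT => /not_orP[/eqP h1 /eqP h2]; apply: h => _.
  exact: speed_T_cvg.
Qed.

(** Factoring n / 2 out of the square root leaves (n + 1) / n = 1 + 1 / n, whose excess is the
    perturbation [e] of the Scheffe section. The constants (1 / n)(1 / pi)(n / 2) and the averaging
    factor 1 / (2 pi) multiply to 1 / (4 pi^2). The closed square of [ell] and the half-open [D]
    differ by a null set. *)
Lemma ell_lim : ell alpha x \is a fin_num /\
  (fun k => ((p k)%:R^-1 * pi^-1)%:E * \int[mu]_(t in `[0%R, (2 * pi)%R[)
    (Num.sqrt (((p k).+1%:R / 2) ^+ 2 + wronskian alpha (p k) t ^+ 2))%:E)%E @ \oo --> ell alpha x.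
Proof.
have c_cvg : (fun k => 4 * pi ^+ 2 * (1 + 2 * (p k)%:R^-1) : R) @ \oo --> 4 * pi ^+ 2.
  suff : (fun k => 4 * pi ^+ 2 * (1 + 2 * (p k)%:R^-1) : R) @ \oo --> 4 * pi ^+ 2 * (1 + 2 * 0).
    by rewrite mulr0 addr0 mulr1.
  apply: cvgM; first exact: cvg_cst.
  by apply: cvgD; [exact: cvg_cst|apply: cvgM => //; exact: cvg_cst].
have [fin lim] := @cvg_integral_sqrt _ _ R (mu \x mu)%E D (fun k q => speed k (T k q.1 q.2))
  (fun q => `|g_fun alpha x q.1 q.2|) (fun k => (p k)%:R^-1) _ _ _ mD muD
  (fun k => measurable_funTS (mspeed k)) (measurable_funTS mg)
  (fun k q => normr_ge0 _) (fun q => normr_ge0 _) speed_cvg_ae speed_le c_cvg g_ge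
  (fun k => ltac:(by rewrite invr_ge0)) p_cvg.
have ellE : ell alpha x = ((4 * pi ^+ 2)^-1%:E *
    \int[mu \x mu]_(q in D) (Num.sqrt (1 + `|g_fun alpha x q.1 q.2| ^+ 2))%:E)%E.
  have mh : measurable_fun setT (fun q : R * R => (Num.sqrt (1 + `|g_fun alpha x q.1 q.2| ^+ 2))%:E).
    apply/measurable_EFinP; apply: (measurableT_comp (continuous_measurable_fun (@sqrt_continuous R))).
    by apply: measurable_funD => //; exact: measurable_funX.
  have h0 (q : R * R) : (0 <= (Num.sqrt (1 + `|g_fun alpha x q.1 q.2| ^+ 2))%:E)%E by rewrite lee_fin sqrtr_ge0.
  have mI' : measurable `[0, 2 * pi : R]%classic by exact: measurable_itv.
  have half (f : R -> \bar R) : measurable_fun setT f -> (\int[mu]_(t in `[0%R, (2 * pi)%R]) f t = \int[mu]_(t in I) f t)%E.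
    by move=> mf; rewrite -integral_itv_bndo_bndc//; exact: measurable_funTS.
  rewrite /ell; congr (_ * _)%E.
  rewrite (ge0_integral_setX mu mu mI' mI' mh h0) (ge0_integral_setX mu mu mI mI mh h0).
  rewrite half; last exact: (measurable_integral_section mu mI' mh h0).
  apply: eq_integral => s _; rewrite half//.
  exact: (measurableT_comp mh (pair1_measurable s)).
rewrite ellE; split.
  by rewrite fin_numM.
have -> : (fun k => ((p k)%:R^-1 * pi^-1)%:E * \int[mu]_(t in `[0%R, (2 * pi)%R[)
    (Num.sqrt (((p k).+1%:R / 2) ^+ 2 + wronskian alpha (p k) t ^+ 2))%:E)%E =
   (fun k => (4 * pi ^+ 2)^-1%:E * \int[mu \x mu]_(q in D)
     (Num.sqrt ((1 + (p k)%:R^-1) ^+ 2 + speed k (T k q.1 q.2) ^+ 2))%:E)%E.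
  apply/funext => k; have n0 := nR k.
  pose G t := Num.sqrt ((1 + (p k)%:R^-1) ^+ 2 + speed k t ^+ 2).
  have cG : continuous G.
    move=> t; apply: (@continuous_comp _ _ _ (fun t => (1 + (p k)%:R^-1) ^+ 2 + speed k t ^+ 2) (@Num.sqrt R)); last exact: sqrt_continuous.
    apply: cvgD; first exact: cvg_cst.
    by apply: (@continuous_comp _ _ _ (speed k) (fun y => y ^+ 2)); [exact: continuous_speed|exact: exprn_continuous].
  have G0 t : 0 <= G t by exact: sqrtr_ge0.
  have Gp t : G (t + 2 * pi) = G t by rewrite /G speedD2pi.
  rewrite (average k cG G0 Gp).
  have -> : (\int[mu]_(t in `[0%R, (2 * pi)%R[)
      (Num.sqrt (((p k).+1%:R / 2) ^+ 2 + wronskian alpha (p k) t ^+ 2))%:E =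
    \int[mu]_(t in I) (((p k)%:R / 2)%:E * (G t)%:E))%E.
    apply: eq_integral => t _; rewrite -EFinM; congr EFin.
    have n20 : 0 <= (p k)%:R / 2 :> R by rewrite divr_ge0.
    rewrite -[X in X * G t](ger0_norm n20) -sqrtr_sqr /G -sqrtrM ?sqr_ge0//; congr Num.sqrt.
    rewrite /speed real_normK ?num_real// -natr1; field; by rewrite gt_eqF.
  rewrite ge0_integralZl//; last 2 first.
  - by apply/measurable_EFinP; apply: measurable_funTS; exact: continuous_measurable_fun.
  - by move=> t _; rewrite lee_fin.
  rewrite !muleA -!EFinM; congr (_%:E * _)%E.
  move: (p0) n0; move: (pi : R) ((p k)%:R : R) => q m q0 m0; field.
  by rewrite !gt_eqF.
by apply: cvgeZl.
Qed.
End two_scale_limit.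

(** * Irrational angles and the limit along the subsequence *)

Lemma sin_natM_neq0 (R : realType) (alpha : R) (n : nat) : (forall q : rat, alpha <> pi * ratr q) ->
  (0 < n)%N -> sin (n%:R * alpha) != 0.
Proof.
move=> irr n0; apply: sin_neq0 => k kE; apply: (irr (k%:~R / n%:R)).
have nR : n%:R != 0 :> R by rewrite pnatr_eq0 -lt0n.
rewrite fmorph_div/= rmorph_int rmorph_nat.
by rewrite mulrCA mulrA -kE mulrAC mulfV// mul1r.
Qed.

Unset Implicit Arguments.

Theorem corollary1p2 (R : realType) (d : measure_display) (T : measurableType d)
  (P : probability T R) (a b : nat -> {RV P >-> R}) (alpha x : R)
  (phi : nat -> nat)
  (alpha_ge0 : 0 <= alpha)
  (alpha_irr : forall q : rat, alpha <> pi * ratr q)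
  (a_gauss : centered_gaussian_process_cov
               (fun m : int => cos (m%:~R * alpha)) a)
  (b_gauss : centered_gaussian_process_cov
               (fun m : int => cos (m%:~R * alpha)) b)
  (ab_indep : independent_processes a b)
  (ab_uncorr : forall k l, (0 < k)%N -> (0 < l)%N -> ('E_P[(a k \* b l)%R] = 0)%E)
  (x_in : 0 < x < pi)
  (phi_gt0 : forall n, (0 < n)%N -> (0 < phi n)%N)
  (phi_incr : forall m n, (0 < m)%N -> (m < n)%N -> (phi m < phi n)%N)
  (phi_cvg : modpi ((phi n)%:R * alpha) @[n --> \oo] --> x) :
  (`| (((phi n)%:R)^-1)%:E *
        \int[P]_w nb_zeros (trig_poly a b (phi n) w) `[0%R, (2 * pi)%R]
      - ell alpha x |)%E @[n --> \oo] --> 0%E.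
Proof.
(* [phi] is constrained from index 1 on, so the sequence is shifted by one; limits at infinity are
   unaffected. *)
pose p k := phi k.+1.
have p_gt0 k : (0 < p k)%N by exact: phi_gt0.
have sin_pa k : sin ((p k)%:R * alpha) != 0 by exact: sin_natM_neq0.
have p_ge k : (k.+1 <= p k)%N.
  by elim: k => [|k ih]; [exact: p_gt0|exact: (leq_ltn_trans ih (phi_incr k.+1 k.+2 _ _))].
have p_cvg : (fun k => (p k)%:R^-1 : R) @ \oo --> (0 : R).
  apply: (squeeze_cvgr _ (cvg_cst 0) (@cvg_harmonic R)); apply: nearW => k.
  by rewrite /harmonic/= invr_ge0 ler0n lef_pV2 ?posrE ?ltr0n// ler_nat p_ge.
have X_cvg : (fun k => modpi ((p k)%:R * alpha)) @ \oo --> x.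
  by have := phi_cvg; rewrite -(cvg_shiftS (fun n => modpi ((phi n)%:R * alpha))).
have [fin lim] := ell_lim x_in p_gt0 sin_pa p_cvg X_cvg
  (fun k => wronskian_variation a_gauss b_gauss ab_indep (sin_pa k)).
pose E n := (((phi n)%:R^-1)%:E * \int[P]_w nb_zeros (trig_poly a b (phi n) w) `[0%R, (2 * pi)%R])%E.
have EE k : E k.+1 = (((p k)%:R^-1 * pi^-1)%:E * \int[lebesgue_measure]_(t in `[0%R, (2 * pi)%R[)
    (Num.sqrt (((p k).+1%:R / 2) ^+ 2 + wronskian alpha (p k) t ^+ 2))%:E)%E.
  by rewrite /E (expected_nb_zeros a_gauss b_gauss ab_indep (p_gt0 k) (sin_pa k)) muleA -EFinM.
rewrite -(funext EE) in lim.
have E_cvg : E @ \oo --> ell alpha x by rewrite -cvg_shiftS; exact: lim.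
have Eell : (fun n => E n - ell alpha x)%E @ \oo --> (ell alpha x - ell alpha x)%E.
  by apply: cvgeB => //; [rewrite fin_num_adde_defl// fin_numN|exact: cvg_cst].
by move: Eell; rewrite subee// => Eell; rewrite -(@abse0 R); exact: (cvg_abse Eell).
Qed.
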